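(* Let $\Phi$ be an irreducible and reduced root system of type $t \neq F_4$ in a finite-dimensional real inner product space $(V,\langle\,,\,\rangle)$, with Weyl group $W$ and Coxeter number $h$. Let $P \subseteq V$ be a symmetric alcoved polytope of type $t$. Then $P$ has a generating set consisting of $h$ vertices of $P$.
   Context: An (generalized) alcoved polytope of type $t$ is a bounded set of the form $\bigcap_{a \in \Psi}\{x \in V : \langle a, x\rangle \le c_a\}$, where $\Psi$ is a subset of a root system $\Phi$ of type $t$ in $V$ and $c_a \in \mathbb{R}$. The Weyl group $W$ is the group of orthogonal maps of $V$ generated by the reflections in the hyperplanes $\{x : \langle a,x\rangle = 0\}$, $a \in \Phi$. An alcoved polytope is symmetric if it is invariant under the action of $W$. A subset $\Sigma \subseteq V$ is a generating set of an alcoved polytope $P$ if $P$ is the smallest alcoved polytope (for the root system $\Phi$) in $V$ containing $\Sigma$. The Coxeter number $h$ is the order in $W$ of a Coxeter element $s_{b_1}\circ\cdots\circ s_{b_n}$, where $b_1,\dots,b_n$ is a basis of simple roots of $\Phi$ and $s_b$ is the reflection associated to $b$.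
   Formalization: P is assumed nonempty (the empty set has no vertices), and the h vertices are claimed to be pairwise distinct only when P is not the single point {0}, which has one vertex although h ≥ 2; for P = {0} they may repeat. *)

(* Defs.v *)
From HB Require Import structures.
From mathcomp Require Import all_boot all_order all_algebra.
From mathcomp Require Import finmap boolp classical_sets reals.

Set Implicit Arguments.
Unset Strict Implicit.
Unset Printing Implicit Defensive.

Import Order.TTheory GRing.Theory Num.Theory.
Local Open Scope ring_scope.

Section RootSystems.
Variables (R : realType) (V : vectType R) (ip : {dot V for idfun}).
Implicit Types (Phi : {fset V}) (P : set V) (a b : V).

Definition cartan_number a b : R := 2 * ip a b / ip b b.

Definition reflection a (x : V) : V := x - cartan_number x a *: a.

Definition root_system Phi : Prop :=
  [/\ 0 \notin Phi,
      (<< enum_fset Phi >> = fullv)%VS,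
      (forall a b, a \in Phi -> b \in Phi -> reflection a b \in Phi)
    & (forall a b, a \in Phi -> b \in Phi ->
         exists z : int, cartan_number a b = z%:~R)].

Definition reduced Phi : Prop :=
  forall a (t : R), a \in Phi -> t *: a \in Phi -> t = 1 \/ t = -1.

Definition irreducible Phi : Prop :=
  Phi <> fset0 /\
  forall A : {fset V}, {subset A <= Phi} ->
    (forall a b, a \in A -> b \in Phi -> b \notin A -> ip a b = 0) ->
    A = fset0 \/ A = Phi.

(* Inverses are required as in any generated group, although they are
   redundant here because reflections are involutions. *)
Inductive weyl_group Phi : (V -> V) -> Prop :=
| weyl_reflection a : a \in Phi -> weyl_group Phi (reflection a)
| weyl_id : weyl_group Phi id
| weyl_comp f g :
    weyl_group Phi f -> weyl_group Phi g -> weyl_group Phi (f \o g)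
| weyl_inv f g :
    weyl_group Phi f -> cancel f g -> cancel g f -> weyl_group Phi g.

Definition simple_roots Phi (b : seq V) : Prop :=
  [/\ {subset b <= Phi},
      basis_of fullv b
    & (forall a, a \in Phi -> exists k : 'I_(size b) -> nat,
         a = \sum_(i < size b) b`_i *+ k i \/
         a = - \sum_(i < size b) b`_i *+ k i)].

Definition coxeter_element (b : seq V) : V -> V :=
  foldr (fun a f => reflection a \o f) id b.

Definition has_order (f : V -> V) (h : nat) : Prop :=
  [/\ (0 < h)%N,
      iter h f =1 id
    & (forall k, (0 < k < h)%N -> ~ (iter k f =1 id))].

(* The order does not depend on the choice of the simple roots b, nor on
   their ordering. *)
Definition coxeter_number Phi (h : nat) : Prop :=
  exists b : seq V, simple_roots Phi b /\ has_order (coxeter_element b) h.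

Definition F4_cartan : seq (seq int) :=
  [:: [::  2; -1;  0;  0];
      [:: -1;  2; -2;  0];
      [::  0; -1;  2; -1];
      [::  0;  0; -1;  2]].

Definition type_F4 Phi : Prop :=
  exists b : seq V,
    [/\ simple_roots Phi b, size b = 4%N
      & (forall i j, (i < 4)%N -> (j < 4)%N ->
           cartan_number b`_i b`_j = (nth 0 (nth [::] F4_cartan i) j)%:~R)].

Definition bounded P : Prop :=
  exists M : R, forall x, P x -> Num.sqrt (ip x x) <= M.

Definition alcoved_polytope Phi P : Prop :=
  bounded P /\
  exists (Psi : {fset V}) (c : V -> R),
    {subset Psi <= Phi} /\
    P = [set x | forall a, a \in Psi -> ip a x <= c a]%classic.

Definition weyl_symmetric Phi P : Prop :=
  forall w, weyl_group Phi w -> (w @` P = P)%classic.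

Definition generating_set Phi P (S : set V) : Prop :=
  [/\ alcoved_polytope Phi P,
      (S `<=` P)%classic
    & (forall Q : set V,
         alcoved_polytope Phi Q -> (S `<=` Q)%classic -> (P `<=` Q)%classic)].

(* A vertex is a zero-dimensional face: the linear form <u, .> attains its
   maximum over P exactly at v. *)
Definition vertex P (v : V) : Prop :=
  P v /\ exists u : V, forall x, P x -> x <> v -> ip u x < ip u v.

End RootSystems.

(* Main.v *)
Require Import Defs.
From HB Require Import structures.
From mathcomp Require Import all_boot all_order all_algebra.
From mathcomp Require Import finmap boolp classical_sets reals.
From mathcomp Require Import perm zify ring lra.

Set Implicit Arguments.
Unset Strict Implicit.
Unset Printing Implicit Defensive.

Import Order.TTheory GRing.Theory Num.Theory.
Local Open Scope ring_scope.
Local Arguments orthogonal : simpl never.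

(* P is cut out by the inequalities <a, x> <= H(a), where a runs over all roots and the
   support function H of P is constant on the Weyl orbits of roots. A point of P is a
   vertex as soon as the roots that attain their support at it span V, and such points
   generate P as soon as every root attains its support at one of them. So h such points
   have to be found, in coordinates adapted to the Dynkin diagram: the vertices of a
   simplex in type A, points whose coordinates are all but one of the same absolute value
   in types B and C, points whose coordinates are all of the same absolute value in type
   D. In types E and G2 they form the orbit of one vertex under a Coxeter element; that
   its h elements are distinct and reach every root is a finite computation with integer
   coordinates of the roots.
   The Dynkin diagram is classified by growing it from one node, a leaf at a time:
   Bessel's inequality limits the bonds of every node, and of every arm contracted to a
   node. As it is a tree, the Coxeter elements of all orderings of its nodes are
   conjugate, so that h is the order of the one convenient for the coordinates. *)

Lemma mem_consr (T : eqType) (x y : T) (s : seq T) : y \in s -> y \in x :: s.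
Proof. by move=> ys; rewrite in_cons ys orbT. Qed.
Arguments mem_consr {T x y s}.

Lemma fresh_ordinal n (s : seq 'I_n) : (size s < n)%N -> exists k, k \notin s.
Proof.
move=> sn; apply/existsP; apply: contraLR sn; rewrite negb_exists -leqNgt => /forallP all_s.
rewrite -[leqLHS]card_ord; apply: leq_trans (card_size s).
by apply/subset_leq_card/fintype.subsetP => k _; have := all_s k; rewrite negbK.
Qed.

(** * Inner products and reflections *)

Section InnerProduct.
Variables (R : realType) (V : vectType R) (ip : {dot V for idfun}).
Implicit Types (x y z d u v a : V) (b us L : seq V) (k : R).

Lemma ipC x y : ip x y = ip y x.
Proof. by rewrite hermC expr0 mul1r. Qed.

(* The bilinearity lemmas of the library produce terms headed by the underlying
   bilinear form; these restatements keep [ip] at the head. *)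
Lemma ipDl x y z : ip (x + y) z = ip x z + ip y z.
Proof. exact: linearDl. Qed.
Lemma ipDr x y z : ip z (x + y) = ip z x + ip z y.
Proof. exact: linearDr. Qed.
Lemma ipNl x y : ip (- x) y = - ip x y.
Proof. exact: linearNl. Qed.
Lemma ipNr x y : ip x (- y) = - ip x y.
Proof. exact: linearNr. Qed.
Lemma ipBl x y z : ip (x - y) z = ip x z - ip y z.
Proof. exact: linearBl. Qed.
Lemma ipBr x y z : ip z (x - y) = ip z x - ip z y.
Proof. exact: linearBr. Qed.
Lemma ipZl k x y : ip (k *: x) y = k * ip x y.
Proof. exact: linearZl_LR. Qed.
Lemma ipZr k x y : ip x (k *: y) = k * ip x y.
Proof. exact: linearZr_LR. Qed.
Lemma ip0l x : ip 0 x = 0.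
Proof. exact: linear0l. Qed.
Lemma ip0r x : ip x 0 = 0.
Proof. exact: linear0r. Qed.
Lemma ip_suml (I : Type) (r : seq I) (Q : pred I) (F : I -> V) y :
  ip (\sum_(i <- r | Q i) F i) y = \sum_(i <- r | Q i) ip (F i) y.
Proof. exact: linear_sumlz. Qed.
Lemma ip_sumr (I : Type) (r : seq I) (Q : pred I) (F : I -> V) y :
  ip y (\sum_(i <- r | Q i) F i) = \sum_(i <- r | Q i) ip y (F i).
Proof. exact: linear_sumr. Qed.

Definition ipE := (ipDl, ipDr, ipBl, ipBr, ipNl, ipNr, ipZl, ipZr).

Lemma ip_gt0 x : (0 < ip x x) = (x != 0).
Proof.
have [->|x0] := eqVneq; first by rewrite ip0l ltxx.
exact: (@neq0_dnorm_gt0 _ _ _ ip).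
Qed.

Lemma ip_eq0 x : (ip x x == 0) = (x == 0).
Proof.
have [->|x0] := eqVneq x 0; first by rewrite ip0l eqxx.
by rewrite gt_eqF // ip_gt0.
Qed.

Lemma orthogonalC L L' : orthogonal ip L L' -> orthogonal ip L' L.
Proof. by move=> /orthogonalP o; apply/orthogonalP => u v uL vL /=; rewrite ipC o. Qed.

Lemma sub_orthogonal L1 L2 L1' L2' : {subset L1' <= L1} -> {subset L2' <= L2} ->
  orthogonal ip L1 L2 -> orthogonal ip L1' L2'.
Proof.
by move=> s1 s2 /orthogonalP o; apply/orthogonalP => u v /s1 u1 /s2 v2; apply: o.
Qed.

Lemma orthogonal_consl x L L' :
  orthogonal ip (x :: L) L' = orthogonal ip [:: x] L' && orthogonal ip L L'.
Proof. exact: orthogonal_cons. Qed.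

Lemma orthogonal_rconsl L x L' :
  orthogonal ip (rcons L x) L' = orthogonal ip L L' && orthogonal ip [:: x] L'.
Proof. by rewrite /orthogonal /ortho_rec all_rcons /= andbT andbC. Qed.

Lemma orthogonal1lP x L : reflect {in L, forall u, ip x u = 0} (orthogonal ip [:: x] L).
Proof.
apply: (iffP orthogonalP) => [o u uL|o u v]; first by apply: o; rewrite ?mem_head.
by rewrite inE => /eqP->; apply: o.
Qed.

Lemma orthogonal1rP x L : reflect {in L, forall u, ip u x = 0} (orthogonal ip L [:: x]).
Proof.
apply: (iffP orthogonalP) => [o u uL|o u v uL]; first by apply: o; rewrite ?mem_head.
by rewrite inE => /eqP->; apply: o.
Qed.

Lemma ip_eq0_span b x : x \in <<b>>%VS -> {in b, forall y, ip y x = 0} -> x = 0.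
Proof.
move=> xb bx; have : orthogonal ip b [:: x].
  by apply/orthogonalP => y z yb; rewrite inE => /eqP->; apply: bx.
rewrite orthogonalE => /orthovP/(_ x x xb)/(_ (memv_span (mem_head _ _)))/eqP.
by rewrite ip_eq0 => /eqP.
Qed.

Lemma riesz b (f : V -> R) : free b -> exists v, {in b, forall x, ip x v = f x}.
Proof.
move=> bfree.
pose gram (v : V) : 'rV[R]_(size b) := \row_i ip b`_i v.
have gram_linear : linear gram.
  by move=> k x y; apply/rowP => i; rewrite !mxE !ipE.
pose gramL : {linear V -> 'rV[R]_(size b)} :=
  HB.pack gram (GRing.isLinear.Build _ _ _ _ gram gram_linear).
have gram_inj : (<<b>> :&: lker (linfun gramL) = 0)%VS.
  apply/eqP; rewrite -subv0; apply/subvP => x; rewrite memv_cap memv_ker lfunE /=.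
  case/andP=> xb /eqP/rowP gx; rewrite memv0; apply/eqP/(ip_eq0_span xb) => y yb.
  by have := gx (Ordinal (etrans (index_mem y b) yb)); rewrite !mxE nth_index.
have gram_surj : (linfun gramL @: <<b>> = fullv)%VS.
  apply/eqP; rewrite eqEdim subvf /= limg_dim_eq // dimvf /dim /= mul1n.
  by rewrite -(eqP bfree).
have : \row_i f b`_i \in (linfun gramL @: <<b>>)%VS by rewrite gram_surj memvf.
case/memv_imgP => v _ vE; exists v => x xb.
have /rowP/(_ (Ordinal (etrans (index_mem x b) xb))) := vE.
by rewrite lfunE !mxE /= nth_index.
Qed.

Definition dual_vector b x d :=
  ip x d = 1 /\ {in b, forall y, y != x -> ip y d = 0}.

Lemma dual_vector_exists b x : free b -> x \in b -> exists d, dual_vector b x d.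
Proof.
move=> bfree xb; have [d dP] := riesz (fun y => (y == x)%:R) bfree.
by exists d; split=> [|y yb /negPf yx]; rewrite dP ?eqxx // yx.
Qed.

(* The squared length of the projection of z on the line of u; it is 0 for u = 0. *)
Definition sq_proj z u := ip z u ^+ 2 / ip u u.

(* The vector d, orthogonal to us but not to z, makes Bessel's inequality strict. *)
Lemma bessel_lt us z d : ip z d != 0 -> {in us, forall u, ip u d = 0} ->
  pairwise (fun u v => ip u v == 0) us -> \sum_(u <- us) sq_proj z u < ip z z.
Proof.
elim: us z => [|u us IH] z zd usd.
  by move=> _; rewrite big_nil ip_gt0; apply: contra_neq zd => ->; rewrite ip0l.
rewrite pairwise_cons => /andP[/allP uus pus].
have usd' : {in us, forall v, ip v d = 0} by move=> v vs; rewrite usd // mem_consr.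
rewrite big_cons; have [->|u0] := eqVneq u 0.
  by rewrite {1}/sq_proj ip0r expr0n mul0r add0r IH.
have uu : ip u u != 0 by rewrite ip_eq0.
pose z' := z - (ip z u / ip u u) *: u.
have -> : ip z z = sq_proj z u + ip z' z'.
  by rewrite /z' /sq_proj !ipE (ipC u z); field.
rewrite ltrD2l (eq_big_seq (sq_proj z')) => [|v vus]; last first.
  by rewrite /sq_proj /z' !ipE (eqP (uus v vus)) mulr0 subr0.
by apply: IH => //; rewrite /z' !ipE (usd u) ?mem_head // mulr0 subr0.
Qed.

Section Reflection.
Variable a : V.
Hypothesis a_neq0 : a != 0.
Local Notation s := (reflection ip a).

Lemma reflectionE x : s x = x - (2 * ip x a / ip a a) *: a.
Proof. by []. Qed.

Lemma reflection_id : s a = - a.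
Proof.
by rewrite reflectionE mulfK ?ip_eq0 // scaler_nat mulr2n opprD addNKr.
Qed.

Lemma reflection_ip x y : ip (s x) (s y) = ip x y.
Proof.
have aa : ip a a != 0 by rewrite ip_eq0.
by rewrite !reflectionE !ipE (ipC a y); field.
Qed.

Lemma reflectionK : involutive s.
Proof.
have aa : ip a a != 0 by rewrite ip_eq0.
move=> x; rewrite !reflectionE !ipE -addrA -opprD -scalerDl.
by rewrite [X in X *: a](_ : _ = 0) ?scale0r ?subr0 //; field.
Qed.

End Reflection.

Lemma reflection_orth a x : ip x a = 0 -> reflection ip a x = x.
Proof. by move=> xa; rewrite reflectionE xa mulr0 mul0r scale0r subr0. Qed.

Lemma reflection_is_linear a : linear (reflection ip a).
Proof.
move=> k x y; rewrite !reflectionE !ipE scalerBr scalerA addrACA.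
rewrite -opprD -scalerDl; congr (_ - _ *: _).
by rewrite mulrDr mulrDl !mulrA [2 * k]mulrC.
Qed.

HB.instance Definition _ a :=
  GRing.isLinear.Build R V V *:%R (reflection ip a) (reflection_is_linear a).

End InnerProduct.
Arguments ipC {R V ip} x y.
Arguments orthogonal1lP {R V ip x L}.
Arguments orthogonal1rP {R V ip x L}.

(** * Simple roots *)

Section SimpleSystem.
Variables (R : realType) (V : vectType R) (Phi : {fset V}).
Implicit Types (b : seq V) (k : V -> nat).

Definition nat_comb b k : V := \sum_(x <- b) (k x)%:R *: x.

Definition simple_system b : Prop :=
  [/\ {subset b <= Phi}, basis_of fullv b
    & forall a, a \in Phi -> exists k, a = nat_comb b k \/ a = - nat_comb b k].

Lemma simple_system_perm b b' : perm_eq b b' -> simple_system b -> simple_system b'.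
Proof.
move=> bb' [sub bas pos]; split.
- by move=> x; rewrite -(perm_mem bb'); apply: sub.
- by rewrite -(perm_basis _ bb').
- by move=> a /pos [k aE]; exists k; rewrite /nat_comb -!(perm_big _ bb').
Qed.

Lemma simple_systemP b : simple_roots Phi b <-> simple_system b.
Proof.
split=> -[sub bas pos]; split=> // a /pos [k aE].
- have ub : uniq b by apply: free_uniq; apply: basis_free bas.
  pose k' x := oapp k 0%N (insub (index x b)); exists k'.
  rewrite (_ : nat_comb b k' = \sum_(i < size b) b`_i *+ k i) //.
  rewrite /nat_comb (big_nth 0) big_mkord; apply: eq_bigr => i _.
  by rewrite scaler_nat /k' index_uniq // valK.
- exists (fun i => k b`_i).
  rewrite (_ : \sum_(i < size b) _ = nat_comb b k) //.
  by rewrite /nat_comb (big_nth 0) big_mkord; apply: eq_bigr => i _; rewrite scaler_nat.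
Qed.

End SimpleSystem.

Section Bonds.
Variables (R : realType) (V : vectType R) (ip : {dot V for idfun}).
Implicit Types (x y z u : V) (m : nat).

(* x and y are joined by m edges in the Dynkin diagram: the angle between them is
   obtuse and the ratio of their squared lengths is m. *)
Definition mbond m x y : Prop :=
  [\/ ip x x = m%:R * ip y y /\ ip x y = - ip x x / 2
    | ip y y = m%:R * ip x x /\ ip x y = - ip y y / 2].

Definition bond x y : Prop := ip x x = ip y y /\ ip x y = - ip x x / 2.

Lemma mbondC m x y : mbond m x y -> mbond m y x.
Proof. by case=> -[xx xy]; [right|left]; rewrite ipC. Qed.

Lemma bondC x y : bond x y -> bond y x.
Proof. by case=> xx xy; split; rewrite // ipC -xx. Qed.

Lemma mbond1P x y : mbond 1 x y <-> bond x y.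
Proof.
split=> [[] []|[xx xy]]; last by left; rewrite mul1r.
  by rewrite mul1r.
by rewrite mul1r => yy xy; split; rewrite // xy yy.
Qed.

Lemma sq_proj_mbond m z u : (0 < m)%N -> u != 0 -> mbond m z u ->
  sq_proj ip z u = m%:R / 4 * ip z z.
Proof.
move=> m_gt0; rewrite -(ip_eq0 ip) => uu.
have m_neq0 : (m%:R : R) != 0 by rewrite pnatr_eq0 -lt0n.
rewrite /sq_proj; case=> -[sq zu]; rewrite zu.
  by rewrite sq; field.
have zz : ip z z != 0 by apply: contra_neq uu => zz0; rewrite sq zz0 mulr0.
by rewrite sq; field; rewrite zz.
Qed.

Lemma sq_proj_bond z u : u != 0 -> bond z u -> sq_proj ip z u = ip z z / 4.
Proof. by move=> u0 /mbond1P zu; rewrite (sq_proj_mbond _ u0 zu) //; field. Qed.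

Definition admissible (b : seq V) : Prop :=
  free b /\ {in b &, forall x y, x != y ->
    ip x y = 0 \/ exists2 m, (0 < m < 4)%N & mbond m x y}.

Definition connected_system (b : seq V) : Prop := forall A : pred V,
  has A b -> ~~ all A b ->
  exists x y, [/\ x \in b, y \in b, A x, ~~ A y & ip x y != 0].

End Bonds.

Lemma npos_int_mul_lt4 (z w : int) : z <= 0 -> w <= 0 -> z != 0 -> w != 0 ->
  z * w < 4 ->
  exists2 m : nat, (0 < m < 4)%N & (z = -1 /\ w = - m%:Z) \/ (w = -1 /\ z = - m%:Z).
Proof.
move=> z0 w0 zn wn zw; exists (`|z| * `|w|)%N; first by lia.
case: z w z0 w0 zn wn zw => [n|n] [p|p] z0 w0 zn wn zw; try lia.
have np : (n.+1 * p.+1 < 4)%N by rewrite !NegzE mulrNN in zw.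
have n3 : (n < 3)%N by nia.
have p3 : (p < 3)%N by nia.
by move: n p n3 p3 np {z0 w0 zn wn zw} => [|[|[|n]]] [|[|[|p]]] // *; by [left|right].
Qed.

Section RootTheory.
Variables (R : realType) (V : vectType R) (ip : {dot V for idfun}).
Variables (Phi : {fset V}) (b : seq V).
Hypotheses (Phi_root : root_system ip Phi) (Phi_reduced : reduced Phi).
Hypothesis b_simple : simple_system Phi b.
Local Notation s := (reflection ip).

Lemma root_neq0 a : a \in Phi -> a != 0.
Proof. by case: Phi_root => P0 _ _ _ aP; apply: contraNneq P0 => <-. Qed.

Lemma root_reflection a x : a \in Phi -> x \in Phi -> s a x \in Phi.
Proof. by case: Phi_root => _ _ refl _; apply: refl. Qed.

Lemma root_opp a : a \in Phi -> - a \in Phi.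
Proof. by move=> aP; rewrite -(reflection_id ip (root_neq0 aP)) root_reflection. Qed.

Lemma simple_root x : x \in b -> x \in Phi.
Proof. by case: b_simple => sub _ _; apply: sub. Qed.

Lemma simple_neq0 x : x \in b -> x != 0.
Proof. by move=> /simple_root/root_neq0. Qed.

Lemma simple_free : free b.
Proof. by case: b_simple => _ /basis_free. Qed.

Lemma simple_span : (<<b>> = fullv)%VS.
Proof. by case: b_simple => _ /andP[/eqP]. Qed.

Lemma simple_ip_eq0 x : {in b, forall y, ip y x = 0} -> x = 0.
Proof. by apply: (ip_eq0_span (b := b)); rewrite simple_span memvf. Qed.

Lemma nat_comb_dual k x d : x \in b -> dual_vector ip b x d ->
  ip (nat_comb b k) d = (k x)%:R.
Proof.
move=> xb [xd yd]; rewrite /nat_comb (bigD1_seq x) ?free_uniq ?simple_free //=.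
rewrite !ipE xd mulr1 ip_suml big_seq_cond big1 ?addr0 // => y /andP[yb yx].
by rewrite ipZl yd ?mulr0.
Qed.

Lemma nat_comb_acute k : nat_comb b k != 0 ->
  exists x, [/\ x \in b, 0 < ip (nat_comb b k) x & (0 < k x)%N].
Proof.
set a := nat_comb b k => a0; apply: contrapT => none; move: a0.
rewrite -(ip_gt0 ip) ltNge => /negP; apply; rewrite {2}/a ip_sumr big_seq.
apply: sumr_le0 => x xb; rewrite ipZr.
have [ax|ax] := leP (ip a x) 0; first by rewrite mulr_ge0_le0.
case kx : (k x) => [|n]; first by rewrite mul0r.
by case: none; exists x; rewrite kx.
Qed.

Lemma pos_root_support k x : x \in b -> nat_comb b k \in Phi -> nat_comb b k \notin b ->
  exists y, [/\ y \in b, y != x & (0 < k y)%N].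
Proof.
move=> xb aP ab; apply: contrapT => none.
have aE : nat_comb b k = (k x)%:R *: x.
  rewrite /nat_comb (bigD1_seq x) ?free_uniq ?simple_free //=.
  rewrite big_seq_cond big1 ?addr0 // => y /andP[yb yx].
  case ky : (k y) => [|n]; first by rewrite scale0r.
  by case: none; exists y; rewrite ky.
rewrite aE in aP ab; case: (Phi_reduced (simple_root xb) aP) => [k1|/eqP].
  by move: ab; rewrite k1 scale1r xb.
by rewrite -subr_eq0 opprK -(natrD _ _ 1) pnatr_eq0 addn1.
Qed.

Lemma reflection_pos_root k x y : x \in b -> nat_comb b k \in Phi ->
  y \in b -> y != x -> (0 < k y)%N ->
  exists k', s x (nat_comb b k) = nat_comb b k'.
Proof.
move=> xb aP yb yx ky.
case: b_simple => _ _ /(_ _ (root_reflection (simple_root xb) aP))[k' [|k'E]].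
  by exists k'.
have [d /[dup] yd [_ zd]] := dual_vector_exists ip simple_free yb.
have : ip (s x (nat_comb b k)) d = (k y)%:R.
  by rewrite reflectionE !ipE [ip x d]zd 1?eq_sym // mulr0 subr0 (nat_comb_dual _ yb yd).
rewrite k'E ipNl (nat_comb_dual _ yb yd) => /esym/eqP.
by rewrite -subr_eq0 opprK -natrD pnatr_eq0 addn_eq0 -leqn0 leqNgt ky.
Qed.

Lemma reflection_height k k' x : x \in b -> 0 < ip (nat_comb b k) x ->
  s x (nat_comb b k) = nat_comb b k' -> (\sum_(y <- b) k' y < \sum_(y <- b) k y)%N.
Proof.
move=> xb ax k'E; have coef y d : y \in b -> dual_vector ip b y d ->
    (k' y)%:R = (k y)%:R - cartan_number ip (nat_comb b k) x * ip x d.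
  by move=> yb yd; rewrite -!(nat_comb_dual _ yb yd) -k'E /reflection !ipE.
have k'y y : y \in b -> y != x -> k' y = k y.
  move=> yb yx; have [d /[dup] yd [_ zd]] := dual_vector_exists ip simple_free yb.
  by apply/eqP; rewrite -(eqr_nat R) (coef y d) // zd 1?eq_sym // mulr0 subr0.
have k'x : (k' x < k x)%N.
  have [d /[dup] xd [xd1 _]] := dual_vector_exists ip simple_free xb.
  rewrite -(ltr_nat R) (coef x d) // xd1 mulr1 ltrBlDr ltrDl.
  by rewrite divr_gt0 ?ip_gt0 ?simple_neq0 // mulr_gt0.
rewrite !(bigD1_seq x xb (free_uniq simple_free)) /= -addSn leq_add // big_seq_cond.
by rewrite [leqRHS]big_seq_cond leq_sum // => y /andP[yb yx]; rewrite k'y.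
Qed.

(* A positive root meets some simple root at an acute angle; reflecting in it
   lowers the height and, the system being reduced, keeps the root positive. *)
Lemma root_ind (S : V -> Prop) : {in b, forall x, S x} ->
  (forall a, S a -> S (- a)) ->
  (forall a x, x \in b -> S a -> S (s x a)) ->
  forall a, a \in Phi -> S a.
Proof.
move=> Sb SN Sr.
suff pos n k : (\sum_(x <- b) k x < n)%N -> nat_comb b k \in Phi -> S (nat_comb b k).
  move=> a aP; case: b_simple => _ _ /(_ a aP)[k [aE|aE]]; rewrite aE.
    by apply: (pos _ k (ltnSn _)); rewrite -aE.
  by apply/SN/(pos _ k (ltnSn _)); rewrite -[nat_comb b k]opprK -aE root_opp.
elim: n k => // n IH k kn aP.
have [x [xb ax kx]] := nat_comb_acute (root_neq0 aP).
have [ab|ab] := boolP (nat_comb b k \in b); first exact: Sb.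
have [y [yb yx ky]] := pos_root_support xb aP ab.
have [k' k'E] := reflection_pos_root xb aP yb yx ky.
rewrite -(reflectionK ip (simple_neq0 xb) (nat_comb b k)); apply: Sr => //.
rewrite k'E; apply: IH; last by rewrite -k'E root_reflection // simple_root.
by apply: leq_trans (reflection_height xb ax k'E) _; rewrite -ltnS.
Qed.

Lemma simple_obtuse x y : x \in b -> y \in b -> x != y -> ip x y <= 0.
Proof.
move=> xb yb xy; rewrite leNgt; apply/negP => xy_gt0.
have c_gt0 : 0 < cartan_number ip x y.
  by rewrite divr_gt0 ?ip_gt0 ?simple_neq0 // mulr_gt0.
have [d /[dup] xd [xd1 xd0]] := dual_vector_exists ip simple_free xb.
have [e /[dup] ye [ye1 ye0]] := dual_vector_exists ip simple_free yb.
have coef_x : ip (s y x) d = 1 by rewrite reflectionE !ipE xd1 xd0 1?eq_sym // mulr0 subr0.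
have coef_y : ip (s y x) e < 0.
  by rewrite /reflection !ipE ye1 ye0 // mulr1 sub0r oppr_lt0.
case: b_simple => _ _ pos.
have /pos[k [kE|kE]] := root_reflection (simple_root yb) (simple_root xb).
  by move: coef_y; rewrite kE (nat_comb_dual _ yb ye) ltNge ler0n.
move: coef_x; rewrite kE ipNl (nat_comb_dual _ xb xd) => k1.
by have := ler0n R (k x); rewrite -oppr_le0 k1 ler10.
Qed.

Lemma cartan_number_mul_lt4 x y : x \in b -> y \in b -> x != y ->
  cartan_number ip x y * cartan_number ip y x < 4.
Proof.
move=> xb yb xy; have [d [xd1 xd0]] := dual_vector_exists ip simple_free xb.
have xx : 0 < ip x x by rewrite ip_gt0 simple_neq0.
have yy : 0 < ip y y by rewrite ip_gt0 simple_neq0.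
have proj_lt : sq_proj ip x y < ip x x.
  have := @bessel_lt _ _ ip [:: y] x d; rewrite big_seq1 xd1 oner_neq0; apply=> //.
  by move=> u; rewrite inE => /eqP->; rewrite xd0 // eq_sym.
rewrite (_ : _ * _ = 4 * (sq_proj ip x y / ip x x)); last first.
  by rewrite /cartan_number /sq_proj (ipC y x); field; rewrite !gt_eqF.
by rewrite gtr_pMr // ltr_pdivrMr // mul1r.
Qed.

Lemma simple_bond x y : x \in b -> y \in b -> x != y ->
  ip x y = 0 \/ exists2 m, (0 < m < 4)%N & mbond ip m x y.
Proof.
move=> xb yb xy; have [xy0|xyn] := eqVneq (ip x y) 0; [by left|right].
have xx : 0 < ip x x by rewrite ip_gt0 simple_neq0.
have yy : 0 < ip y y by rewrite ip_gt0 simple_neq0.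
have xy_lt0 : ip x y < 0 by rewrite lt_neqAle xyn simple_obtuse.
case: Phi_root => _ _ _ int.
have [z zE] := int x y (simple_root xb) (simple_root yb).
have [w wE] := int y x (simple_root yb) (simple_root xb).
have cxy : 2 * ip x y = z%:~R * ip y y by rewrite -zE divfK // gt_eqF.
have cyx : 2 * ip x y = w%:~R * ip x x by rewrite -wE ipC divfK // gt_eqF.
have z_lt0 : z < 0 by rewrite -(ltrz0 R) -(pmulr_llt0 _ yy) -cxy pmulr_rlt0.
have w_lt0 : w < 0 by rewrite -(ltrz0 R) -(pmulr_llt0 _ xx) -cyx pmulr_rlt0.
have zw_lt4 : z * w < 4.
  by have := cartan_number_mul_lt4 xb yb xy; rewrite zE wE -intrM (ltr_int R _ 4).
have [m m4 [[z1 w1]|[w1 z1]]] :=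
  npos_int_mul_lt4 (ltW z_lt0) (ltW w_lt0) (ltr0_neq0 z_lt0) (ltr0_neq0 w_lt0) zw_lt4.
- exists m => //; right; move: cxy cyx; rewrite z1 w1 !rmorphN /= => cxy cyx.
  by split; lra.
- exists m => //; left; move: cxy cyx; rewrite w1 z1 !rmorphN /= => cxy cyx.
  by split; lra.
Qed.

Lemma simple_admissible : admissible ip b.
Proof. by split; [exact: simple_free|move=> x y; apply: simple_bond]. Qed.

Lemma root_orthogonal_split b1 b2 : {in b, forall x, (x \in b1) || (x \in b2)} ->
  orthogonal ip b1 b2 -> forall a, a \in Phi -> (a \in <<b1>>%VS) || (a \in <<b2>>%VS).
Proof.
rewrite orthogonalE => b12 /orthovP orth.
have bU x : x \in b -> (x \in <<b1>>%VS) || (x \in <<b2>>%VS).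
  by move=> /b12/orP[xb|xb]; rewrite (memv_span xb) ?orbT.
apply: root_ind => [x /bU //|a|a x /bU/orP[xU|xU] /orP[aU|aU]].
- by rewrite !memvN.
- by rewrite rpredB // rpredZ.
- by rewrite reflection_orth ?aU ?orbT // ipC orth.
- by rewrite reflection_orth ?aU // orth.
- by apply/orP; right; rewrite rpredB // rpredZ.
Qed.

Lemma simple_nonempty : irreducible ip Phi -> b != [::].
Proof.
case=> /eqP/fset0Pn[a aP] _; apply/eqP => b_nil; have := root_neq0 aP.
case: b_simple => _ _ /(_ a aP)[k]; rewrite b_nil /nat_comb big_nil oppr0.
by case=> ->; rewrite eqxx.
Qed.

Lemma simple_connected : irreducible ip Phi -> connected_system ip b.
Proof.
case=> _ irr A /hasP[x xb Ax] /allPn[y yb Ay]; apply: contrapT => noedge.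
pose b1 := filter A b; pose b2 := filter (predC A) b.
have orth : orthogonal ip b1 b2.
  apply/orthogonalP => u v; rewrite !mem_filter => /andP[Au ub] /andP[Av vb].
  by apply/eqP; apply: contra_notT noedge => uv; exists u, v.
have cover : {in b, forall z, (z \in b1) || (z \in b2)}.
  by move=> z zb; rewrite !mem_filter zb /= !andbT orbN.
have split_root := root_orthogonal_split cover orth.
have y0 : (y \in <<b1>>%VS) = false.
  apply: contraNF (simple_neq0 yb) => yU; rewrite -(ip_eq0 ip); apply/eqP.
  move: orth; rewrite orthogonalE => /orthovP; apply=> //.
  by rewrite memv_span // mem_filter /= Ay.
case: (irr [fset a in Phi | a \in <<b1>>%VS]%fset).
- by move=> a; rewrite !inE => /andP[].
- move=> a c; rewrite !inE => /andP[_ aU] cP; rewrite cP /= => cU.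
  move: orth; rewrite orthogonalE => /orthovP; apply=> //.
  by have := split_root _ cP; rewrite (negPf cU).
- move/fsetP/(_ x); rewrite !inE simple_root //= memv_span //.
  by rewrite mem_filter Ax.
- by move/fsetP/(_ y); rewrite !inE simple_root //= y0.
Qed.

End RootTheory.

(** * Dynkin diagrams *)

Section Arms.
Variables (R : realType) (V : vectType R) (ip : {dot V for idfun}).
Implicit Types (x y z u v : V) (L : seq V) (m : nat).
Local Notation orthogonal := (orthogonal ip).

Fixpoint arm y L : Prop :=
  if L is x :: L' then [/\ bond ip y x, orthogonal [:: y] L' & arm x L'] else True.

Lemma arm_norm y L : arm y L -> {in L, forall u, ip u u = ip y y}.
Proof.
elim: L y => //= x L IH y [[yy _] _ xL] u.
by rewrite in_cons yy => /predU1P[->//|]; apply: IH.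
Qed.

Lemma arm_rcons y L x : arm y L -> bond ip (last y L) x ->
  orthogonal (belast y L) [:: x] -> arm y (rcons L x).
Proof.
elim: L y => [|z L IH] y /=; first by move=> _ yx _; split.
move=> [yz yL zL] Lx; rewrite orthogonal_consl => /andP[yx oLx].
split=> //; last exact: IH.
apply/orthogonal1lP => u; rewrite mem_rcons in_cons => /predU1P[->|uL].
  by apply: (orthogonal1lP yx); rewrite mem_head.
exact: (orthogonal1lP yL).
Qed.

Lemma arm_catl y L L' : arm y (L ++ L') -> arm y L.
Proof.
elim: L y => //= x L IH y [yx yL xL]; split=> //; last exact: IH xL.
by apply: sub_orthogonal yL => // u; rewrite mem_cat => ->.
Qed.

Lemma arm_next y L n L' : arm y (L ++ n :: L') ->
  bond ip (last y L) n /\ orthogonal (belast y L) [:: n].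
Proof.
elim: L y => [|x L IH] y /=; first by case.
case=> yx yL /IH [Ln oLn]; split=> //; rewrite orthogonal_consl oLn andbT.
by apply: sub_orthogonal yL => // u; rewrite inE mem_cat in_cons => ->; rewrite orbT.
Qed.

Definition contraction y L : V := \sum_(u <- y :: L) u.

Lemma contraction_ip_head y L v : orthogonal L [:: v] -> ip (contraction y L) v = ip y v.
Proof.
move=> /orthogonal1rP o; rewrite /contraction big_cons ipDl ip_suml big_seq.
by rewrite big1 ?addr0.
Qed.

Lemma contraction_ip_last y L v : orthogonal (belast y L) [:: v] ->
  ip (contraction y L) v = ip (last y L) v.
Proof.
move=> /orthogonal1rP o; rewrite /contraction lastI -cats1 big_cat big_seq1 /=.
by rewrite ipDl ip_suml big_seq big1 ?add0r.
Qed.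

Lemma contraction_norm y L (w := contraction y L) : arm y L -> ip w w = ip y y.
Proof.
rewrite {}/w; elim: L y => [|x L IH] y; first by rewrite /contraction big_seq1.
move=> [[yy yx] yL xL]; rewrite /contraction big_cons -/(contraction x L).
have yw : ip y (contraction x L) = - ip y y / 2.
  rewrite ipC contraction_ip_head; first by rewrite ipC.
  exact: orthogonalC.
by rewrite !ipE (ipC _ y) IH // yw -yy; field.
Qed.

Lemma sq_proj_contraction y L v m : (0 < m)%N -> v != 0 -> arm y L ->
  orthogonal (belast y L) [:: v] -> mbond ip m (last y L) v ->
  sq_proj ip (contraction y L) v = m%:R / 4 * ip y y.
Proof.
move=> m_gt0 v0 yL oLv lv; rewrite /sq_proj contraction_ip_last //.
rewrite -/(sq_proj ip _ _) (sq_proj_mbond m_gt0 v0 lv).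
by have := mem_last y L; rewrite in_cons => /predU1P[->|/(arm_norm yL)->].
Qed.

End Arms.

Section Diagrams.
Variables (R : realType) (V : vectType R) (ip : {dot V for idfun}).
Implicit Types (x y z u : V) (L t : seq V) (m : nat).
Local Notation orthogonal := (orthogonal ip).
Local Notation arm := (arm ip).

Definition fork z L1 L2 L3 : Prop :=
  [/\ [/\ arm z L1, arm z L2 & arm z L3],
      [/\ orthogonal L1 L2, orthogonal L1 L3 & orthogonal L2 L3]
    & [/\ L1 != [::], L2 != [::] & L3 != [::]]].

Definition multi m z L x L' : Prop :=
  [/\ (1 < m < 4)%N, mbond ip m z x, arm z L /\ arm x L',
      orthogonal (z :: L) L' & orthogonal L (x :: L')].

Inductive diagram t : Prop :=
| DiagramPath z L1 L2 of arm z L1 & arm z L2 & orthogonal L1 L2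
    & perm_eq t (z :: L1 ++ L2)
| DiagramFork z L1 L2 L3 of fork z L1 L2 L3 & perm_eq t (z :: L1 ++ L2 ++ L3)
| DiagramMulti m z L x L' of multi m z L x L' & perm_eq t (z :: L ++ x :: L').

Lemma fork_swap12 z L1 L2 L3 : fork z L1 L2 L3 -> fork z L2 L1 L3.
Proof. by case=> -[? ? ?] [? ? ?] [? ? ?]; split; split=> //; apply: orthogonalC. Qed.

Lemma fork_swap23 z L1 L2 L3 : fork z L1 L2 L3 -> fork z L1 L3 L2.
Proof. by case=> -[? ? ?] [? ? ?] [? ? ?]; split; split=> //; apply: orthogonalC. Qed.

Lemma multiC m z L x L' : multi m z L x L' -> multi m x L' z L.
Proof.
by case=> ? ? [? ?] ? ?; split=> //; [apply: mbondC|apply: orthogonalC..].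
Qed.

Lemma diagram_perm t t' : perm_eq t t' -> diagram t -> diagram t'.
Proof.
rewrite perm_sym => tt' [z L1 L2 a1 a2 o tE|z L1 L2 L3 f tE|m z L x L' mu tE].
- exact: DiagramPath a1 a2 o (perm_trans tt' tE).
- exact: DiagramFork f (perm_trans tt' tE).
- exact: DiagramMulti mu (perm_trans tt' tE).
Qed.

Lemma arm_cons_rev z x L : bond ip z x -> orthogonal [:: x] L -> arm z L -> arm x (z :: L).
Proof. by move=> zx xL zL; split=> //; apply: bondC. Qed.

Lemma path_shift z x L1 L2 : arm z L1 -> arm z (x :: L2) -> orthogonal L1 (x :: L2) ->
  [/\ arm x (z :: L1), arm x L2 & orthogonal (z :: L1) L2].
Proof.
move=> zL1 [zx zL2 xL2] o; split=> //.
  apply: arm_cons_rev => //; apply: orthogonalC.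
  by apply: sub_orthogonal o => // u; rewrite !inE => ->.
rewrite orthogonal_consl zL2; apply: sub_orthogonal o => // u uL.
by rewrite mem_consr.
Qed.

Lemma path_recenter z L p q (y := last z p) (K := catrev (belast z p) L) :
  arm z L -> arm z (p ++ q) -> orthogonal L (p ++ q) ->
  [/\ arm y K, arm y q & orthogonal K q].
Proof.
rewrite {}/y {}/K; elim: p z L => [|x p IH] z L zL zpq o //=.
by have [] := path_shift zL zpq o; apply: IH.
Qed.

Lemma perm_recenter z L p : perm_eq (z :: L ++ p) (last z p :: catrev (belast z p) L).
Proof.
elim: p z L => [|x p IH] z L /=; first by rewrite cats0.
by apply: perm_trans (IH x (z :: L)); rewrite -[x :: p]cat1s -cat_cons perm_catCA.
Qed.

Lemma path_center z L1 L2 y : arm z L1 -> arm z L2 -> orthogonal L1 L2 ->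
  y \in z :: L1 ++ L2 ->
  exists K1 K2, [/\ arm y K1, arm y K2, orthogonal K1 K2
    & perm_eq (z :: L1 ++ L2) (y :: K1 ++ K2)].
Proof.
wlog yL2 : L1 L2 / y \in z :: L2 => [wl zL1 zL2 o yt|].
  have [|yL1] : y \in z :: L2 \/ y \in z :: L1.
    by move: yt; rewrite !(in_cons, mem_cat) => /or3P[]->; rewrite ?orbT; auto.
    by move=> yL2; apply: wl.
  have perm12 : perm_eq (z :: L1 ++ L2) (z :: L2 ++ L1) by rewrite perm_cons perm_catC.
  have [|K1 [K2 [yK1 yK2 oK pK]]] := wl L2 L1 yL1 zL2 zL1 (orthogonalC o).
    by rewrite -(perm_mem perm12).
  by exists K1, K2; split=> //; apply: perm_trans perm12 pK.
case/splitPl: yL2 => p q <- zL1 zpq o _.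
have [yK yq oK] := path_recenter zL1 zpq o; exists (catrev (belast z p) L1), q.
by split=> //; rewrite catA -!cat_cons perm_cat2r perm_recenter.
Qed.

Lemma path_arm z L1 L2 : arm z L1 -> arm z L2 -> orthogonal L1 L2 ->
  exists y L, arm y L /\ perm_eq (z :: L1 ++ L2) (y :: L).
Proof.
move=> zL1 zL2 o; exists (last z L2), (catrev (belast z L2) L1).
split; last exact: perm_recenter.
by have [] := @path_recenter z L1 L2 [::] zL1; rewrite ?cats0.
Qed.

End Diagrams.

Tactic Notation "perm_by_count" :=
  let p := fresh in
  apply/seq.permP => p; clear; rewrite -?cats1 /= ?count_cat /= ?count_cat /=; lia.

Tactic Notation "perm_by_count" hyp(tE) :=
  let p := fresh in let pE := fresh in
  apply/seq.permP => p; move/seq.permP/(_ p): tE => pE; move: pE; clear;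
  rewrite -?cats1 /= ?count_cat /= ?count_cat /=; lia.

Section Attachment.
Variables (R : realType) (V : vectType R) (ip : {dot V for idfun}).
Implicit Types (x y z u v : V) (L t hs : seq V) (m : nat).
Local Notation orthogonal := (orthogonal ip).
Local Notation arm := (arm ip).
Local Notation fork := (fork ip).
Local Notation multi := (multi ip).
Local Notation diagram := (diagram ip).

Variable b : seq V.
Hypothesis b_adm : admissible ip b.

Lemma admissible_neq0 x : x \in b -> x != 0.
Proof. by case: b_adm => bfree _; apply: free_not0. Qed.

Lemma contraction_bessel z L us (w := contraction z L) : arm z L ->
  {subset z :: L <= b} -> {subset us <= b} -> z \notin L -> z \notin us ->
  pairwise (fun u v => ip u v == 0) us -> \sum_(u <- us) sq_proj ip w u < ip z z.
Proof.
move=> zL zLb usb zNL zNus pus.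
have [d [zd ud]] := dual_vector_exists ip b_adm.1 (zLb z (mem_head _ _)).
rewrite -(contraction_norm zL); apply: (bessel_lt (d := d)) => //.
  rewrite contraction_ip_head ?zd ?oner_neq0 //; apply/orthogonal1rP => u uL.
  by apply: ud; [exact/zLb/mem_consr|apply: contraNneq zNL => <-].
by move=> u uus; apply: ud; [exact: usb|apply: contraNneq zNus => <-].
Qed.

Definition leaf x y t : Prop := y \in t /\ {in t, forall u, u != y -> ip x u = 0}.

Definition attachable x y m t : Prop :=
  [/\ uniq (x :: t), {subset x :: t <= b}, leaf x y t
    & (0 < m < 4)%N /\ mbond ip m y x].

Lemma attachable_exists x y t : uniq (x :: t) -> {subset x :: t <= b} ->
  leaf x y t -> ip x y != 0 -> exists m, attachable x y m t.
Proof.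
move=> uxt xtb [yt xo] xy; have yx : y != x by apply: contraTneq yt => ->; case/andP: uxt.
have [yx0|[m m4 yxm]] := b_adm.2 y x (xtb _ (mem_consr yt)) (xtb _ (mem_head _ _)) yx.
  by rewrite ipC yx0 eqxx in xy.
by exists m.
Qed.

Lemma attachable_perm x y m t t' : perm_eq t t' ->
  attachable x y m t -> attachable x y m t'.
Proof.
move=> tt' [uxt xtb [yt xo] yx]; have xtt' : perm_eq (x :: t) (x :: t') by rewrite perm_cons.
split=> //; first by rewrite -(perm_uniq xtt').
  by move=> u; rewrite -(perm_mem xtt'); apply: xtb.
by split=> [|u]; rewrite -(perm_mem tt') //; apply: xo.
Qed.

Lemma attachable_subseq x y m t t' : subseq t' t -> y \in t' ->
  attachable x y m t -> attachable x y m t'.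
Proof.
move=> t't yt' [uxt xtb [yt xo] yx]; have sub := mem_subseq t't.
split=> //.
- by apply: subseq_uniq uxt; rewrite /= eqxx.
- move=> u; rewrite in_cons => /predU1P[->|/sub ut]; first by rewrite xtb ?mem_head.
  exact/xtb/mem_consr.
- by split=> // u /sub; apply: xo.
Qed.

Lemma attachable_orthogonal x y m t1 t2 : y \in t1 ->
  attachable x y m (t1 ++ t2) -> orthogonal [:: x] t2.
Proof.
move=> yt1 [+ _ [_ xo] _]; rewrite cons_uniq cat_uniq => /and4P[_ _ /hasPn t12 _].
apply/orthogonal1lP => u ut2; apply: xo; first by rewrite mem_cat ut2 orbT.
by apply: contraTneq yt1 => <-; apply: t12.
Qed.

(* The bonds hs take up at least half of what Bessel's inequality leaves at z. *)
Definition junction z L hs : Prop :=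
  [/\ arm z L, orthogonal L hs, pairwise (fun u v => ip u v == 0) hs
    & ip z z / 2 <= \sum_(u <- hs) sq_proj ip z u].

Lemma junction_bessel z L L' hs us : junction z (L ++ L') hs ->
  {subset z :: L ++ us ++ hs <= b} -> z \notin L ++ us ++ hs ->
  pairwise (fun u v => ip u v == 0) us -> orthogonal us hs ->
  \sum_(u <- us) sq_proj ip (contraction z L) u < ip z z / 2.
Proof.
move=> [zLL' oLhs phs half] sub zN pus /orthogonalP ous; have zL := arm_catl zLL'.
have whs : \sum_(u <- hs) sq_proj ip (contraction z L) u = \sum_(u <- hs) sq_proj ip z u.
  apply: eq_big_seq => u uhs; rewrite /sq_proj contraction_ip_head //.
  by apply/orthogonal1rP => v vL; apply: (orthogonalP oLhs); rewrite // mem_cat vL.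
have : \sum_(u <- us ++ hs) sq_proj ip (contraction z L) u < ip z z.
  move: zN; rewrite mem_cat negb_or => /andP[zNL zNus].
  apply: contraction_bessel => // [u|u uus|].
  - by rewrite in_cons => uL; rewrite sub // in_cons mem_cat; case/orP: uL => ->; rewrite ?orbT.
  - by rewrite sub // in_cons mem_cat uus !orbT.
  - rewrite pairwise_cat pus phs !andbT; apply/allrelP => u v uus vhs.
    by rewrite ous.
by rewrite big_cat /= whs; lra.
Qed.

(* The part z :: L of the arm up to the neighbour of x contracts to a single node that
   keeps the bonds hs and has those of its last node, so these have total multiplicity
   less than 2. *)
Section LeafOnArm.
Variables (z x : V) (L L' hs : seq V) (m : nat).
Hypothesis jn : junction z (L ++ L') hs.
Hypothesis x_att : attachable x (last z L) m (z :: (L ++ L') ++ hs).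

Let zx_b : z \in b /\ x \in b.
Proof. by case: x_att => _ sub _ _; split; apply: sub; rewrite !in_cons eqxx ?orbT. Qed.

Let z_notin : z != x /\ z \notin (L ++ L') ++ hs.
Proof.
case: x_att => /=; rewrite in_cons negb_or eq_sym.
by case/andP => /andP[-> _] /andP[-> _].
Qed.

Lemma leaf_orth : {in belast z L ++ L' ++ hs, forall u, ip x u = 0}.
Proof.
have tE : z :: (L ++ L') ++ hs = belast z L ++ last z L :: L' ++ hs.
  by rewrite -catA -cat_cons lastI cat_rcons.
case: x_att; rewrite tE => uxt _ [_ xo] _ u uin; apply: xo.
  by move: uin; rewrite !(mem_cat, in_cons) => /orP[->|->]; rewrite ?orbT.
apply: contraTneq uin => ->; rewrite mem_cat negb_or.
by move: uxt; rewrite cons_uniq cat_uniq => /and5P[_ _ /norP[-> _] ->].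
Qed.

Lemma leaf_sq_proj : sq_proj ip (contraction z L) x = m%:R / 4 * ip z z.
Proof.
case: x_att jn => _ _ _ [/andP[m_gt0 _] lx] [/arm_catl zL _ _ _].
apply: sq_proj_contraction => //; first exact: admissible_neq0 zx_b.2.
by apply/orthogonal1rP => u ul; rewrite ipC leaf_orth // mem_cat ul.
Qed.

Let x_orth_hs : orthogonal [:: x] hs.
Proof. by apply/orthogonal1lP => u uhs; rewrite leaf_orth // !mem_cat uhs !orbT. Qed.

Let zz : 0 < ip z z.
Proof. by rewrite ip_gt0 admissible_neq0 // zx_b.1. Qed.

Lemma leaf_mult_eq1 : m = 1%N.
Proof.
case: x_att => _ sub _ [/andP[m_gt0 _] _]; have [zNx zNt] := z_notin.
have := junction_bessel (us := [:: x]) jn; rewrite big_seq1 leaf_sq_proj => lt.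
have : m%:R / 4 * ip z z < ip z z / 2.
  apply: lt => // [u|].
    rewrite !(in_cons, mem_cat) => /or4P[]e; apply: sub;
      by rewrite !(in_cons, mem_cat) e ?orbT.
  by move: zNt; rewrite !(mem_cat, in_cons) (negPf zNx) !negb_or => /andP[/andP[-> _] ->].
rewrite [ip z z / 2]mulrC ltr_pM2r // => half.
have : (m%:R : R) < 2%:R by lra.
by rewrite ltr_nat; case: (m) m_gt0 => [|[|]].
Qed.

Lemma leaf_at_end : L' = [::].
Proof.
case: L' jn x_att z_notin leaf_orth => // n L'' jn' [_ sub _ _] [zNx zNt] orth.
have nb : n \in b by apply: sub; rewrite !(in_cons, mem_cat) eqxx !orbT.
have [zL oLhs _ _] := jn'; have [ln oLn] := arm_next zL.
have wn : sq_proj ip (contraction z L) n = 1%:R / 4 * ip z z.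
  apply: sq_proj_contraction; rewrite ?admissible_neq0 //; last exact/mbond1P.
  exact: arm_catl zL.
have := junction_bessel (us := [:: n; x]) jn'.
rewrite big_cons big_seq1 wn leaf_sq_proj leaf_mult_eq1 => lt.
exfalso; suff : 1%:R / 4 * ip z z + 1%:R / 4 * ip z z < ip z z / 2 by lra.
apply: lt.
- move=> u; rewrite !(in_cons, mem_cat) => /or4P[e|e|e|/orP[e|e]]; apply: sub;
    by rewrite !(in_cons, mem_cat) e ?orbT.
- move: zNt; rewrite !(mem_cat, in_cons) (negPf zNx) !negb_or.
  by case/andP => /andP[-> /andP[-> _]] ->.
- by rewrite /= ipC orth ?eqxx // !(mem_cat, in_cons) eqxx !orbT.
- rewrite orthogonal_consl x_orth_hs andbT; apply: sub_orthogonal oLhs => // u.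
  by rewrite inE mem_cat in_cons => ->; rewrite orbT.
Qed.

End LeafOnArm.

Lemma leaf_on_arm z L hs x y m : y \in z :: L -> junction z L hs ->
  attachable x y m (z :: L ++ hs) -> m = 1%N /\ arm z (rcons L x).
Proof.
move=> yL; case/splitPl: yL => p q <- jn att; have m1 := leaf_mult_eq1 jn att.
split=> //; have ox := leaf_orth att; rewrite (leaf_at_end jn att) cats0.
case: jn => /arm_catl zp _ _ _; apply: arm_rcons => //.
  by case: att => _ _ _ [_]; rewrite m1 => /mbond1P.
by apply/orthogonal1rP => u up; rewrite ipC ox // mem_cat up.
Qed.

Lemma fork_junction z L h2 L2 h3 L3 : z != 0 -> fork z L (h2 :: L2) (h3 :: L3) ->
  junction z L [:: h2; h3].
Proof.
move=> z0 [[zL [zh2 _ _] [zh3 _ _]] [o2 o3 o23] _].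
have head_neq0 h : bond ip z h -> h != 0 by case=> zz _; rewrite -(ip_eq0 ip) -zz ip_eq0.
split=> //.
- apply: orthogonalC; rewrite orthogonal_consl; apply/andP; split; apply: orthogonalC.
    by apply: sub_orthogonal o2 => // u; rewrite !inE => ->.
  by apply: sub_orthogonal o3 => // u; rewrite !inE => ->.
- by rewrite /= (orthogonalP o23) ?mem_head ?eqxx.
- by rewrite big_cons big_seq1 !sq_proj_bond ?head_neq0 //; lra.
Qed.

Lemma multi_junction m z L x L' : x != 0 -> multi m z L x L' -> junction z L [:: x].
Proof.
move=> x0 [/andP[m1 _] zx [zL _] _ o]; split=> //.
  by apply: sub_orthogonal o => // u; rewrite !inE => ->.
rewrite big_seq1 (sq_proj_mbond _ x0 zx); last exact: ltnW.
have : (2%:R : R) <= m%:R by rewrite ler_nat.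
have : 0 <= ip z z by have [->|z0] := eqVneq z 0; rewrite ?ip0l // ltW ?ip_gt0.
by nra.
Qed.

Lemma fork_attach z L1 L2 L3 x y m : fork z L1 L2 L3 -> y \in z :: L1 ->
  attachable x y m (z :: L1 ++ L2 ++ L3) -> diagram (x :: z :: L1 ++ L2 ++ L3).
Proof.
move=> f yL1 att; have oxL : orthogonal [:: x] (L2 ++ L3).
  exact: (attachable_orthogonal (t1 := z :: L1) yL1 att).
have z0 : z != 0 by case: att => _ sub _ _; rewrite admissible_neq0 // sub // !in_cons eqxx orbT.
case: (f) => [[zL1 zL2 zL3] [o12 o13 o23] [L1n L2n L3n]].
have [_ zL1x] : m = 1%N /\ arm z (rcons L1 x).
  case: L2 L3 L2n L3n f att {oxL zL2 zL3 o12 o13 o23} => [|h2 L2] // [|h3 L3] // _ _ f att.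
  apply: (leaf_on_arm yL1 (fork_junction z0 f)).
  apply: attachable_subseq att; last by rewrite -cat_cons mem_cat yL1.
  rewrite /= eqxx; apply: cat_subseq => //=; rewrite eqxx sub1seq.
  by rewrite mem_cat mem_head orbT.
apply: (@DiagramFork _ _ _ _ z (rcons L1 x) L2 L3); last by perm_by_count.
split; split=> //; last by case: (L1).
  by rewrite orthogonal_rconsl o12 (sub_orthogonal _ _ oxL) // => u uL; rewrite mem_cat uL.
by rewrite orthogonal_rconsl o13 (sub_orthogonal _ _ oxL) // => u uL; rewrite mem_cat uL orbT.
Qed.

Lemma multi_attach n z L x' L' x y m : multi n z L x' L' -> y \in z :: L ->
  attachable x y m (z :: L ++ x' :: L') -> diagram (x :: z :: L ++ x' :: L').
Proof.
move=> mu yL att; have oxL : orthogonal [:: x] (x' :: L').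
  exact: (attachable_orthogonal (t1 := z :: L) yL att).
have x'0 : x' != 0.
  by case: att => _ sub _ _; rewrite admissible_neq0 // sub // !(in_cons, mem_cat) eqxx !orbT.
have [_ zLx] : m = 1%N /\ arm z (rcons L x).
  apply: (leaf_on_arm yL (multi_junction x'0 mu)).
  apply: attachable_subseq att; last by rewrite -cat_cons mem_cat yL.
  by rewrite /= eqxx cat_subseq //= eqxx sub0seq.
case: mu => n14 zx' [zL x'L'] o1 o2.
apply: (@DiagramMulti _ _ _ _ n z (rcons L x) x' L'); last by perm_by_count.
move: o1; rewrite orthogonal_consl => /andP[ozL' oLL'].
split=> //; last by rewrite orthogonal_rconsl o2.
rewrite orthogonal_consl ozL' orthogonal_rconsl oLL' (sub_orthogonal _ _ oxL) // => u.
exact: mem_consr.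
Qed.

Lemma inner_leaf_mult_lt2 y h1 L1 h2 L2 x m : arm y (h1 :: L1) -> arm y (h2 :: L2) ->
  orthogonal (h1 :: L1) (h2 :: L2) ->
  attachable x y m (y :: (h1 :: L1) ++ (h2 :: L2)) -> (m < 2)%N.
Proof.
move=> [yh1 _ _] [yh2 _ _] /orthogonalP o att.
have [uxt sub _ [/andP[m_gt0 _] yx]] := att.
have /orthogonal1lP ox := attachable_orthogonal (t1 := [:: y]) (mem_head _ _) att.
have yb : y \in b by rewrite sub // !in_cons eqxx orbT.
have : {subset [:: h1; h2; x] <= b}.
  move=> u; rewrite !inE => e; rewrite sub // !(in_cons, mem_cat).
  by case/or3P: e => ->; rewrite ?orbT.
move=> hb; have hn u : u \in [:: h1; h2; x] -> u != 0 by move/hb/admissible_neq0.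
have := @contraction_bessel y [::] [:: h1; h2; x] I _ hb isT.
have -> : contraction y [::] = y by rewrite /contraction big_seq1.
rewrite !big_cons big_nil (sq_proj_mbond m_gt0 _ yx) ?hn ?inE ?eqxx ?orbT //.
rewrite !sq_proj_bond ?hn ?inE ?eqxx ?orbT // => lt.
have yy : 0 < ip y y by rewrite ip_gt0 admissible_neq0.
suff : (m%:R : R) < 2%:R by rewrite ltr_nat.
suff : ip y y / 4 + (ip y y / 4 + (m%:R / 4 * ip y y + 0)) < ip y y.
  by move=> {}lt; rewrite -(ltr_pM2r yy); lra.
apply: lt.
- by move=> u; rewrite inE => /eqP->.
- move: uxt; rewrite /= !(in_cons, mem_cat) !negb_or ![x == y]eq_sym.
  by case/andP => /andP[-> _] /andP[/andP[-> /andP[_ /andP[-> _]]] _].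
- by rewrite /= !(ipC _ x) !ox ?o ?mem_head ?eqxx // !(mem_cat, in_cons) eqxx ?orbT.
Qed.

Lemma path_attach y L1 L2 x m : arm y L1 -> arm y L2 -> orthogonal L1 L2 ->
  attachable x y m (y :: L1 ++ L2) -> diagram (x :: y :: L1 ++ L2).
Proof.
move=> yL1 yL2 o12 att; have [_ _ _ [/andP[m_gt0 m_lt4] yx]] := att.
have ox : orthogonal [:: x] (L1 ++ L2).
  exact: (attachable_orthogonal (t1 := [:: y]) (mem_head _ _) att).
have ox1 : orthogonal [:: x] L1.
  by apply: sub_orthogonal ox => // u uL; rewrite mem_cat uL.
have ox2 : orthogonal [:: x] L2.
  by apply: sub_orthogonal ox => // u uL; rewrite mem_cat uL orbT.
have [m1|m_neq1] := eqVneq m 1%N.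
  have yx1 : bond ip y x by apply/mbond1P; rewrite -m1.
  have [L1_0|L1n] := eqVneq L1 [::].
    by apply: (@DiagramPath _ _ _ _ y [:: x] L2) => //; rewrite L1_0; perm_by_count.
  have [L2_0|L2n] := eqVneq L2 [::].
    by apply: (@DiagramPath _ _ _ _ y [:: x] L1) => //; rewrite L2_0; perm_by_count.
  by apply: (@DiagramFork _ _ _ _ y [:: x] L1 L2); [split; split|perm_by_count].
have m_gt1 : (1 < m < 4)%N by rewrite m_lt4 andbT; case: (m) m_gt0 m_neq1 => [|[]].
have end_multi L : arm y L -> orthogonal [:: x] L -> multi m y L x [::].
  by move=> yL oxL; split=> //; apply: orthogonalC.
case: L1 L2 yL1 yL2 o12 ox1 ox2 att {ox} => [|h1 L1] [|h2 L2] yL1 yL2 o12 ox1 ox2 att.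
- by apply: DiagramMulti (end_multi _ yL2 ox2) _; perm_by_count.
- by apply: DiagramMulti (end_multi _ yL2 ox2) _; perm_by_count.
- by apply: DiagramMulti (end_multi _ yL1 ox1) _; perm_by_count.
- by case/andP: m_gt1; rewrite ltnNge -ltnS (inner_leaf_mult_lt2 yL1 yL2 o12 att).
Qed.

Lemma diagram_attach t x y m : diagram t -> attachable x y m t -> diagram (x :: t).
Proof.
move=> dt att; have [_ _ [yt _] _] := att.
have transport t' : perm_eq t t' ->
    (attachable x y m t' -> diagram (x :: t')) -> diagram (x :: t).
  move=> tt' dt'; apply: (@diagram_perm _ _ _ (x :: t')).
    by rewrite perm_cons perm_sym.
  exact/dt'/attachable_perm/att.
case: dt => [z L1 L2 zL1 zL2 o tE|z L1 L2 L3 f tE|n z L x' L' mu tE];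
  move: yt; rewrite (perm_mem tE).
- case/(path_center zL1 zL2 o) => K1 [K2 [yK1 yK2 oK pK]].
  by apply: (transport _ (perm_trans tE pK)); apply: path_attach.
- have fork_case K1 K2 K3 : fork z K1 K2 K3 -> perm_eq t (z :: K1 ++ K2 ++ K3) ->
      y \in z :: K1 -> diagram (x :: t).
    by move=> fK tK yK; apply: (transport _ tK); apply: fork_attach.
  have f2 := fork_swap12 f; have f3 := fork_swap12 (fork_swap23 f).
  have t2 : perm_eq t (z :: L2 ++ L1 ++ L3) by perm_by_count tE.
  have t3 : perm_eq t (z :: L3 ++ L1 ++ L2) by perm_by_count tE.
  rewrite in_cons !mem_cat => /or4P[yz|y1|y2|y3].
  + by apply: (fork_case _ _ _ f tE); rewrite in_cons yz.
  + exact: (fork_case _ _ _ f tE (mem_consr y1)).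
  + exact: (fork_case _ _ _ f2 t2 (mem_consr y2)).
  + exact: (fork_case _ _ _ f3 t3 (mem_consr y3)).
- rewrite -cat_cons mem_cat => /orP[yL|yL'].
    by apply: (transport _ tE); apply: multi_attach mu yL.
  have {}tE : perm_eq t (x' :: L' ++ z :: L) by perm_by_count tE.
  by apply: (transport _ tE); apply: multi_attach (multiC mu) yL'.
Qed.

End Attachment.

Lemma count_lt2_uniq (T : eqType) (p : pred T) (t : seq T) y : uniq t ->
  (count p t < 2)%N -> y \in t -> p y -> {in t, forall u, u != y -> ~~ p u}.
Proof.
move=> ut pt yt py u u_t uy; apply: contraL pt => pu; rewrite -leqNgt -size_filter.
apply: (@uniq_leq_size _ [:: y; u]); first by rewrite /= inE eq_sym uy.
by move=> v; rewrite !inE mem_filter => /orP[]/eqP->; rewrite ?py ?pu.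
Qed.

Section Growth.
Variables (R : realType) (V : vectType R) (ip : {dot V for idfun}).
Implicit Types (x y : V) (t : seq V).

Definition normalize x : V := (Num.sqrt (ip x x))^-1 *: x.

Lemma normalize_ip x : x != 0 -> ip (normalize x) (normalize x) = 1.
Proof.
rewrite -(ip_gt0 ip) => xx; have s0 : Num.sqrt (ip x x) != 0 by rewrite gt_eqF ?sqrtr_gt0.
by rewrite /normalize !ipE -{3}(sqr_sqrtr (ltW xx)); field.
Qed.

Lemma normalize_ip_le x y : y != 0 -> ip y y <= ip x x -> ip x y = - ip x x / 2 ->
  ip (normalize x) (normalize y) <= - 1 / 2.
Proof.
rewrite -(ip_gt0 ip) => yy yx; have xx := lt_le_trans yy yx => xy.
rewrite /normalize !ipE xy -{2}(sqr_sqrtr (ltW xx)).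
have : Num.sqrt (ip y y) <= Num.sqrt (ip x x) by rewrite ler_sqrt // ltW.
have : 0 < Num.sqrt (ip x x) by rewrite sqrtr_gt0.
have : 0 < Num.sqrt (ip y y) by rewrite sqrtr_gt0.
move: (Num.sqrt (ip x x)) (Num.sqrt (ip y y)) => s q q0 s0 qs.
rewrite (_ : _ * _ = - (s / q) / 2); last by field; rewrite !gt_eqF.
by rewrite ler_pM2r ?invr_gt0 // lerN2 ler_pdivlMr // mul1r.
Qed.

Lemma mbond_normalize_le m x y : (0 < m)%N -> x != 0 -> y != 0 -> mbond ip m x y ->
  ip (normalize x) (normalize y) <= - 1 / 2.
Proof.
move=> m_gt0 x0 y0 xy.
have m_ge1 z : z != 0 -> ip z z <= m%:R * ip z z.
  by move=> z0; rewrite ler_peMl ?ler1n // ltW ?ip_gt0.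
case: xy => -[sq xy]; first by apply: normalize_ip_le; rewrite // sq m_ge1.
by rewrite ipC; apply: normalize_ip_le; rewrite ?(ipC y x) // sq m_ge1.
Qed.

Variable b : seq V.
Hypothesis b_adm : admissible ip b.
Hypothesis b_conn : connected_system ip b.

Definition normalize_sum t : V := \sum_(x <- t) normalize x.

Definition degree x t := count (fun u => ip x u != 0) t.

Lemma normalize_sum_cons x t (w := normalize_sum t) (w' := normalize_sum (x :: t)) :
  x \notin t -> {subset x :: t <= b} -> ip w' w' <= ip w w + 1 - (degree x t)%:R.
Proof.
move=> xt sub; have xb : x \in b by rewrite sub ?mem_head.
have xw : ip (normalize x) w <= - (degree x t)%:R / 2.
  rewrite /w /normalize_sum ip_sumr /degree -sum1_count natr_sum -sumrN mulr_suml.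
  rewrite [leRHS]big_mkcond /= !big_seq; apply: ler_sum => u ut.
  have ub : u \in b by rewrite sub ?mem_consr.
  have xu : x != u by apply: contraNneq xt => ->.
  have [xu0|[m /andP[m_gt0 _] bxu]] := b_adm.2 x u xb ub xu.
    by rewrite xu0 eqxx /normalize !ipE xu0 !mulr0.
  case: ifP => [_|/negbFE/eqP xu0]; last by rewrite /normalize !ipE xu0 !mulr0.
  by apply: mbond_normalize_le m_gt0 _ _ bxu; apply: admissible_neq0 b_adm _ _.
rewrite /w' /normalize_sum big_cons -/(normalize_sum t) -/w.
move: (normalize x) w (normalize_ip (admissible_neq0 b_adm xb)) xw => e w ee xw.
by rewrite !ipE ee (ipC w); lra.
Qed.

Lemma normalize_sum_gt0 x t (w := normalize_sum (x :: t)) :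
  x \notin t -> {subset x :: t <= b} -> 0 < ip w w.
Proof.
move=> xt sub; have xb : x \in b by rewrite sub ?mem_head.
have [d [xd yd]] := dual_vector_exists ip b_adm.1 xb.
rewrite ip_gt0; apply/eqP => /(congr1 (ip^~ d)); rewrite ip0l /w /normalize_sum big_cons.
rewrite !ipE xd mulr1 ip_suml big_seq big1 ?addr0 => [/eqP|u ut].
  by rewrite invr_eq0 gt_eqF // sqrtr_gt0 ip_gt0 (admissible_neq0 b_adm).
by rewrite ipZl yd ?mulr0 ?sub ?mem_consr //; apply: contraNneq xt => <-.
Qed.

Lemma leaf_of_neighbour x y t (w := normalize_sum t) (w' := normalize_sum (x :: t)) :
  uniq (x :: t) -> {subset x :: t <= b} -> ip w w <= 1 -> y \in t -> ip x y != 0 ->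
  leaf ip x y t /\ ip w' w' <= 1.
Proof.
move=> /andP[xt ut] sub w1 yt xy.
have w'_le := normalize_sum_cons xt sub; have w'_gt0 := normalize_sum_gt0 xt sub.
have deg_lt2 : (degree x t < 2)%N.
  by rewrite -(ltr_nat R); move: w'_gt0 w'_le w1; rewrite -/w -/w'; lra.
split; first split=> // u ut' uy.
  by apply/eqP; rewrite -[_ == _]negbK; apply: count_lt2_uniq ut deg_lt2 yt xy _ ut' uy.
have deg_gt0 : (1 : R) <= (degree x t)%:R.
  by rewrite ler1n -has_count; apply/hasP; exists y.
by apply: le_trans w'_le _; rewrite -/w; move: w1 deg_gt0; lra.
Qed.

Fixpoint tree t : Prop :=
  if t is x :: t' then (t' = [::] \/ exists y, leaf ip x y t') /\ tree t' else True.

Lemma connected_boundary t : t != [::] -> uniq t -> {subset t <= b} ->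
  (size t < size b)%N -> exists x y, [/\ x \in b, x \notin t, y \in t & ip x y != 0].
Proof.
move=> t0 ut sub st; have [||y [x [yb xb yt xt yx]]] := b_conn (A := mem t).
- by case: t t0 sub {ut st} => // x t _ sub; apply/hasP; exists x; rewrite ?sub ?inE ?eqxx.
- by apply: contraL st => /allP bt; rewrite -leqNgt uniq_leq_size // free_uniq // b_adm.1.
- by exists x, y; rewrite ipC.
Qed.

(* The sum of the normalised nodes keeps length at most 1 while the diagram grows, so
   a new node has exactly one neighbour: the diagram has no cycle. *)
Lemma diagram_growth n : (n < size b)%N ->
  exists t, [/\ size t = n.+1, uniq t & {subset t <= b}] /\
    [/\ diagram ip t, tree t & ip (normalize_sum t) (normalize_sum t) <= 1].
Proof.
elim: n => [|n IH] nb.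
  case b_eq : b nb => [|x b'] // _; exists [:: x]; split.
    by split=> // u; rewrite inE => /eqP->; rewrite mem_head.
  split; [exact: (@DiagramPath _ _ _ _ x [::] [::])|by split=> //; left|].
  by rewrite /normalize_sum big_seq1 normalize_ip // (admissible_neq0 b_adm) // b_eq mem_head.
have [t [[st ut sub] [dt tt w1]]] := IH (ltnW nb).
have [||x [y [xb xt yt xy]]] := connected_boundary _ ut sub; rewrite ?st //.
  by rewrite -size_eq0 st.
have uxt : uniq (x :: t) by rewrite /= xt.
have subx : {subset x :: t <= b} by move=> u; rewrite in_cons => /predU1P[->|/sub].
have [xy_leaf w'1] := leaf_of_neighbour uxt subx w1 yt xy.
have [m att] := attachable_exists b_adm uxt subx xy_leaf xy.
exists (x :: t); split; first by rewrite /= st.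
split=> //; first exact: (diagram_attach b_adm dt att).
by split=> //; right; exists y.
Qed.

End Growth.

Lemma unit_fractions_gt1 (R : realFieldType) (p q r : nat) :
  (1 < p)%N -> (p <= q)%N -> (q <= r)%N ->
  (1 : R) < p%:R^-1 + q%:R^-1 + r%:R^-1 ->
  p = 2%N /\ (q = 2%N \/ q = 3%N /\ (r < 6)%N).
Proof.
move=> p1 pq qr gt1; have [p0 q0 r0] : [/\ (0 < p)%N, (0 < q)%N & (0 < r)%N].
  by split; lia.
have lt : (p * q * r < q * r + p * r + p * q)%N.
  rewrite -(ltr_nat R) !natrD !natrM.
  have pqr0 : (0 : R) < p%:R * q%:R * r%:R by rewrite !mulr_gt0 ?ltr0n.
  have clear_denoms (x y z : R) : x != 0 -> y != 0 -> z != 0 ->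
      x * y * z * (x^-1 + y^-1 + z^-1) = y * z + x * z + x * y.
    by move=> x0 y0 z0; field; rewrite x0 y0 z0.
  by rewrite -clear_denoms ?pnatr_eq0 -?lt0n // -[ltLHS]mulr1 ltr_pM2l.
have p2 : p = 2%N.
  have : (p < 3)%N; last by lia.
  rewrite ltnNge; apply/negP => p3.
  have : (3 * (q * r) <= p * q * r)%N by rewrite -mulnA leq_mul2r p3 orbT.
  have : (p * r <= q * r)%N by rewrite leq_mul2r pq orbT.
  have : (p * q <= q * r)%N by rewrite mulnC leq_mul2l (leq_trans pq qr) orbT.
  by lia.
subst p; split=> //; have : (q < 4)%N by nia.
by case: q {p1 q0 gt1} pq qr lt => [|[|[|[|]]]] // _ qr lt _; [left|right; split=> //; nia].
Qed.

Lemma multi_fractions_lt2 (R : realFieldType) (m p q : nat) : (1 < m < 4)%N ->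
  m%:R * (p.+1%:R / p.+2%:R) + q%:R / q.+1%:R < (2 : R) ->
  [/\ m = 3%N, p = 0%N & q = 0%N] \/ m = 2%N /\ (p * q < 2)%N.
Proof.
move=> m14 lt2; have lt : (m * (p.+1 * q.+1) + q * p.+2 < 2 * (p.+2 * q.+1))%N.
  rewrite -(ltr_nat R) !(natrD, natrM).
  have pq0 : (0 : R) < p.+2%:R * q.+1%:R by rewrite mulr_gt0 ?ltr0n.
  rewrite -(ltr_pM2r pq0) in lt2; move: lt2; congr (_ < _).
  have := pnatr_eq0 R p.+2; have := pnatr_eq0 R q.+1.
  move: p.+1%:R p.+2%:R q.+1%:R => x y z /negbT z0 /negbT y0.
  by field; rewrite y0 z0.
case: m m14 lt {lt2} => [|[|[|[|m]]]] // _ lt; [right; split=> //; nia|left].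
by have [p0 q0] : p = 0%N /\ q = 0%N by nia.
Qed.

Section Classification.
Variables (R : realType) (V : vectType R) (ip : {dot V for idfun}).
Implicit Types (x y z u v d : V) (L t : seq V).
Local Notation orthogonal := (orthogonal ip).
Local Notation arm := (arm ip).
Local Notation fork := (fork ip).
Local Notation multi := (multi ip).

(* Up to a factor, the fundamental weight of the arm L at its head: among the vectors
   of the span of L it is the one with the largest projection on the node before L. *)
Fixpoint taper L : V := if L is x :: L' then (size L)%:R *: x + taper L' else 0.

Lemma taper_orthr L v : {in L, forall u, ip v u = 0} -> ip v (taper L) = 0.
Proof.
elim: L => [|x L IH] o /=; first by rewrite ip0r.
rewrite ipDr ipZr o ?mem_head // mulr0 add0r IH // => u uL.
exact/o/mem_consr.
Qed.

Lemma taper_orth L L' : orthogonal L L' -> ip (taper L) (taper L') = 0.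
Proof.
move=> /orthogonalP o; apply: taper_orthr => v vL'.
by rewrite ipC taper_orthr // => u uL; rewrite ipC o.
Qed.

Lemma taper_ip y L : arm y L ->
  ip y (taper L) = - (size L)%:R * ip y y / 2 /\
  ip (taper L) (taper L) = (size L)%:R * (size L).+1%:R * ip y y / 2.
Proof.
elim: L y => [|x L IH] y /=; first by rewrite !ip0r !(mul0r, oppr0).
move=> [[yy yx] /orthogonal1lP yL /IH[xt tt]]; rewrite -yy in xt tt.
by rewrite !ipE yx -yy (ipC (taper L) x) xt tt (taper_orthr yL) -!natr1; split; field.
Qed.

Lemma sq_proj_taper y L : y != 0 -> arm y L ->
  sq_proj ip y (taper L) = (size L)%:R / (size L).+1%:R * (ip y y / 2).
Proof.
rewrite -(ip_eq0 ip) => yy yL; rewrite /sq_proj; have [-> ->] := taper_ip yL.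
case: (size L) => [|n]; first by rewrite expr2 !(oppr0, mul0r).
move: n.+1%:R n.+2%:R (pnatr_eq0 R n.+1) (pnatr_eq0 R n.+2) => p q /negbT p0 /negbT q0.
by field; rewrite p0 q0 yy.
Qed.

Lemma sq_proj_taper_mbond m z x L : (0 < m)%N -> x != 0 -> mbond ip m z x ->
  arm x L -> orthogonal [:: z] L ->
  sq_proj ip z (taper (x :: L)) =
    m%:R * ((size L).+1%:R / (size L).+2%:R) * (ip z z / 2).
Proof.
move=> m_gt0 x0 zx xL /orthogonal1lP zL; have xx : ip x x != 0 by rewrite ip_eq0.
have [xt tt] := taper_ip xL.
have zt : ip z (taper (x :: L)) = (size L).+1%:R * ip z x.
  by rewrite /= ipDr ipZr taper_orthr // addr0.
have tt' : ip (taper (x :: L)) (taper (x :: L)) =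
    (size L).+1%:R * (size L).+2%:R * ip x x / 2.
  by rewrite /= !ipE (ipC (taper L) x) xt tt -!natr1; field.
have zx2 : ip z x ^+ 2 = m%:R / 4 * ip z z * ip x x.
  by rewrite -(sq_proj_mbond m_gt0 x0 zx) divfK.
rewrite /sq_proj zt tt' exprMn zx2.
move: (size L).+1%:R (size L).+2%:R (pnatr_eq0 R (size L).+1) (pnatr_eq0 R (size L).+2).
by move=> p q /negbT p0 /negbT q0; field; rewrite xx p0 q0.
Qed.

Inductive dynkin t : Prop :=
| DynkinA z L of arm z L & perm_eq t (z :: L)
| DynkinBC z L x of multi 2 z L x [::] & perm_eq t (x :: z :: L)
| DynkinD z L x y of fork z [:: x] [:: y] L & perm_eq t (x :: y :: z :: L)
| DynkinE z L x y y' of fork z [:: x] [:: y; y'] L & (2 <= size L <= 4)%N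
    & perm_eq t [:: x, y', y, z & L]
| DynkinF z x y x' of multi 2 z [:: y] x [:: x'] & perm_eq t [:: y; z; x; x']
| DynkinG z x of multi 3 z [::] x [::] & perm_eq t [:: z; x].

Lemma fork_sort z L1 L2 L3 : fork z L1 L2 L3 ->
  exists K1 K2 K3, [/\ fork z K1 K2 K3, (size K1 <= size K2 <= size K3)%N
    & perm_eq (z :: L1 ++ L2 ++ L3) (z :: K1 ++ K2 ++ K3)].
Proof.
wlog le13 : L1 L2 L3 / (size L1 <= size L3)%N => [wl f|].
  have [le13|/ltnW le31] := leqP (size L1) (size L3); first exact: wl.
  have [K1 [K2 [K3 [fK leK pK]]]] := wl _ _ _ le31 (fork_swap12 (fork_swap23 (fork_swap12 f))).
  by exists K1, K2, K3; split=> //; apply: perm_trans pK; perm_by_count.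
wlog le12 : L1 L2 L3 le13 / (size L1 <= size L2)%N => [wl f|f].
  have [le12|lt21] := leqP (size L1) (size L2); first exact: wl.
  have [|K1 [K2 [K3 [fK leK pK]]]] := wl L2 L1 L3 _ (ltnW lt21) (fork_swap12 f).
    exact: leq_trans (ltnW lt21) le13.
  by exists K1, K2, K3; split=> //; apply: perm_trans pK; perm_by_count.
have [le23|/ltnW le32] := leqP (size L2) (size L3).
  by exists L1, L2, L3; rewrite le12.
exists L1, L3, L2; rewrite le13; split=> //; first exact: fork_swap23.
by perm_by_count.
Qed.

Variable b : seq V.
Hypothesis b_adm : admissible ip b.

Lemma taper_bessel z Ls : {subset z :: flatten Ls <= b} -> z \notin flatten Ls ->
  pairwise (fun L L' => orthogonal L L') Ls ->
  \sum_(L <- Ls) sq_proj ip z (taper L) < ip z z.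
Proof.
move=> sub zN oLs; rewrite -(big_map taper predT (sq_proj ip z)).
have [d [zd dz]] := dual_vector_exists ip b_adm.1 (sub z (mem_head _ _)).
apply: (bessel_lt (d := d)); first by rewrite zd oner_neq0.
  move=> _ /mapP[L LLs ->]; rewrite ipC taper_orthr // => u uL.
  have uLs : u \in flatten Ls by apply/flattenP; exists L.
  by rewrite ipC dz ?sub ?mem_consr //; apply: contraNneq zN => <-.
rewrite pairwise_map; apply: sub_pairwise oLs => L L' oLL'.
by rewrite /= taper_orth.
Qed.

Lemma fork_unit_fractions z L1 L2 L3 : uniq (z :: L1 ++ L2 ++ L3) ->
  {subset z :: L1 ++ L2 ++ L3 <= b} -> fork z L1 L2 L3 ->
  (1 : R) < (size L1).+1%:R^-1 + (size L2).+1%:R^-1 + (size L3).+1%:R^-1.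
Proof.
move=> /andP[zN _] sub [[zL1 zL2 zL3] [o12 o13 o23] _].
have z0 : z != 0 by rewrite (admissible_neq0 b_adm) // sub ?mem_head.
have := @taper_bessel z [:: L1; L2; L3].
rewrite /= cats0 o12 o13 o23 !big_cons big_nil => /(_ sub zN isT).
rewrite !sq_proj_taper // addr0 -!mulrDl -ltr_pdivlMr ?divr_gt0 ?ip_gt0 //.
rewrite invf_div [ip z z * _]mulrCA divff ?ip_eq0 // mulr1.
have frac n : (n%:R / n.+1%:R : R) = 1 - n.+1%:R^-1.
  by rewrite -[in LHS](addrK 1 n%:R) natr1 mulrBl divff ?pnatr_eq0 // mul1r.
by rewrite !frac; move: _%:R^-1 _%:R^-1 _%:R^-1 => p q r; lra.
Qed.

Lemma fork_dynkin t z L1 L2 L3 : uniq t -> {subset t <= b} -> fork z L1 L2 L3 ->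
  perm_eq t (z :: L1 ++ L2 ++ L3) -> dynkin t.
Proof.
move=> ut sub /fork_sort[K1 [K2 [K3 [f /andP[le12 le23] pK]]]] /perm_trans/(_ pK) tE.
have [_ _ [K1n K2n _]] := f.
have size1 : (1 < (size K1).+1)%N by rewrite ltnS lt0n size_eq0.
have [|[size_K1] size_K23] := @unit_fractions_gt1 R _ (size K2).+1 (size K3).+1 size1 le12 le23.
  apply: fork_unit_fractions f; first by rewrite -(perm_uniq tE).
  by move=> u; rewrite -(perm_mem tE) => /sub.
case: K1 size_K1 f tE {le12 pK K1n size1} => [|x [|]] // _ f tE.
case: K2 K2n f tE le23 size_K23 => [|y K2] // _ f tE le23.
case=> [[/size0nil K2_0]|[[size2] size6]].
  by rewrite K2_0 in f tE; apply: (DynkinD f); perm_by_count tE.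
case: K2 size2 f tE le23 => [|y' [|]] // _ f tE le23.
by apply: (DynkinE f); [rewrite le23|perm_by_count tE].
Qed.

Lemma multi_fractions m z L x L' : uniq (z :: L ++ x :: L') ->
  {subset z :: L ++ x :: L' <= b} -> multi m z L x L' ->
  m%:R * ((size L').+1%:R / (size L').+2%:R) + (size L)%:R / (size L).+1%:R < (2 : R).
Proof.
move=> /andP[zN _] sub [/andP[m_gt1 _] zx [zL xL'] o1 o2].
have [zb xb] : z \in b /\ x \in b.
  by split; apply: sub; rewrite !(in_cons, mem_cat) eqxx ?orbT.
have z0 := admissible_neq0 b_adm zb; have x0 := admissible_neq0 b_adm xb.
have perm2 : perm_eq (L ++ x :: L') (flatten [:: x :: L'; L]) by perm_by_count.
have := @taper_bessel z [:: x :: L'; L].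
rewrite -(perm_mem perm2) pairwise2 (orthogonalC o2) big_cons big_seq1 => lt.
have {lt} : sq_proj ip z (taper (x :: L')) + sq_proj ip z (taper L) < ip z z.
  by apply: lt => // u; rewrite in_cons -(perm_mem perm2) -in_cons; apply: sub.
move: o1; rewrite orthogonal_consl => /andP[ozL' _].
rewrite (sq_proj_taper_mbond _ x0 zx) 1?ltnW // sq_proj_taper // -mulrDl.
by rewrite -ltr_pdivlMr ?divr_gt0 ?ip_gt0 // invf_div [ip z z * _]mulrCA divff ?ip_eq0 // mulr1.
Qed.

Lemma multi_dynkin t m z L x L' : uniq t -> {subset t <= b} -> multi m z L x L' ->
  perm_eq t (z :: L ++ x :: L') -> dynkin t.
Proof.
move=> ut sub mu tE; have [m14 _ _ _ _] := mu.
have := multi_fractions _ _ mu; rewrite -(perm_uniq tE) => /(_ ut) lt2.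
case: (multi_fractions_lt2 m14 (lt2 _)) => [u|[m3 L'0 L0]|[m2 sizes]].
- by rewrite -(perm_mem tE); apply: sub.
- move: mu tE; rewrite m3 (size0nil L0) (size0nil L'0) => mu tE.
  exact: DynkinG mu tE.
subst m; case: L' mu tE {lt2} sizes => [|x' L'] mu tE sizes.
  by apply: DynkinBC mu _; perm_by_count tE.
case: L mu tE sizes => [|y L] mu tE sizes.
  by apply: (DynkinBC (multiC mu)); perm_by_count tE.
have [L'0 L0] : size L' = 0%N /\ size L = 0%N.
  by move: sizes => /=; case: (size L') => [|?]; case: (size L).
rewrite (size0nil L0) (size0nil L'0) in mu tE.
by apply: DynkinF mu _; perm_by_count tE.
Qed.

Lemma diagram_dynkin t : uniq t -> {subset t <= b} -> diagram ip t -> dynkin t.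
Proof.
move=> ut sub [z L1 L2 zL1 zL2 o tE|z L1 L2 L3 f tE|m z L x L' mu tE].
- have [y [L [yL pL]]] := path_arm zL1 zL2 o.
  exact: DynkinA yL (perm_trans tE pL).
- exact: fork_dynkin f tE.
- exact: multi_dynkin mu tE.
Qed.

Theorem dynkin_classification : connected_system ip b -> b != [::] ->
  exists t, [/\ perm_eq t b, tree ip t & dynkin t].
Proof.
move=> b_conn b0; have sb : ((size b).-1 < size b)%N by case: (b) b0.
have [t [[st ut sub] [dt tt _]]] := diagram_growth b_adm b_conn sb.
exists t; split=> //; last exact: diagram_dynkin.
have [|_ tb] := uniq_min_size ut sub; first by rewrite st (ltn_predK sb).
by apply: uniq_perm => //; apply: free_uniq b_adm.1.
Qed.

End Classification.

(** * Coxeter elements *)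

Section Coxeter.
Variables (R : realType) (V : vectType R) (ip : {dot V for idfun}).
Implicit Types (x y z u v : V) (s t : seq V) (m h : nat).
Local Notation cox := (coxeter_element ip).

Lemma coxeter_element_cat s t x : cox (s ++ t) x = cox s (cox t x).
Proof. by elim: s => //= y s ->. Qed.

Lemma coxeter_element_is_linear s : linear (cox s).
Proof. by elim: s => //= a s IH c x y; rewrite /= IH linearP. Qed.

HB.instance Definition _ s :=
  GRing.isLinear.Build R V V *:%R (cox s) (coxeter_element_is_linear s).

Lemma iter_is_linear (f : {linear V -> V}) m : linear (iter m f).
Proof. by elim: m => //= m IH c x y; rewrite /= IH linearP. Qed.

HB.instance Definition _ (f : {linear V -> V}) m :=
  GRing.isLinear.Build R V V *:%R (iter m f) (iter_is_linear f m).

Lemma linear_span_id (f : {linear V -> V}) s : (<<s>> = fullv)%VS ->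
  {in s, forall x, f x = x} -> f =1 id.
Proof.
move=> sV fs x; have : {in <<s>>%VS, linfun f =1 \1%VF}.
  by apply/span_lfunP => y ys; rewrite lfunE id_lfunE fs.
by move/(_ x); rewrite sV memvf lfunE id_lfunE; apply.
Qed.

Inductive word_equiv : seq V -> seq V -> Prop :=
| WordRefl s : word_equiv s s
| WordTrans s t r : word_equiv s t -> word_equiv t r -> word_equiv s r
| WordSym s t : word_equiv s t -> word_equiv t s
| WordRot x s : word_equiv (x :: s) (rcons s x)
| WordSwap s x y t : ip x y = 0 ->
    word_equiv (s ++ x :: y :: t) (s ++ y :: x :: t).

Lemma word_equiv_perm s t : word_equiv s t -> perm_eq s t.
Proof.
elim=> {s t} [s|s t u _ st _ tu|s t _|x s|s x y t _] //.
- exact: perm_trans st tu.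
- by rewrite perm_sym.
- by rewrite perm_sym perm_rcons.
- by rewrite perm_cat2l; apply/seq.permP => p; rewrite /= addnCA.
Qed.

Lemma word_equiv_catC s t : word_equiv (s ++ t) (t ++ s).
Proof.
elim: s t => [|x s IH] t; first by rewrite cats0; apply: WordRefl.
apply: WordTrans (WordRot _ _) _; rewrite rcons_cat.
by apply: WordTrans (IH _) _; rewrite -cats1 -catA; apply: WordRefl.
Qed.

Lemma word_equiv_push r x s t : {in s, forall u, ip x u = 0} ->
  word_equiv (r ++ x :: s ++ t) (r ++ s ++ x :: t).
Proof.
elim: s r => [|u s IH] r xs; first exact: WordRefl.
apply: WordTrans (WordSwap _ _ (xs u (mem_head _ _))) _.
rewrite -cat_rcons; apply: WordTrans (IH _ _) _; last by rewrite cat_rcons; apply: WordRefl.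
by move=> v vs; apply/xs/mem_consr.
Qed.

Section LeafLetter.
Variables (x y : V) (t0 : seq V).
Hypothesis xo : {in t0, forall u, u != y -> ip x u = 0}.

Definition graft s := flatten [seq if u == y then [:: x; y] else [:: u] | u <- s].

Lemma graft_cat s t : graft (s ++ t) = graft s ++ graft t.
Proof. by rewrite /graft map_cat flatten_cat. Qed.

Lemma graft_id s : y \notin s -> graft s = s.
Proof.
elim: s => //= u s IH; rewrite in_cons negb_or => /andP[yu /IH sE].
by rewrite /graft /= -/(graft s) sE eq_sym (negPf yu).
Qed.

Lemma graft_equiv s t : word_equiv s t -> {subset s <= t0} ->
  word_equiv (graft s) (graft t).
Proof.
elim=> {s t} [s|s t u st IHst tu IHtu|s t st IHst|u s|s u v t uv] sub.
- exact: WordRefl.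
- apply: WordTrans (IHst sub) (IHtu _) => w.
  by rewrite -(perm_mem (word_equiv_perm st)); apply: sub.
- apply/WordSym/IHst => w; rewrite (perm_mem (word_equiv_perm st)); exact: sub.
- by rewrite -cats1 graft_cat -cat1s graft_cat; apply: word_equiv_catC.
have [ut vt] : u \in t0 /\ v \in t0.
  by split; apply: sub; rewrite mem_cat !in_cons eqxx ?orbT.
rewrite -[[:: u, v & t]]/([:: u] ++ [:: v] ++ t) -[[:: v, u & t]]/([:: v] ++ [:: u] ++ t).
rewrite !graft_cat /graft /= !cats0.
case: (eqVneq u y) => uy; case: (eqVneq v y) => vy.
- exact: WordRefl.
- have xv := xo vt vy; rewrite /= uy in uv *.
  apply: WordTrans (_ : word_equiv _ (_ ++ [:: x, v, y & _])) _.
    by rewrite -!(cat_rcons x); apply: WordSwap.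
  exact: WordSwap.
- have xu := xo ut uy; rewrite /= vy in uv *.
  apply: WordTrans (_ : word_equiv _ (_ ++ [:: x, u, y & _])) _.
    by apply: WordSwap; rewrite ipC.
  by rewrite -!(cat_rcons x); apply: WordSwap.
- exact: WordSwap.
Qed.

Lemma cons_graft_equiv s : y \in s -> uniq s -> {subset s <= t0} ->
  word_equiv (x :: s) (graft s).
Proof.
move=> /splitPr[s1 s2]; rewrite cat_uniq /= negb_or => /and4P[_ /andP[y1 _] y2 _] sub.
have -> : graft (s1 ++ y :: s2) = s1 ++ [:: x, y & s2].
  rewrite graft_cat -[y :: s2]cat1s graft_cat (graft_id y1) (graft_id y2).
  by rewrite /graft /= eqxx.
apply: (word_equiv_push [::]) => u us; apply: xo; first by rewrite sub // mem_cat us.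
by apply: contraNneq y1 => <-.
Qed.

End LeafLetter.

(* Induction on the tree: a leaf x commutes with everything but its neighbour y,
   so it can be moved next to y and the pair xy treated as a single letter. *)
Lemma tree_word_equiv t t' : tree ip t -> uniq t -> perm_eq t t' -> word_equiv t t'.
Proof.
elim: t t' => [|x t IH] t'.
  by rewrite perm_sym => _ _ /perm_nilP->; apply: WordRefl.
move=> [x_leaf tt] /= /andP[xt ut] tt'.
have xt' : x \in t' by rewrite -(perm_mem tt') mem_head.
case/splitPr: xt' tt' => p q tt'.
have tqp : perm_eq t (q ++ p).
  by rewrite -(perm_cons x); apply: perm_trans tt' _; rewrite perm_catC.
apply: WordTrans (_ : word_equiv _ (x :: q ++ p)) _.
  case: x_leaf => [t0|[y [yt xo]]].
    by move: tqp; rewrite t0 perm_sym => /perm_nilP->; apply: WordRefl.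
  have sub : {subset q ++ p <= t} by move=> u; rewrite (perm_mem tqp).
  apply: WordTrans (cons_graft_equiv xo yt ut _) _ => //.
  apply: WordTrans (graft_equiv xo (IH _ tt ut tqp) _) _ => //.
  apply/WordSym/(cons_graft_equiv xo) => //; first by rewrite -(perm_mem tqp).
  by rewrite -(perm_uniq tqp).
exact: (word_equiv_catC (x :: q) p).
Qed.

Definition conjugate (f g : V -> V) : Prop := exists u u' : V -> V,
  [/\ cancel u u', cancel u' u & forall x, g x = u' (f (u x))].

Lemma word_equiv_conjugate s t : {in s, forall x, x != 0} -> word_equiv s t ->
  conjugate (cox s) (cox t).
Proof.
move=> s0 st; elim: st s0 => {s t} [s|s t u st IHst tu IHtu|s t st IHst|x s|s x y t xy] s0.
- by exists id, id.
- have [p [p' [pK p'K pE]]] := IHst s0.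
  have [|q [q' [qK q'K qE]]] := IHtu.
    by move=> z; rewrite -(perm_mem (word_equiv_perm st)); apply: s0.
  exists (p \o q), (q' \o p'); split; [exact: can_comp..|].
  by move=> z; rewrite qE pE.
- have [|p [p' [pK p'K pE]]] := IHst.
    by move=> z; rewrite (perm_mem (word_equiv_perm st)); apply: s0.
  by exists p', p; split=> // z; rewrite pE p'K p'K.
- have x0 := s0 x (mem_head _ _).
  exists (reflection ip x), (reflection ip x); split; try exact: reflectionK.
  by move=> z; rewrite -cats1 coxeter_element_cat /= reflectionK.
- exists id, id; split=> // z; rewrite !coxeter_element_cat /=; congr (cox s _).
  move: (cox t z) => w; rewrite !reflectionE !ipE xy (ipC y x) xy !mulr0 !subr0.
  by rewrite addrAC.
Qed.

Lemma iter_conjugate (f g u u' : V -> V) m : cancel u u' -> cancel u' u ->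
  (forall x, g x = u' (f (u x))) -> forall x, iter m g x = u' (iter m f (u x)).
Proof. by move=> uK u'K gE; elim: m => [|m IH] x /=; rewrite ?uK // IH gE u'K. Qed.

Lemma has_order_conjugate (f g : V -> V) h :
  conjugate f g -> has_order f h -> has_order g h.
Proof.
move=> [u [u' [uK u'K gE]]] [h0 fh fk]; split=> //.
  by move=> x; rewrite (iter_conjugate _ uK u'K gE) fh uK.
move=> k kh gk; apply: (fk k kh) => x.
by have := gk (u' x); rewrite (iter_conjugate _ uK u'K gE) u'K => /(can_inj u'K).
Qed.

Lemma has_order_uniq (f : V -> V) h h' : has_order f h -> has_order f h' -> h = h'.
Proof.
move=> [h0 fh fk] [h0' fh' fk']; have [lt|lt|//] := ltngtP h h'.
- by case: (fk' h); rewrite ?h0.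
- by case: (fk h'); rewrite ?h0'.
Qed.

End Coxeter.

Lemma simple_system_reorder (R : realType) (V : vectType R) (ip : {dot V for idfun})
    (Phi : {fset V}) (b t t' : seq V) h :
  root_system ip Phi -> simple_system Phi b -> perm_eq t b -> tree ip t ->
  has_order (coxeter_element ip b) h -> perm_eq t t' ->
  simple_system Phi t' /\ has_order (coxeter_element ip t') h.
Proof.
move=> Phi_root bP tb tt bh tt'.
have bt' : perm_eq b t' by rewrite perm_sym in tb; apply: perm_trans tb tt'.
split; first exact: simple_system_perm bt' bP.
have ut : uniq t by rewrite (perm_uniq tb) (free_uniq (simple_free bP)).
apply: has_order_conjugate bh; apply: word_equiv_conjugate.
  by move=> x; apply: simple_neq0 Phi_root bP _.
by apply: WordTrans (tree_word_equiv tt ut tt'); apply/WordSym/tree_word_equiv.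
Qed.

(** * Frames *)

Section Frame.
Variables (R : realType) (V : vectType R) (ip : {dot V for idfun}).
Variables (T : finType) (E : T -> V) (k r : R).
Implicit Types (i j l : T).

Definition frame : Prop := forall i j, ip (E i) (E j) = k + r * (i == j)%:R.

Hypotheses (r_gt0 : 0 < r) (E_frame : frame).

Lemma frame_diff_ip i j l : ip (E i - E j) (E l) = r * ((i == l)%:R - (j == l)%:R).
Proof. by rewrite ipBl !E_frame; ring. Qed.

Lemma frame_diff_norm i j : i != j -> ip (E i - E j) (E i - E j) = 2 * r.
Proof. by move=> /negPf ij; rewrite ipBr !frame_diff_ip !eqxx (eq_sym j) ij /=; ring. Qed.

Lemma frame_inj : injective E.
Proof.
move=> i j Eij; have [//|/frame_diff_norm] := eqVneq i j.
by rewrite Eij subrr ip0l => /esym/eqP; rewrite mulf_eq0 pnatr_eq0 (gt_eqF r_gt0).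
Qed.

Lemma frame_reflection i j l : i != j -> reflection ip (E i - E j) (E l) = E (tperm i j l).
Proof.
move=> ij; rewrite reflectionE frame_diff_norm // ipC frame_diff_ip.
have -> : 2 * (r * ((i == l)%:R - (j == l)%:R)) / (2 * r) = (i == l)%:R - (j == l)%:R.
  by field; rewrite gt_eqF.
case: tpermP => [->|->|/nesym/eqP/negPf-> /nesym/eqP/negPf->].
- by rewrite eqxx eq_sym (negPf ij) subr0 scale1r opprB addrC subrK.
- by rewrite eqxx (negPf ij) sub0r scaleN1r opprK addrC subrK.
- by rewrite subrr scale0r subr0.
Qed.

End Frame.

Section Steps.
Variables (R : realType) (V : vectType R) (ip : {dot V for idfun}).
Variables (n : nat) (E : 'I_n.+1 -> V).

Definition steps m : seq V := mkseq (fun i => E (inord i.+1) - E (inord i)) m.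

Lemma mem_steps m a : a \in steps m ->
  exists2 i, (i < m)%N & a = E (inord i.+1) - E (inord i).
Proof. by case/mapP => i; rewrite mem_iota => im ->; exists i. Qed.

Lemma inord_neq i j : (i <= n)%N -> (j <= n)%N -> i != j ->
  (inord i : 'I_n.+1) != inord j.
Proof. by move=> i_n jn; apply: contra_neq => /(congr1 val) /=; rewrite !inordK. Qed.

Lemma mem_steps_diff a : a \in steps n -> exists i j, i != j /\ a = E i - E j.
Proof.
case/mem_steps => i i_n ->; exists (inord i.+1), (inord i); split=> //.
by rewrite inord_neq ?gtn_eqF // ltnW.
Qed.

Variables (k r : R).
Hypotheses (r_gt0 : 0 < r) (E_frame : frame ip E k r).

Lemma frame_diff_root (Phi : {fset V}) : root_system ip Phi -> {subset steps n <= Phi} ->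
  forall i j, i != j -> E i - E j \in Phi.
Proof.
move=> Phi_root sub; have up i j : (i < j)%N -> (j <= n)%N ->
    E (inord j) - E (inord i) \in Phi.
  elim: j => // j IH; rewrite ltnS leq_eqVlt => ij jn.
  have step_root : E (inord j.+1) - E (inord j) \in Phi.
    by apply/sub/mapP; exists j; rewrite ?mem_iota.
  case/predU1P: ij => [->//|ij].
  have := root_reflection Phi_root step_root (IH ij (ltnW jn)).
  have [j_neqS [j_neqi jS_neqi]] : inord j.+1 != inord j :> 'I_n.+1 /\
      inord j != inord i :> 'I_n.+1 /\ inord j.+1 != inord i :> 'I_n.+1.
    by rewrite !inord_neq; lia.
  by rewrite linearB /= !(frame_reflection r_gt0 E_frame) // tpermR tpermD.
move=> i j; rewrite neq_ltn => /orP[ij|ji].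
  rewrite -opprB -(inord_val i) -(inord_val j).
  by apply/(root_opp Phi_root)/up; rewrite // -ltnS.
by rewrite -(inord_val i) -(inord_val j); apply: up; rewrite // -ltnS.
Qed.

(* The steps form the cycle E 0 -> E 1 -> ... -> E n -> E 0, read as a product of
   transpositions from the right. *)
Lemma coxeter_steps_nat m j : (m <= n)%N -> (j <= n)%N ->
  coxeter_element ip (steps m) (E (inord j)) =
    E (inord (if (j < m)%N then j.+1 else if j == m then 0 else j)).
Proof.
elim: m j => [|m IH] j mn jn; first by case: eqP => [->|].
have mS : inord m.+1 != inord m :> 'I_n.+1 by rewrite inord_neq ?gtn_eqF // ltnW.
rewrite /steps mkseqS -cats1 coxeter_element_cat -/(steps m) /=.
rewrite (frame_reflection r_gt0 E_frame) //.
have [->|jmS] := eqVneq j m.+1; first by rewrite tpermL IH ?ltnn ?eqxx // ltnW.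
have [->|jm] := eqVneq j m.
  by rewrite tpermR IH ?(ltnW mn) // ltnNge leqnSn /= gtn_eqF // ltnSn.
have [m_neqj mS_neqj] : inord m != inord j :> 'I_n.+1 /\ inord m.+1 != inord j :> 'I_n.+1.
  by rewrite !inord_neq; lia.
rewrite tpermD // IH ?(ltnW mn) //.
by rewrite [in RHS]ltnS [in RHS]leq_eqVlt (negPf jm).
Qed.

Lemma coxeter_steps i : coxeter_element ip (steps n) (E i) = E (ordS i).
Proof.
have i_n : (i <= n)%N by rewrite -ltnS.
rewrite -{1}(inord_val i) coxeter_steps_nat //; congr (E _); apply: val_inj => /=.
move: i_n; rewrite leq_eqVlt => /predU1P[->|lt]; first by rewrite ltnn eqxx modnn inordK.
by rewrite lt inordK // modn_small.
Qed.

Lemma iter_coxeter_steps m i :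
  iter m (coxeter_element ip (steps n)) (E i) = E (iter m (@ordS n.+1) i).
Proof. by elim: m => //= m ->; apply: coxeter_steps. Qed.

Lemma val_iter_ordS m (i : 'I_n.+1) : iter m (@ordS n.+1) i = ((i + m) %% n.+1)%N :> nat.
Proof.
elim: m => [|m IH]; first by rewrite addn0 modn_small.
by rewrite iterS /= IH -addn1 modnDml addn1 addnS.
Qed.

Lemma coxeter_steps_order : (<<steps n>> = fullv)%VS ->
  has_order (coxeter_element ip (steps n)) n.+1.
Proof.
move=> span_steps; split=> //.
  apply: (linear_span_id span_steps) => _ /mem_steps_diff[i [j [_ ->]]].
  rewrite linearB /= -!iterS !iter_coxeter_steps; congr (E _ - E _); apply: ord_inj;
    by rewrite val_iter_ordS modnDr modn_small.
move=> m /andP[m_gt0 mn] /(_ (E ord0)); rewrite iter_coxeter_steps.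
move/(frame_inj r_gt0 E_frame)/(congr1 (@nat_of_ord _)).
rewrite val_iter_ordS add0n modn_small //=.
by case: m m_gt0 {mn}.
Qed.

End Steps.

Section ArmFrame.
Variables (R : realType) (V : vectType R) (ip : {dot V for idfun}).
Implicit Types (z e : V) (L : seq V).

Lemma arm_gram z L i j : arm ip z L -> (i <= size L)%N -> (j <= size L)%N ->
  ip (z :: L)`_i (z :: L)`_j =
    ip z z / 2 * (2 * (i == j)%:R - (i == j.+1)%:R - (i.+1 == j)%:R).
Proof.
elim: L z i j => [|x L IH] z i j; first by case: i j => [|//] [|//] _ _ _ /=; field.
move=> [[zx xz] /orthogonal1lP zL xL].
have zLj k : (k < size L)%N -> ip z L`_k = 0 by move=> kL; rewrite zL ?mem_nth.
case: i j => [|i] [|j] /=; rewrite ?ltnS => iL jL.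
- by field.
- by case: j jL => [|j] jL /=; [rewrite xz|rewrite zLj //]; field.
- by rewrite ipC; case: i iL => [|i] iL /=; [rewrite xz|rewrite zLj //]; field.
- by rewrite (IH x i j) // -zx !eqSS.
Qed.

(* The vectors e, e + z, e + z + L_0, ..., whose successive differences are z :: L. *)
Lemma arm_frame z L e r (n := (size L).+1) : arm ip z L -> ip z z = 2 * r ->
  ip z e = - r -> {in L, forall u, ip u e = 0} ->
  exists E : 'I_n.+1 -> V,
    [/\ z :: L = steps E n, E ord0 = e & frame ip E (ip e e - r) r].
Proof.
move=> zL zz ze Le; set t := z :: L.
pose F i := e + \sum_(k < i) t`_k; exists (fun i => F i).
have FS i : F i.+1 = F i + t`_i by rewrite /F big_ord_recr addrA.
have tt i j : (i < n)%N -> (j < n)%N ->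
    ip t`_i t`_j = r * (2 * (i == j)%:R - (i == j.+1)%:R - (i.+1 == j)%:R).
  by move=> i_n jn; rewrite (arm_gram zL) // zz; field.
have te i : (i < n)%N -> ip t`_i e = - r * (i == 0)%:R.
  case: i => [|i] i_n /=; first by rewrite ze mulr1.
  by rewrite Le ?mem_nth // mulr0.
have tF i j : (i < n)%N -> (j <= n)%N ->
    ip t`_i (F j) = r * ((i.+1 == j)%:R - (i == j)%:R).
  move=> i_n; elim: j => [|j IH] jn; first by rewrite /F big_ord0 addr0 te //=; ring.
  by rewrite FS ipDr IH ?tt // 1?ltnW // eqSS; ring.
have F0 j : (j <= n)%N -> ip (F 0) (F j) = (ip e e - r) + r * (0 == j)%:R.
  elim: j => [|j IH] jn; first by rewrite /F big_ord0 addr0 eqxx mulr1 subrK.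
  rewrite FS ipDr IH 1?ltnW // ipC tF // [0 == j]eq_sym [0 == j.+1]eq_sym.
  by case: j jn {IH} => [|j] jn /=; ring.
split; last move=> [i i_n] [j jn].
- apply: (@eq_from_nth _ 0); rewrite ?size_mkseq // => i i_n.
  by rewrite nth_mkseq // !inordK ?FS 1?addrC ?addKr // ltnW.
- by rewrite /F big_ord0 addr0.
rewrite -val_eqE /=; elim: i i_n => [|i IH] i_n; first by apply: F0; rewrite -ltnS.
by rewrite FS ipDl (IH (ltnW i_n)) tF //; ring.
Qed.

End ArmFrame.

Section OrthogonalFrame.
Variables (R : realType) (V : vectType R) (ip : {dot V for idfun}).
Variables (T : finType) (G : T -> V) (r : R).
Hypotheses (r_gt0 : 0 < r) (G_frame : frame ip G 0 r).
Implicit Types (i j l : T) (b c : bool) (a x : V) (f : V -> V).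

Lemma orthogonal_frameE i j : ip (G i) (G j) = r * (i == j)%:R.
Proof. by rewrite G_frame add0r. Qed.

Definition coord_vec (c : T -> R) : V := \sum_j (c j / r) *: G j.

Lemma ip_coord_vec (c : T -> R) i : ip (G i) (coord_vec c) = c i.
Proof.
rewrite /coord_vec ip_sumr (bigD1 i) //= ipZr orthogonal_frameE eqxx mulr1.
rewrite divfK ?gt_eqF // big1 ?addr0 // => j /negPf ji.
by rewrite ipZr orthogonal_frameE eq_sym ji !mulr0.
Qed.

Lemma signed_frame_inj i j b c : (-1) ^+ b *: G i = (-1) ^+ c *: G j -> i = j /\ b = c.
Proof.
move/(congr1 (ip (G i))); rewrite !ipZr !orthogonal_frameE eqxx mulr1.
case: (eqVneq i j) => [-> /=|ij /=]; last first.
  by move/eqP; rewrite !mulr0 mulf_eq0 signr_eq0 (gt_eqF r_gt0).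
by rewrite mulr1 => /(mulIf (lt0r_neq0 r_gt0))/signr_inj.
Qed.

Definition signed_perm f : Prop := exists (s : {perm T}) (e : T -> bool),
  forall i, f (G i) = (-1) ^+ e i *: G (s i).

Definition signed_pair a : Prop := exists i j b c,
  i != j /\ a = (-1) ^+ b *: G i + (-1) ^+ c *: G j.

Definition signed_single (k : R) a : Prop := exists i b, a = (-1) ^+ b *: (k *: G i).

Lemma signed_pair_diff i j : i != j -> signed_pair (G i - G j).
Proof. by exists i, j, false, true; rewrite expr0 expr1 scale1r scaleN1r. Qed.

Lemma signed_pair_opp a : signed_pair a -> signed_pair (- a).
Proof.
move=> [i [j [b [c [ij ->]]]]]; exists i, j, (~~ b), (~~ c).
by rewrite opprD !signrN !scaleNr.
Qed.

Lemma signed_single_opp k a : signed_single k a -> signed_single k (- a).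
Proof. by move=> [i [b ->]]; exists i, (~~ b); rewrite signrN scaleNr. Qed.

Lemma signed_pair_perm (f : {linear V -> V}) a :
  signed_perm f -> signed_pair a -> signed_pair (f a).
Proof.
move=> [s [e fG]] [i [j [b [c [ij ->]]]]].
exists (s i), (s j), (b (+) e i), (c (+) e j); rewrite (inj_eq perm_inj); split=> //.
by rewrite linearD !linearZ /= !fG !scalerA !signr_addb.
Qed.

Lemma signed_single_perm k (f : {linear V -> V}) a :
  signed_perm f -> signed_single k a -> signed_single k (f a).
Proof.
move=> [s [e fG]] [i [b ->]]; exists (s i), (b (+) e i).
by rewrite !linearZ /= fG !scalerA signr_addb; congr (_ *: _); ring.
Qed.

Lemma signed_perm_diff i j : i != j -> signed_perm (reflection ip (G i - G j)).
Proof.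
move=> ij; exists (tperm i j), (fun=> false) => l.
by rewrite expr0 scale1r (frame_reflection r_gt0 G_frame).
Qed.

Lemma reflection_sum i j l : i != j ->
  reflection ip (G i + G j) (G l) = (-1) ^+ ((l == i) || (l == j)) *: G (tperm i j l).
Proof.
move=> ij; have rr : r + r != 0 by rewrite gt_eqF // addr_gt0.
have rrE : 2 * r / (r + r) = 1 by rewrite mulr_natl mulr2n divff.
rewrite reflectionE !ipE !orthogonal_frameE !eqxx [j == i]eq_sym (negPf ij).
case: tpermP => [->|->|/eqP/negPf li /eqP/negPf lj].
- rewrite eqxx (negPf ij) !(mulr1, mulr0, addr0, add0r) rrE scale1r expr1 scaleN1r.
  by rewrite opprD addNKr.
- rewrite eqxx eq_sym (negPf ij) !(mulr1, mulr0, addr0, add0r) rrE scale1r expr1 scaleN1r.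
  by rewrite opprD addrCA subrr addr0.
- by rewrite li lj !(mulr0, addr0, mul0r) scale0r subr0 expr0 scale1r.
Qed.

Lemma signed_perm_sum i j : i != j -> signed_perm (reflection ip (G i + G j)).
Proof.
move=> ij; exists (tperm i j), (fun l => (l == i) || (l == j)) => l.
exact: reflection_sum.
Qed.

Lemma reflection_single (k : R) i l : k != 0 ->
  reflection ip (k *: G i) (G l) = (-1) ^+ (l == i) *: G l.
Proof.
move=> k0; rewrite reflectionE !ipE !orthogonal_frameE eqxx.
have [->|li] := eqVneq l i; last first.
  by rewrite expr0 scale1r !mulr0 mul0r scale0r subr0.
rewrite expr1 scaleN1r scalerA mulr1 (_ : _ / _ * k = 2); last first.
  by field; rewrite k0 (gt_eqF r_gt0).
by rewrite scaler_nat mulr2n opprD addNKr.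
Qed.

Lemma signed_perm_single (k : R) i : k != 0 -> signed_perm (reflection ip (k *: G i)).
Proof. by move=> k0; exists 1%g, (fun l => l == i) => l; rewrite perm1 reflection_single. Qed.

Lemma signed_pair_norm a : signed_pair a -> ip a a = 2 * r.
Proof.
move=> [i [j [b [c [/negPf ij ->]]]]].
rewrite !ipE !orthogonal_frameE !eqxx [j == i]eq_sym ij !mulr0 !mulr1 addr0 add0r.
by rewrite !signrMK; ring.
Qed.

Lemma signed_single_norm k a : signed_single k a -> ip a a = k ^+ 2 * r.
Proof.
by move=> [i [b ->]]; rewrite hnorm_sign /= !ipE orthogonal_frameE eqxx mulr1 mulrA -expr2.
Qed.

Lemma signed_pair_ip_le (C : R) x : (forall i j, i != j -> `|ip (G i) x| + `|ip (G j) x| <= C) ->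
  forall a, signed_pair a -> ip a x <= C.
Proof.
move=> xC a [i [j [b [c [ij ->]]]]]; rewrite !ipE; apply: le_trans (xC i j ij).
by apply: lerD; rewrite (le_trans (ler_norm _)) // normrMsign.
Qed.

Hypothesis G_total : forall x, (forall i, ip (G i) x = 0) -> x = 0.

Lemma coord_vec_ip x : x = coord_vec (fun i => ip (G i) x).
Proof.
by apply/eqP; rewrite -subr_eq0; apply/eqP/G_total => i; rewrite ipBr ip_coord_vec subrr.
Qed.

End OrthogonalFrame.

Section SignedCycle.
Variables (R : realType) (V : vectType R) (ip : {dot V for idfun}).
Variables (n : nat) (G : 'I_n.+1 -> V) (r : R).
Hypotheses (r_gt0 : 0 < r) (G_frame : frame ip G 0 r).
Hypothesis G_total : forall x, (forall i, ip (G i) x = 0) -> x = 0.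

Lemma signed_cycle_order (f : {linear V -> V}) m (p := (n.+1 - m)%N) : (m <= n)%N ->
  (forall j, (m <= j < n)%N -> f (G (inord j)) = G (inord j.+1)) ->
  f (G (inord n)) = - G (inord m) ->
  (forall j, (j < m)%N -> f (G (inord j)) = - G (inord j)) ->
  has_order f (2 * p).
Proof.
move=> mn fS fn f0; pose g j := G (inord j).
have up k j : (m <= j)%N -> (j + k <= n)%N -> iter k f (g j) = g (j + k)%N.
  move=> mj; elim: k => [|k IH] jk; first by rewrite addn0.
  rewrite addnS in jk *; rewrite iterS (IH (ltnW jk)) /g fS //.
  by rewrite jk (leq_trans mj (leq_addr k j)).
have half j : (m <= j <= n)%N -> iter p f (g j) = - g j.
  case/andP => mj jn; have -> : p = ((j - m) + (1 + (n - j)))%N by rewrite /p; lia.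
  by rewrite iterD iterD up // ?subnKC //= /g fn linearN /= -/(g m) up ?leqnn ?subnKC //.
have full j : (j <= n)%N -> iter (2 * p) f (g j) = g j.
  move=> jn; rewrite mul2n -addnn; have [jm|mj] := ltnP j m; last first.
    by rewrite iterD half ?mj // linearN /= half ?mj // opprK.
  have sign k : iter k f (g j) = (-1) ^+ k *: g j.
    elim: k => [|k IH]; first by rewrite expr0 scale1r.
    by rewrite iterS IH linearZ /= /g f0 // scalerN exprS mulN1r scaleNr.
  by rewrite sign exprD -expr2 sqrr_sign scale1r.
split; first by rewrite muln_gt0 subn_gt0 ltnS.
  move=> x; rewrite (coord_vec_ip r_gt0 G_frame G_total x) /coord_vec linear_sum.
  by apply: eq_bigr => i _; rewrite linearZ /= -(inord_val i) -/(g i) full // -ltnS.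
have neq_gm j b : (m < j <= n)%N || b -> (m <= j <= n)%N -> (-1) ^+ b *: g j <> g m.
  move=> jb /andP[mj jn] /esym; rewrite -[g m]scale1r -(expr0 (-1)).
  case/(signed_frame_inj (b := false) r_gt0 G_frame) => /(congr1 (@nat_of_ord _)).
  by rewrite !inordK // => mE bE; move: jb; rewrite mE -bE ltnn.
move=> k /andP[k_gt0 k_lt] /(_ (g m)); have [kp|pk] := ltnP k p.
  rewrite up ?leqnn //; last by rewrite /p in kp; lia.
  by rewrite -[g _]scale1r -(expr0 (-1)); apply: (neq_gm _ false); rewrite /p in kp; lia.
rewrite -(subnK pk) iterD half ?leqnn // linearN /= up ?leqnn //; last by rewrite /p in k_lt; lia.
by rewrite -scaleN1r -(expr1 (-1)); apply: (neq_gm _ true); rewrite ?orbT // /p in k_lt *; lia.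
Qed.

End SignedCycle.

(** * Coordinates of roots in a simple system *)

Section RootCoordinates.
Variables (M : seq (seq int)) (n : nat).
Implicit Types (c f : seq int) (i : nat).

Definition int_dot f c : int := foldr +%R 0 (mkseq (fun k => f`_k * c`_k) n).
Definition cartan_entry i j : int := (nth [::] M i)`_j.
Definition unit_coords i : seq int := mkseq (fun k => (k == i)%:R) n.
Definition opp_coords c : seq int := mkseq (fun k => - c`_k) n.

(* For a simple system t, the entry M i j is meant to be 2 <t_i, t_j> / <t_i, t_i>. The
   i-th simple reflection then acts on the coordinates c of a vector in t by
   [reflect_coords], and on its inner products f with t by [reflect_values]. *)
Definition reflect_coords i c : seq int :=
  let d := int_dot (nth [::] M i) c in mkseq (fun k => if k == i then c`_k - d else c`_k) n.
Definition reflect_values i f : seq int :=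
  let d := f`_i in mkseq (fun k => f`_k - cartan_entry i k * d) n.

Definition coxeter_coords c := foldr reflect_coords c (iota 0 n).
Definition coxeter_values f := foldr reflect_values f (iota 0 n).

(* Every orbit of the Coxeter element s_0 ... s_(n-1) on the roots contains exactly one
   of the roots s_0 ... s_(i-1) (t_i). *)
Definition coxeter_orbits h : seq (seq int) :=
  let start i := foldr reflect_coords (unit_coords i) (iota 0 i) in
  flatten [seq traject coxeter_coords (start i) h | i <- iota 0 n].

Definition root_closed rts : bool :=
  all (fun i => unit_coords i \in rts) (iota 0 n) &&
  all (fun c =>
    (opp_coords c \in rts) && all (fun i => reflect_coords i c \in rts) (iota 0 n)) rts.

(* The fundamental coweight of [node] is at most m on the roots, and only its multiples
   are determined by the roots where it takes the value m. *)
Definition coweight_vertex rts node m : bool :=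
  let top := [seq c <- rts | c`_node == m%:Z] in
  [&& all (fun c => c`_node <= m%:Z) rts, top != [::]
    & all (fun i => (i == node) || has (fun c => has (fun c' =>
        all (fun k => c`_k - c'`_k == (k == i)%:R) (iota 0 n)) top) top) (iota 0 n)].

Definition coxeter_period h : bool :=
  all (fun i => iter h coxeter_coords (unit_coords i) == unit_coords i) (iota 0 n).

Definition coxeter_free f h : bool :=
  all (fun j => ~~ all (fun k => (iter j coxeter_values f)`_k == f`_k) (iota 0 n)) (iota 1 h.-1).

Definition coxeter_cover rts f m h : bool :=
  all (fun c => has (fun j => int_dot f (iter j coxeter_coords c) == m%:Z) (iota 0 h)) rts.

(* The vertex is the image under the word w of the fundamental coweight of [node]. In type
   E8 the Coxeter orbit of the coweight itself does not reach every root. *)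
Definition certificate node m (w : seq nat) h : bool :=
  let rts := coxeter_orbits h in
  let f := foldr reflect_values (unit_coords node) w in
  [&& [&& (node < n)%N, (0 < m)%N, (0 < h)%N & all (gtn n) w],
      root_closed rts, coweight_vertex rts node m, coxeter_period h,
      coxeter_free f h & coxeter_cover rts f m h].

Lemma int_dotE f c : int_dot f c = \sum_(k < n) f`_k * c`_k.
Proof. by rewrite /int_dot foldrE big_map -{1}(subn0 n) -/(index_iota 0 n) big_mkord. Qed.

End RootCoordinates.

(* The nodes 1, 2, ..., n - 1 form a chain and the node 0 is attached to the node 3. *)
Definition E_cartan n : seq (seq int) :=
  let edge i j := ((0 < i)%N && (j == i.+1)) || ((i, j) == (0%N, 3%N)) in
  mkseq (fun i => mkseq (fun j =>
    if i == j then 2%:Z else if edge i j || edge j i then -1 else 0) n) n.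

Lemma certificate_E6 : certificate (E_cartan 6) 6 1 1 [::] 12.
Proof. by vm_compute. Qed.

Lemma certificate_E7 : certificate (E_cartan 7) 7 6 1 [::] 18.
Proof. by vm_compute. Qed.

Lemma certificate_E8 : certificate (E_cartan 8) 8 1 2
  [:: 4; 5; 6; 0; 3; 4; 5; 2; 3; 4; 0; 3; 2; 1]%N 30.
Proof. by vm_compute. Qed.

Section CoordinateTransfer.
Variables (R : realType) (V : vectType R) (ip : {dot V for idfun}).
Variables (Phi : {fset V}) (t : seq V) (M : seq (seq int)).
Local Notation n := (size t).
Local Notation reflect_coords := (reflect_coords M n).
Local Notation reflect_values := (reflect_values M n).
Local Notation coxeter_coords := (coxeter_coords M n).
Local Notation coxeter_values := (coxeter_values M n).
Local Notation cox := (coxeter_element ip t).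
Hypotheses (Phi_root : root_system ip Phi) (Phi_reduced : reduced Phi).
Hypothesis t_simple : simple_system Phi t.
Hypothesis t_cartan : forall i j, (i < n)%N -> (j < n)%N ->
  cartan_number ip t`_j t`_i = (cartan_entry M i j)%:~R.
Implicit Types (i j k h : nat) (c f : seq int) (s : seq nat) (a u v x : V).

Definition lcomb c : V := \sum_(k < n) (c`_k)%:~R *: t`_k.

Definition simple_values f v : Prop :=
  forall k, (k < n)%N -> ip t`_k v = (f`_k)%:~R.

Lemma simple_nth_root i : (i < n)%N -> t`_i \in Phi.
Proof. by move=> i_n; rewrite (simple_root t_simple) ?mem_nth. Qed.

Lemma nth_ip_eq0 x : (forall i, (i < n)%N -> ip t`_i x = 0) -> x = 0.
Proof.
move=> tx; apply: (simple_ip_eq0 (ip := ip) t_simple) => y yt.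
by rewrite -(nth_index 0 yt) tx ?index_mem.
Qed.

Lemma lcomb_unit i : (i < n)%N -> lcomb (unit_coords n i) = t`_i.
Proof.
move=> i_n; rewrite /lcomb (bigD1 (Ordinal i_n)) //= nth_mkseq // eqxx scale1r.
rewrite big1 ?addr0 // => k; rewrite -val_eqE /= => /negPf ki.
by rewrite nth_mkseq // ki scale0r.
Qed.

Lemma lcomb_opp c : lcomb (opp_coords n c) = - lcomb c.
Proof.
by rewrite /lcomb -sumrN; apply: eq_bigr => k _; rewrite nth_mkseq // rmorphN scaleNr.
Qed.

Lemma lcomb_diff c c' i : (i < n)%N ->
  all (fun k => c`_k - c'`_k == (k == i)%:R) (iota 0 n) -> lcomb c - lcomb c' = t`_i.
Proof.
move=> i_n /allP cc'; rewrite -(lcomb_unit i_n) /lcomb -sumrB; apply: eq_bigr => k _.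
have /eqP ck : c`_k - c'`_k == (k == i :> nat)%:R by apply: cc'; rewrite mem_iota /=.
by rewrite -scalerBl -rmorphB /= ck nth_mkseq.
Qed.

Lemma ip_lcomb f c v : simple_values f v -> ip (lcomb c) v = (int_dot n f c)%:~R.
Proof.
move=> fv; rewrite int_dotE ip_suml rmorph_sum; apply: eq_bigr => k _ /=.
by rewrite ipZl fv // -intrM mulrC.
Qed.

Lemma cartan_number_lcomb i c : (i < n)%N ->
  cartan_number ip (lcomb c) t`_i = (int_dot n (nth [::] M i) c)%:~R.
Proof.
move=> i_n; rewrite /cartan_number ip_suml mulr_sumr mulr_suml int_dotE rmorph_sum.
apply: eq_bigr => k _ /=; rewrite ipZl intrM -/(cartan_entry M i k) -t_cartan // /cartan_number.
by ring.
Qed.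

Lemma reflection_lcomb i c : (i < n)%N ->
  reflection ip t`_i (lcomb c) = lcomb (reflect_coords i c).
Proof.
move=> i_n; rewrite /reflection cartan_number_lcomb //.
rewrite {1}/lcomb [RHS]/lcomb (bigD1 (Ordinal i_n)) //= [in RHS](bigD1 (Ordinal i_n)) //=.
rewrite nth_mkseq // eqxx rmorphB scalerBl addrAC; congr (_ + _).
apply: eq_bigr => k; rewrite -val_eqE /= => /negPf ki.
by rewrite nth_mkseq // ki.
Qed.

Lemma reflection_simple_values i f v : (i < n)%N -> simple_values f v ->
  simple_values (reflect_values i f) (reflection ip t`_i v).
Proof.
move=> i_n fv k kn; rewrite ipBr ipZr fv // nth_mkseq // rmorphB rmorphM /= -t_cartan //.
by rewrite /cartan_number (ipC v) fv //; congr (_ - _); ring.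
Qed.

Lemma coxeter_word_lcomb s c : all (gtn n) s ->
  coxeter_element ip [seq t`_i | i <- s] (lcomb c) = lcomb (foldr reflect_coords c s).
Proof. by elim: s => //= i s IH /andP[i_n /IH->]; apply: reflection_lcomb. Qed.

Lemma coxeter_word_simple_values s f v : all (gtn n) s -> simple_values f v ->
  simple_values (foldr reflect_values f s) (coxeter_element ip [seq t`_i | i <- s] v).
Proof.
by elim: s => //= i s IH /andP[i_n sn] fv; apply: reflection_simple_values; last exact: IH.
Qed.

Lemma coxeter_wordE : cox = coxeter_element ip [seq t`_i | i <- iota 0 n].
Proof. by rewrite -/(mkseq _ _) mkseq_nth. Qed.

Let all_iota : all (gtn n) (iota 0 n).
Proof. by apply/allP => i; rewrite mem_iota. Qed.

Lemma iter_cox_lcomb k c : iter k cox (lcomb c) = lcomb (iter k coxeter_coords c).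
Proof. by elim: k => //= k ->; rewrite coxeter_wordE (coxeter_word_lcomb _ all_iota). Qed.

Lemma iter_cox_simple_values k f v : simple_values f v ->
  simple_values (iter k coxeter_values f) (iter k cox v).
Proof.
by move=> fv; elim: k => //= k IH; rewrite {1}coxeter_wordE; apply: coxeter_word_simple_values.
Qed.

Lemma simple_values_exists f : exists v, simple_values f v.
Proof.
have [v vP] := riesz ip (fun x => (f`_(index x t))%:~R) (simple_free t_simple).
exists v => k kn; rewrite vP ?mem_nth // index_uniq //.
exact/free_uniq/simple_free/t_simple.
Qed.

Lemma root_closed_roots rts : root_closed M n rts ->
  forall a, a \in Phi -> exists2 c, c \in rts & a = lcomb c.
Proof.
case/andP => /allP rts_unit /allP rts_closed.
apply: (root_ind Phi_root Phi_reduced t_simple) => [x xt|_ [c crts ->]|_ x xt [c crts ->]].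
- have xi : (index x t < n)%N by rewrite index_mem.
  exists (unit_coords n (index x t)); first by rewrite rts_unit ?mem_iota.
  by rewrite lcomb_unit // nth_index.
- have /andP[oppc _] := rts_closed c crts; by exists (opp_coords n c); rewrite ?lcomb_opp.
- have xi : (index x t < n)%N by rewrite index_mem.
  have /andP[_ /allP reflc] := rts_closed c crts; exists (reflect_coords (index x t) c).
    by rewrite reflc ?mem_iota.
  by rewrite -reflection_lcomb // nth_index.
Qed.

Lemma coxeter_orbits_root h : {in coxeter_orbits M n h, forall c, lcomb c \in Phi}.
Proof.
have word_root s a : all (gtn n) s -> a \in Phi ->
    coxeter_element ip [seq t`_i | i <- s] a \in Phi.
  by elim: s => //= i s IH /andP[i_n sn] aP; rewrite root_reflection ?simple_nth_root ?IH.
move=> c /flatten_mapP[i]; rewrite mem_iota /= => i_n /trajectP[k _ ->].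
rewrite -iter_cox_lcomb; elim: k => [|k IH] /=; last by rewrite {1}coxeter_wordE word_root.
have i_lt : all (gtn n) (iota 0 i).
  by apply/allP => j; rewrite mem_iota /= => ji; apply: ltn_trans i_n.
by rewrite -coxeter_word_lcomb // lcomb_unit // word_root ?simple_nth_root.
Qed.

Lemma coxeter_freeP f h u : coxeter_free M n f h -> simple_values f u ->
  forall k, (0 < k < h)%N -> iter k cox u <> u.
Proof.
move=> /allP free_f fu k kh ku; have := free_f k; rewrite mem_iota.
case: h kh {free_f} => [|h]; rewrite ?andbF // add1n => -> /(_ isT)/negP; apply.
apply/allP => i; rewrite mem_iota /= => i_n; apply/eqP/(@intr_inj R).
by rewrite -(iter_cox_simple_values k fu) // ku fu.
Qed.

Lemma coxeter_order f h : (0 < h)%N -> coxeter_period M n h -> coxeter_free M n f h ->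
  has_order cox h.
Proof.
move=> h_gt0 /allP period free_f; split=> //; last first.
  move=> k kh cox_id; have [u fu] := simple_values_exists f.
  exact: coxeter_freeP free_f fu k kh (cox_id u).
apply: (linear_span_id (simple_span t_simple)) => y yt.
have yi : (index y t < n)%N by rewrite index_mem.
have /eqP yE : iter h coxeter_coords (unit_coords n (index y t)) == unit_coords n (index y t).
  by apply: period; rewrite mem_iota.
by rewrite -(nth_index 0 yt) -lcomb_unit //= iter_cox_lcomb yE.
Qed.

End CoordinateTransfer.

(** * Symmetric alcoved polytopes *)

Section SymmetricAlcoved.
Variables (R : realType) (V : vectType R) (ip : {dot V for idfun}).
Variables (Phi : {fset V}) (P : set V).
Hypotheses (Phi_root : root_system ip Phi) (Phi_reduced : reduced Phi).
Implicit Types (a x v z : V) (b s L : seq V) (h : nat).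
Local Notation W := (weyl_group ip Phi).
Local Notation cox := (coxeter_element ip).

Lemma weyl_isometry w : W w -> forall x y, ip (w x) (w y) = ip x y.
Proof.
elim=> {w} [a aP x y|//|f g _ fP _ gP x y|f g _ fP fg gf x y].
- by rewrite reflection_ip // (root_neq0 Phi_root).
- by rewrite /= fP gP.
- by rewrite -fP !gf.
Qed.

Lemma weyl_inverse w : W w -> exists w', [/\ W w', cancel w w' & cancel w' w].
Proof.
elim=> {w} [a aP||f g _ [f' [Wf' fK f'K]] _ [g' [Wg' gK g'K]]|f g Wf _ fg gf].
- have a0 := root_neq0 Phi_root aP.
  by exists (reflection ip a); split; [apply: weyl_reflection|apply: reflectionK..].
- by exists id; split=> //; apply: weyl_id.
- by exists (g' \o f'); split; [apply: weyl_comp|apply: can_comp..].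
- by exists f.
Qed.

Lemma weyl_root w : W w -> forall a, (w a \in Phi) = (a \in Phi).
Proof.
elim=> {w} [x xP a|//|f g _ fP _ gP a|f g _ fP _ fgK a].
- apply/idP/idP; last exact: root_reflection.
  by move/(root_reflection Phi_root xP); rewrite reflectionK // (root_neq0 Phi_root).
- by rewrite /= fP gP.
- by rewrite -{2}[a]fgK fP.
Qed.

Lemma weyl_iter w k : W w -> W (iter k w).
Proof. by move=> Ww; elim: k => [|k IH]; [exact: weyl_id|exact: weyl_comp Ww IH]. Qed.

Lemma weyl_coxeter s : {subset s <= Phi} -> W (cox s).
Proof.
elim: s => [|a s IH] sub; first exact: weyl_id.
apply: weyl_comp; first by apply: weyl_reflection; rewrite sub ?mem_head.
by apply: IH => x xs; apply/sub/mem_consr.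
Qed.

Definition weyl_conj a a' : Prop := exists2 w, W w & w a = a'.

Lemma weyl_conj_refl a : weyl_conj a a.
Proof. by exists id => //; apply: weyl_id. Qed.

Lemma weyl_conj_trans a a' a'' :
  weyl_conj a a' -> weyl_conj a' a'' -> weyl_conj a a''.
Proof. by move=> [w Ww <-] [w' Ww' <-]; exists (w' \o w) => //; apply: weyl_comp. Qed.

Lemma weyl_conj_reflection a x : x \in Phi -> weyl_conj a (reflection ip x a).
Proof. by move=> xP; exists (reflection ip x) => //; apply: weyl_reflection. Qed.

Lemma weyl_conj_bond x y : x \in Phi -> y \in Phi -> bond ip x y -> weyl_conj x y.
Proof.
move=> xP yP [yy xy].
have xx : ip x x != 0 by rewrite ip_eq0 (root_neq0 Phi_root).
have <- : reflection ip x (reflection ip y x) = y.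
  rewrite !reflectionE !ipE (ipC y x) xy -yy.
  rewrite (_ : 2 * (- ip x x / 2) / ip x x = -1); last by field.
  rewrite (_ : 2 * _ / _ = 1); last by field.
  by rewrite scaleN1r opprK scale1r addrC addKr.
exact: weyl_conj_trans (weyl_conj_reflection _ yP) (weyl_conj_reflection _ xP).
Qed.

Lemma weyl_conj_arm z L : {subset z :: L <= Phi} -> arm ip z L ->
  {in z :: L, forall x, weyl_conj z x}.
Proof.
elim: L z => [|y L IH] z sub zL x; rewrite in_cons.
  by rewrite in_nil orbF => /eqP->; apply: weyl_conj_refl.
case/predU1P => [->|xL]; first exact: weyl_conj_refl.
case: zL => zy _ yL; apply: weyl_conj_trans (IH y _ yL x xL).
  by apply: weyl_conj_bond zy; apply: sub; rewrite !in_cons eqxx ?orbT.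
by move=> u uL; apply/sub/mem_consr.
Qed.

Lemma weyl_conj_fork z L1 L2 L3 : {subset z :: L1 ++ L2 ++ L3 <= Phi} ->
  fork ip z L1 L2 L3 -> {in z :: L1 ++ L2 ++ L3, forall x, weyl_conj z x}.
Proof.
move=> sub [[zL1 zL2 zL3] _ _] x.
have conj L : {subset L <= L1 ++ L2 ++ L3} -> arm ip z L -> x \in z :: L -> weyl_conj z x.
  move=> subL zL; apply: weyl_conj_arm zL x => u; rewrite in_cons => uL; apply: sub.
  by rewrite in_cons; case/orP: uL => [->//|/subL->]; rewrite orbT.
rewrite in_cons !mem_cat => /or4P[xz|xL1|xL2|xL3].
- by apply: (conj L1) => //; [move=> u uL; rewrite !mem_cat uL|rewrite in_cons xz].
- by apply: (conj L1) (mem_consr xL1) => // u uL; rewrite !mem_cat uL.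
- by apply: (conj L2) (mem_consr xL2) => // u uL; rewrite !mem_cat uL orbT.
- by apply: (conj L3) (mem_consr xL3) => // u uL; rewrite !mem_cat uL !orbT.
Qed.

Lemma weyl_conj_simple b : simple_system Phi b ->
  forall a, a \in Phi -> exists2 x, x \in b & weyl_conj x a.
Proof.
move=> b_simple a aP; suff [] : a \in Phi /\ exists2 x, x \in b & weyl_conj x a by [].
move: a aP; apply: (root_ind Phi_root Phi_reduced b_simple).
- move=> x xb; split; first exact: simple_root b_simple _ xb.
  by exists x; last exact: weyl_conj_refl.
- move=> a [aP [x xb xa]]; split; first exact: root_opp Phi_root _ aP.
  exists x => //; apply: weyl_conj_trans xa _.
  by rewrite -(reflection_id ip (root_neq0 Phi_root aP)); apply: weyl_conj_reflection.
- move=> a y yb [aP [x xb xa]]; have yP := simple_root b_simple yb.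
  split; first exact: root_reflection Phi_root _ _ yP aP.
  by exists x => //; apply: weyl_conj_trans xa _; apply: weyl_conj_reflection.
Qed.

Hypothesis P_nonempty : (P !=set0)%classic.
Hypothesis P_alcoved : alcoved_polytope ip Phi P.
Hypothesis P_symmetric : weyl_symmetric ip Phi P.

Definition support a : R := sup [set ip a x | x in P]%classic.

Lemma ip_le_support a x : P x -> ip a x <= support a.
Proof.
move=> Px; apply: ub_le_sup; last by exists x.
case: P_alcoved => -[M bM] _; exists ((ip a a + M ^+ 2) / 2) => _ [y Py <-].
have ya : 0 <= ip (y - a) (y - a).
  by rewrite le_eqVlt eq_sym ip_eq0 ip_gt0 orbN.
have yy : ip y y <= M ^+ 2.
  have y0 : 0 <= ip y y by rewrite le_eqVlt eq_sym ip_eq0 ip_gt0 orbN.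
  by rewrite -(sqr_sqrtr y0) ler_sqr ?nnegrE ?sqrtr_ge0 ?bM // (le_trans (sqrtr_ge0 _) (bM y Py)).
by move: ya yy; rewrite !ipE (ipC y a); lra.
Qed.

Lemma support_le a (C : R) : (forall x, P x -> ip a x <= C) -> support a <= C.
Proof.
move=> aC; apply: ge_sup => [|_ [x Px <-]]; last exact: aC.
by case: P_nonempty => x Px; exists (ip a x); exists x.
Qed.

Lemma supportD a a' : support (a + a') <= support a + support a'.
Proof. by apply: support_le => x Px; rewrite ipDl lerD ?ip_le_support. Qed.

Lemma supportZ (k : R) a : 0 < k -> support (k *: a) = k * support a.
Proof.
move=> k0; apply/eqP; rewrite eq_le; apply/andP; split.
  by apply: support_le => x Px; rewrite ipZl ler_wpM2l ?ip_le_support // ltW.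
rewrite -ler_pdivlMl //; apply: support_le => x Px.
by rewrite ler_pdivlMl // -ipZl ip_le_support.
Qed.

Lemma support_weyl w a : W w -> support (w a) = support a.
Proof.
have le u c : W u -> support (u c) <= support c.
  move=> Wu; apply: support_le => x Px.
  have [u' [Wu' uK u'K]] := weyl_inverse Wu; rewrite -[x]u'K (weyl_isometry Wu).
  by apply: ip_le_support; rewrite -(P_symmetric Wu'); exists x.
move=> Ww; apply/eqP; rewrite eq_le le //=; have [w' [Ww' wK _]] := weyl_inverse Ww.
by rewrite -{1}[a]wK le.
Qed.

Lemma support_conj a a' : weyl_conj a a' -> support a' = support a.
Proof. by move=> [w Ww <-]; apply: support_weyl. Qed.

Lemma support_opp a : a \in Phi -> support (- a) = support a.
Proof.
move=> aP; rewrite -(reflection_id ip (root_neq0 Phi_root aP)).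
exact/support_weyl/weyl_reflection.
Qed.

Lemma support_ge0 a : a \in Phi -> 0 <= support a.
Proof.
move=> aP; case: P_nonempty => x Px; have := ip_le_support a Px.
by have := ip_le_support (- a) Px; rewrite support_opp // ipNl; lra.
Qed.

Lemma alcoved_supportP x : P x <-> forall a, a \in Phi -> ip a x <= support a.
Proof.
split=> [Px a _|xle]; first exact: ip_le_support.
case: P_alcoved => _ [Psi [c [sub PE]]]; rewrite PE => a aPsi.
apply: le_trans (xle a (sub a aPsi)) _; apply: support_le => y.
by rewrite PE; apply.
Qed.

Lemma support_eq0 : (forall a, a \in Phi -> support a = 0) -> P = [set 0]%classic.
Proof.
move=> s0; apply/seteqP; split=> x /= => [Px|->].
  case: Phi_root => _ span _ _; apply: (@ip_eq0_span _ _ ip (enum_fset Phi)).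
    by rewrite span memvf.
  move=> a aP; have := ip_le_support a Px; have := ip_le_support (- a) Px.
  by rewrite support_opp // s0 // ipNl; lra.
by apply/alcoved_supportP => a aP; rewrite ip0r s0.
Qed.

Lemma support_const_neq0 (C : R) : (forall a, a \in Phi -> support a = C) ->
  P <> [set 0]%classic -> C != 0.
Proof.
move=> support_C; apply: contra_not_neq => C0.
by apply: support_eq0 => a aP; rewrite support_C.
Qed.

Lemma support_single_class b z : simple_system Phi b ->
  {in b, forall x, weyl_conj z x} -> forall a, a \in Phi -> support a = support z.
Proof.
move=> b_simple zb a aP; have [x xb xa] := weyl_conj_simple b_simple aP.
by apply: support_conj; apply: weyl_conj_trans xa; apply: zb.
Qed.

Lemma support_norm b (N C : R) : simple_system Phi b ->
  {in b, forall x, ip x x = N -> support x = C} ->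
  forall a, a \in Phi -> ip a a = N -> support a = C.
Proof.
move=> b_simple bC a aP aN; have [x xb xa] := weyl_conj_simple b_simple aP.
rewrite (support_conj xa); apply: bC => //.
by case: xa aN => w Ww <-; rewrite (weyl_isometry Ww).
Qed.

Definition attains v a : Prop := ip a v = support a.

Definition tight v : Prop :=
  P v /\ forall x, (forall a, a \in Phi -> attains v a -> ip a x = 0) -> x = 0.

Lemma tight_vertex v : tight v -> vertex ip P v.
Proof.
move=> [Pv v_tight]; split=> //; pose N := [seq a <- enum_fset Phi | `[< attains v a >]].
exists (\sum_(a <- N) a) => x Px xv; rewrite -subr_gt0 !ip_suml -sumrB.
have ge0 : {in N, forall a, 0 <= ip a v - ip a x}.
  move=> a; rewrite mem_filter => /andP[/asboolP av _].
  by rewrite subr_ge0 av ip_le_support.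
rewrite big_seq lt_neqAle sumr_ge0 // andbT eq_sym psumr_neq0 //.
apply: contra_notT xv => none; apply/esym/eqP; rewrite -subr_eq0.
apply/eqP/v_tight => a aP av; have aN : a \in N.
  by rewrite mem_filter; apply/andP; split=> //; apply/asboolP.
apply/eqP; rewrite ipBr eq_le ge0 // andbT leNgt; apply/negP => lt.
by move/negP: none; apply; apply/hasP; exists a; rewrite // aN.
Qed.

Lemma weyl_attains w v a : W w -> attains v a -> attains (w v) (w a).
Proof. by move=> Ww av; rewrite /attains weyl_isometry // support_weyl. Qed.

Lemma weyl_tight w v : W w -> tight v -> tight (w v).
Proof.
move=> Ww [Pv v_tight]; have [w' [Ww' wK w'K]] := weyl_inverse Ww.
split; first by rewrite -(P_symmetric Ww); exists v.
move=> x xt; have <- : w 0 = 0.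
  by apply/eqP; rewrite -(ip_eq0 ip) (weyl_isometry Ww) ip0l.
rewrite -[x]w'K; congr w; apply: v_tight => a aP av.
rewrite -(weyl_isometry Ww) w'K; apply: xt; first by rewrite weyl_root.
exact: weyl_attains.
Qed.

Definition generated_by_vertices h : Prop := exists v : 'I_h -> V,
  [/\ forall i, vertex ip P (v i), generating_set ip Phi P (range v)
    & P <> [set 0]%classic -> injective v].

Lemma generated_by_tight (T : finType) (v : T -> V) h : #|T| = h ->
  (forall i, tight (v i)) -> (forall a, a \in Phi -> exists i, attains (v i) a) ->
  (P <> [set 0]%classic -> injective v) -> generated_by_vertices h.
Proof.
move=> <- v_tight cover inj; exists (v \o enum_val); split.
- by move=> i; apply/tight_vertex/v_tight.
- split=> [//|_ [i _ <-]|Q [_ [Psi [c [sub ->]]]] vQ x Px a aPsi].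
    by case: (v_tight (enum_val i)).
  have [i av] := cover a (sub a aPsi); apply: le_trans (ip_le_support a Px) _.
  by rewrite -av; apply: (vQ (v i)) aPsi; exists (enum_rank i); rewrite //= enum_rankK.
- by move=> Pn; apply: inj_comp (inj Pn) enum_val_inj.
Qed.

Lemma generated_by_orbit w h v : W w -> (0 < h)%N -> iter h w =1 id -> tight v ->
  (forall a, a \in Phi -> exists k, attains v (iter k w a)) ->
  (P <> [set 0]%classic -> forall k, (0 < k < h)%N -> iter k w v <> v) ->
  generated_by_vertices h.
Proof.
move=> Ww h_gt0 wh v_tight cover free_orbit; have Wk k := weyl_iter k Ww.
have period q x : iter (q * h) w x = x by elim: q => // q IH; rewrite mulSn iterD IH wh.
apply: (@generated_by_tight _ (fun i : 'I_h => iter i w v)); first exact: card_ord.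
- by move=> i; apply: weyl_tight.
- move=> a /cover[k av]; pose j := ((k * h.-1) %% h)%N.
  exists (Ordinal (ltn_pmod _ h_gt0 : (j < h)%N)) => /=.
  have [q jk] : exists q, (j + k = q * h)%N.
    apply/dvdnP; rewrite /dvdn modnDml -mulnSr prednK //; apply/eqP; exact: modnMl.
  by rewrite -[a](period q) -jk iterD; apply: weyl_attains.
- move=> Pn; have no_repeat i j : (i < j < h)%N -> iter i w v <> iter j w v.
    case/andP => ij jh; have [w' [_ wK _]] := weyl_inverse (Wk i).
    rewrite -(subnKC (ltnW ij)) iterD => /(can_inj wK)/esym; apply: free_orbit => //.
    by rewrite subn_gt0 ij (leq_ltn_trans (leq_subr _ _) jh).
  move=> i j ivj; apply: ord_inj; have [ij|ji|//] := ltngtP i j.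
    by case: (@no_repeat i j); rewrite ?ij /=.
  by case: (@no_repeat j i); rewrite ?ji /=.
Qed.

(** * Types A to D *)

Section TypeA.
Variables (n : nat) (E : 'I_n.+1 -> V) (k r C : R).
Hypotheses (r_gt0 : 0 < r) (E_frame : frame ip E k r).
Hypothesis E_simple : simple_system Phi (steps E n).
Hypothesis support_C : forall a, a \in Phi -> support a = C.
Implicit Types (i j l : 'I_n.+1).

Lemma typeA_diff_root i j : i != j -> E i - E j \in Phi.
Proof. by apply: (frame_diff_root r_gt0 E_frame) => //; case: E_simple. Qed.

Lemma typeA_roots a : a \in Phi -> exists i j, i != j /\ a = E i - E j.
Proof.
move: a; apply: (root_ind Phi_root Phi_reduced E_simple).
- by move=> x; apply: mem_steps_diff.
- by move=> _ [i [j [ij ->]]]; exists j, i; rewrite opprB eq_sym.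
- move=> _ _ /mem_steps_diff[l [m [lm ->]]] [i [j [ij ->]]].
  exists (tperm l m i), (tperm l m j); rewrite (inj_eq perm_inj) linearB /=.
  by rewrite !(frame_reflection r_gt0 E_frame).
Qed.

Definition typeA_vertex l : V := (C / r) *: E l.

Lemma typeA_vertex_ip i j l :
  ip (E i - E j) (typeA_vertex l) = C * ((i == l)%:R - (j == l)%:R).
Proof. by rewrite ipZr (frame_diff_ip E_frame); field; rewrite gt_eqF. Qed.

Lemma typeA_attains i j : i != j -> attains (typeA_vertex i) (E i - E j).
Proof.
move=> ij; rewrite /attains support_C ?typeA_diff_root // typeA_vertex_ip eqxx.
by rewrite eq_sym (negPf ij) subr0 mulr1.
Qed.

Lemma typeA_tight l : tight (typeA_vertex l).
Proof.
split.
  apply/alcoved_supportP => a aP; have := support_ge0 aP; rewrite support_C // => C_ge0.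
  have [i [j [_ ->]]] := typeA_roots aP; rewrite typeA_vertex_ip.
  by rewrite ler_piMr //; case: (i == l); case: (j == l) => /=; lra.
move=> x x_orth; have El j : ip (E l - E j) x = 0.
  have [->|lj] := eqVneq l j; first by rewrite subrr ip0l.
  by apply: x_orth; [apply: typeA_diff_root|apply: typeA_attains].
apply: (simple_ip_eq0 (ip := ip) E_simple) => _ /mem_steps_diff[i [j [_ ->]]].
have -> : E i - E j = (E l - E j) - (E l - E i) by rewrite opprB [RHS]addrC addrA subrK.
by rewrite ipBl !El subrr.
Qed.

Lemma typeA_generated : generated_by_vertices n.+1.
Proof.
apply: (@generated_by_tight _ typeA_vertex); first exact: card_ord.
- exact: typeA_tight.
- by move=> a /typeA_roots[i [j [ij ->]]]; exists i; apply: typeA_attains.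
- move=> Pn i j /scalerI Eij; apply: (frame_inj r_gt0 E_frame); apply: Eij.
  by rewrite mulf_neq0 ?(support_const_neq0 support_C) ?invr_eq0 ?gt_eqF.
Qed.

End TypeA.

Lemma dynkinA_generated z L h : arm ip z L -> simple_system Phi (z :: L) ->
  has_order (cox (z :: L)) h -> generated_by_vertices h.
Proof.
move=> zL simp ord_h; have zP : z \in Phi by rewrite (simple_root simp) ?mem_head.
pose r := ip z z / 2; have zz : ip z z = 2 * r by rewrite /r; field.
have r_gt0 : 0 < r by rewrite divr_gt0 // ip_gt0 (root_neq0 Phi_root).
have [e eP] := riesz ip (fun u => if u == z then - r else 0) (simple_free simp).
have ze : ip z e = - r by rewrite eP ?mem_head // eqxx.
have Le : {in L, forall u, ip u e = 0}.
  move=> u uL; rewrite eP ?mem_consr //; case: eqP => // uz.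
  by have := free_uniq (simple_free simp); rewrite /= -uz uL.
have [E [tE _ E_frame]] := arm_frame zL zz ze Le.
have support_z a : a \in Phi -> support a = support z.
  move: a; apply: (support_single_class simp); apply: weyl_conj_arm zL.
  by case: simp.
rewrite tE in simp ord_h.
have := coxeter_steps_order r_gt0 E_frame (simple_span simp).
move/(has_order_uniq ord_h) => ->; exact: typeA_generated r_gt0 E_frame simp support_z.
Qed.

(* Type B for tau = 1 and type C for tau = 2. *)
Section TypeBC.
Variables (n : nat) (G : 'I_n.+1 -> V) (r tau alpha beta : R).
Hypotheses (n_gt0 : (0 < n)%N) (r_gt0 : 0 < r) (G_frame : frame ip G 0 r).
Hypothesis tau_gt0 : 0 < tau.
Hypothesis b_simple : simple_system Phi (tau *: G ord0 :: steps G n).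
Hypothesis support_pair : forall a, a \in Phi -> ip a a = 2 * r -> support a = beta.
Hypothesis support_single :
  forall a, a \in Phi -> ip a a = tau ^+ 2 * r -> support a = tau * alpha.
Implicit Types (i j l : 'I_n.+1) (c d : bool) (p q : bool * 'I_n.+1).

Let tau_neq0 : tau != 0. Proof. by rewrite gt_eqF. Qed.

Lemma typeBC_total x : (forall i, ip (G i) x = 0) -> x = 0.
Proof.
move=> Gx; apply: (simple_ip_eq0 (ip := ip) b_simple) => a; rewrite in_cons.
case/predU1P => [->|/mem_steps_diff[i [j [_ ->]]]]; first by rewrite ipZl Gx mulr0.
by rewrite ipBl !Gx subrr.
Qed.

Lemma typeBC_order : has_order (cox (tau *: G ord0 :: steps G n)) (2 * n.+1).
Proof.
rewrite -[n.+1]subn0; apply: (signed_cycle_order r_gt0 G_frame typeBC_total) => //.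
- move=> j /andP[_ jn]; rewrite -[LHS]/(reflection ip _ (cox (steps G n) _)).
  rewrite (coxeter_steps_nat r_gt0 G_frame (leqnn n) (ltnW jn)) jn.
  rewrite (reflection_single r_gt0 G_frame) // (_ : inord _ == _ = false) ?scale1r //.
  by rewrite -val_eqE /= inordK.
- rewrite -[LHS]/(reflection ip _ (cox (steps G n) _)).
  rewrite (coxeter_steps_nat r_gt0 G_frame) // ltnn eqxx.
  rewrite (reflection_single r_gt0 G_frame) // (_ : inord _ == _) ?expr1 ?scaleN1r //.
  by rewrite -val_eqE /= inordK.
Qed.

Lemma typeBC_roots a : a \in Phi -> signed_pair G a \/ signed_single G tau a.
Proof.
move: a; apply: (root_ind Phi_root Phi_reduced b_simple) => [a|a|a x xb].
- rewrite in_cons => /predU1P[->|/mem_steps_diff[i [j [ij ->]]]].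
    by right; exists ord0, false; rewrite expr0 scale1r.
  by left; apply: signed_pair_diff.
- by case=> [/signed_pair_opp|/signed_single_opp]; [left|right].
have x_perm : signed_perm G (reflection ip x).
  move: xb; rewrite in_cons => /predU1P[->|/mem_steps_diff[i [j [ij ->]]]].
    exact: (signed_perm_single r_gt0 G_frame).
  exact: (signed_perm_diff r_gt0 G_frame).
by case=> [/(signed_pair_perm x_perm)|/(signed_single_perm x_perm)]; [left|right].
Qed.

Lemma typeBC_diff_root i j : i != j -> G i - G j \in Phi.
Proof.
apply: (frame_diff_root r_gt0 G_frame) => // a ab.
exact: simple_root b_simple _ (mem_consr ab).
Qed.

Lemma typeBC_single_root c i : (-1) ^+ c *: (tau *: G i) \in Phi.
Proof.
suff iP : tau *: G i \in Phi.
  by case: c; rewrite ?expr1 ?scaleN1r ?expr0 ?scale1r //; apply: (root_opp Phi_root).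
have P0 : tau *: G ord0 \in Phi by rewrite (simple_root b_simple) ?mem_head.
have [->//|i0] := eqVneq i ord0.
have := root_reflection Phi_root (typeBC_diff_root i0) P0.
by rewrite linearZ /= (frame_reflection r_gt0 G_frame) // tpermR.
Qed.

Lemma typeBC_pair_root c d i j : i != j -> (-1) ^+ c *: G i + (-1) ^+ d *: G j \in Phi.
Proof.
move=> ij; have sum_root : G i + G j \in Phi.
  have jP := typeBC_single_root false j; rewrite expr0 scale1r in jP.
  have := root_reflection Phi_root jP (typeBC_diff_root ij).
  rewrite linearB /= !(reflection_single r_gt0 G_frame) // (negPf ij) eqxx.
  by rewrite expr0 expr1 scaleN1r scale1r opprK.
case: c d => [] []; rewrite ?expr0 ?expr1 ?scaleN1r ?scale1r //.
- by rewrite -opprD; apply: (root_opp Phi_root).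
- by rewrite addrC; apply: typeBC_diff_root; rewrite eq_sym.
- exact: typeBC_diff_root.
Qed.

Lemma typeBC_support_unit c i : support ((-1) ^+ c *: G i) = alpha.
Proof.
apply: (mulfI tau_neq0); rewrite -supportZ // scalerA mulrC -scalerA.
apply: support_single; first exact: typeBC_single_root.
by apply: (signed_single_norm G_frame); exists i, c.
Qed.

Lemma typeBC_support_pair c d i j : i != j ->
  support ((-1) ^+ c *: G i + (-1) ^+ d *: G j) = beta.
Proof.
move=> ij; apply: support_pair; first exact: typeBC_pair_root.
by apply: (signed_pair_norm G_frame); exists i, j, c, d.
Qed.

Lemma typeBC_support_bounds : alpha <= beta /\ beta <= 2 * alpha.
Proof.
have n0 : (ord_max : 'I_n.+1) != ord0 by rewrite -val_eqE /= -lt0n.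
have pair c := typeBC_support_pair false c n0; rewrite expr0 scale1r in pair.
have unit i : support (G i) = alpha.
  by rewrite -(typeBC_support_unit false i) expr0 scale1r.
have pair_sum := pair false; have pair_diff := pair true.
rewrite expr0 scale1r in pair_sum; rewrite expr1 scaleN1r in pair_diff; split.
  have := supportD (G ord_max + G ord0) (G ord_max - G ord0).
  rewrite pair_sum pair_diff addrACA subrr addr0 -mulr2n -scaler_nat supportZ // unit.
  by lra.
by rewrite -pair_sum; apply: le_trans (supportD _ _) _; rewrite !unit; lra.
Qed.

(* The coordinate i of the vertex (c, i) has absolute value alpha, the others beta - alpha;
   they change sign at i, so that every root on a pair i < j attains its support at some
   (c, i) or some (c, j). *)
Definition cross_coord p j : R :=
  (-1) ^+ p.1 * (if j == p.2 then alpha else if (j < p.2)%N then beta - alpha else alpha - beta).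

Definition cross_vertex p : V := coord_vec G r (cross_coord p).

Lemma norm_cross_coord p j : `|cross_coord p j| = if j == p.2 then alpha else beta - alpha.
Proof.
have [alpha_le beta_le] := typeBC_support_bounds; rewrite normrMsign.
by case: eqP => _; [|case: ifP => _; [|rewrite distrC]]; rewrite ger0_norm //; lra.
Qed.

Lemma typeBC_attains_single p : attains (cross_vertex p) ((-1) ^+ p.1 *: (tau *: G p.2)).
Proof.
rewrite /attains scalerA mulrC -scalerA supportZ // typeBC_support_unit !ipZl.
by rewrite (ip_coord_vec r_gt0 G_frame) /cross_coord eqxx signrMK.
Qed.

Lemma typeBC_attains_pair p j : j != p.2 -> attains (cross_vertex p)
  ((-1) ^+ p.1 *: G p.2 + (-1) ^+ (p.1 (+) (p.2 < j)%N) *: G j).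
Proof.
move=> jp; rewrite /attains typeBC_support_pair 1?eq_sym // !ipE signr_addb.
rewrite !(ip_coord_vec r_gt0 G_frame) /cross_coord eqxx (negPf jp) signrMK mulrACA.
rewrite -expr2 sqrr_sign mul1r; move: jp; rewrite -val_eqE /= neq_ltn => /orP[jp|pj].
  by rewrite jp ltnNge (ltnW jp) /= expr0; ring.
by rewrite pj ltnNge (ltnW pj) /= expr1; ring.
Qed.

Lemma cross_vertex_tight p : tight (cross_vertex p).
Proof.
have [alpha_le beta_le] := typeBC_support_bounds; split.
  apply/alcoved_supportP => a aP; case: (typeBC_roots aP) => [aS|aS].
    rewrite (support_pair aP (signed_pair_norm G_frame aS)).
    apply: signed_pair_ip_le aS => i j ij.
    rewrite !(ip_coord_vec r_gt0 G_frame) !norm_cross_coord.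
    by case: (eqVneq i p.2) ij => [->|_]; case: (eqVneq j p.2) => //= *; lra.
  rewrite (support_single aP (signed_single_norm G_frame aS)).
  case: aS => i [c ->]; rewrite !ipZl mulrCA ler_pM2l // (ip_coord_vec r_gt0 G_frame).
  apply: le_trans (ler_norm _) _; rewrite normrMsign norm_cross_coord.
  by case: ifP => _; lra.
move=> x xt; have xp : ip (G p.2) x = 0.
  have /eqP := xt _ (typeBC_single_root _ _) (typeBC_attains_single p).
  by rewrite !ipZl !mulf_eq0 signr_eq0 (negPf tau_neq0) => /eqP.
apply: typeBC_total => j; have [->//|jp] := eqVneq j p.2.
have pj : p.2 != j by rewrite eq_sym.
have /eqP := xt _ (typeBC_pair_root _ _ pj) (typeBC_attains_pair jp).
by rewrite ipDl !ipZl xp mulr0 add0r mulf_eq0 signr_eq0 => /eqP.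
Qed.

Lemma cross_vertex_cover a : a \in Phi -> exists p, attains (cross_vertex p) a.
Proof.
case/typeBC_roots => [[i [j [c [d [ij ->]]]]]|[i [c ->]]]; last first.
  by exists (c, i); apply: (typeBC_attains_single (c, i)).
wlog lt_ij : i j c d ij / (i < j)%N => [wl|].
  have [|ji|/ord_inj ijE] := ltngtP i j; first exact: wl.
    by rewrite addrC; apply: wl => //; rewrite eq_sym.
  by rewrite ijE eqxx in ij.
have [<-|cd] := eqVneq c d.
  exists (c, j); have := @typeBC_attains_pair (c, j) i ij.
  by rewrite /= ltnNge (ltnW lt_ij) addbF addrC.
exists (c, i); have ji : j != i by rewrite eq_sym.
have := @typeBC_attains_pair (c, i) j ji; rewrite /= lt_ij.
by case: (c) (d) cd => [] [].
Qed.

Lemma cross_vertex_inj : P <> [set 0]%classic -> injective cross_vertex.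
Proof.
have [alpha_le beta_le] := typeBC_support_bounds; move=> Pn.
have alpha_gt0 : 0 < alpha.
  rewrite lt_neqAle; apply/andP; split; last by lra.
  apply: contra_not_neq Pn => alpha0; apply: support_eq0 => a aP.
  case: (typeBC_roots aP) => [/(signed_pair_norm G_frame)/(support_pair aP)->|]; first by lra.
  by move/(signed_single_norm G_frame)/(support_single aP)->; rewrite -alpha0 mulr0.
move=> p q pq; have pqj j : cross_coord p j = cross_coord q j.
  by have := congr1 (ip (G j)) pq; rewrite !(ip_coord_vec r_gt0 G_frame).
have no_lt p' q' : (forall j, cross_coord p' j = cross_coord q' j) -> ~ (p'.2 < q'.2)%N.
  case: p' q' => c i [d j] /= pqE ij; have := pqE i; have := pqE j.
  rewrite /cross_coord /= !eqxx -!val_eqE /= (ltn_eqF ij) (gtn_eqF ij) ij ltnNge (ltnW ij) /=.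
  by case: (c) (d) => [] []; rewrite ?expr0 ?expr1; lra.
case: p q pqj {pq} => c i [d j] pqj; have [ij|ji|/ord_inj ij] := ltngtP i j.
- by case: (no_lt _ _ pqj).
- by case: (no_lt _ _ (fun l => esym (pqj l))).
rewrite ij in pqj *; congr (_, _); apply: (@signr_inj R).
by have := pqj j; rewrite /cross_coord eqxx => /mulIf; apply; rewrite gt_eqF.
Qed.

Lemma typeBC_generated : generated_by_vertices (2 * n.+1).
Proof.
apply: (@generated_by_tight _ cross_vertex); last exact: cross_vertex_inj.
- by rewrite card_prod card_bool card_ord.
- exact: cross_vertex_tight.
- exact: cross_vertex_cover.
Qed.

End TypeBC.

Lemma mbond2_unit z x (r := ip z z / 2) : mbond ip 2 z x -> exists tau e,
  [/\ tau = 1 \/ tau = 2, x = tau *: e, ip e e = r & ip z e = - r].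
Proof.
case=> -[norm zx].
  by exists 1, x; rewrite scale1r /r norm zx norm; split; [left| |field|field].
exists 2, (2^-1 *: x); rewrite scalerA mulfV ?pnatr_eq0 // scale1r !ipE zx norm /r.
by split; [right| |field|field].
Qed.

Lemma dynkinBC_generated z L x h : multi ip 2 z L x [::] ->
  simple_system Phi (x :: z :: L) -> has_order (cox (x :: z :: L)) h ->
  generated_by_vertices h.
Proof.
move=> [_ zx [zL _] _ /orthogonal1rP Lx] simp ord_h; pose r := ip z z / 2.
have sub : {subset z :: L <= Phi} by move=> u uL; apply: simple_root simp _ (mem_consr uL).
have r_gt0 : 0 < r by rewrite divr_gt0 // ip_gt0 (root_neq0 Phi_root) ?sub ?mem_head.
have zz : ip z z = 2 * r by rewrite /r; field.
have [tau [e [tau12 xE ee ze]]] := mbond2_unit zx; rewrite -/r in ee ze.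
have tau_gt0 : 0 < tau by case: tau12 => ->.
have Le : {in L, forall u, ip u e = 0}.
  move=> u /Lx/eqP; rewrite xE ipZr mulf_eq0 (gt_eqF tau_gt0) => /eqP //.
have [G [tG G0 G_frame]] := arm_frame zL zz ze Le; rewrite ee subrr in G_frame.
have xx : ip x x = tau ^+ 2 * r by rewrite xE !ipE ee mulrA -expr2.
have tau2 : tau ^+ 2 * r != 2 * r.
  by rewrite (inj_eq (mulIf (lt0r_neq0 r_gt0))); case: tau12 => ->; apply/eqP; lra.
have uu : {in z :: L, forall u, ip u u = 2 * r}.
  by move=> u /predU1P[->//|/(arm_norm zL)->].
have support_pair a : a \in Phi -> ip a a = 2 * r -> support a = support z.
  move: a; apply: (support_norm simp) => u /predU1P[->|uL] uN.
    by move: tau2; rewrite -xx uN eqxx.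
  exact/support_conj/(weyl_conj_arm sub zL).
have support_single a : a \in Phi -> ip a a = tau ^+ 2 * r ->
    support a = tau * (support x / tau).
  rewrite (_ : tau * (support x / tau) = support x); last by rewrite mulrC divfK ?gt_eqF.
  move: a; apply: (support_norm simp) => u /predU1P[->//|/uu uN /eqP].
  by rewrite uN eq_sym (negPf tau2).
rewrite tG xE -G0 in simp ord_h.
rewrite (has_order_uniq ord_h (typeBC_order r_gt0 G_frame tau_gt0 simp)).
exact: typeBC_generated (ltn0Sn _) r_gt0 G_frame tau_gt0 simp support_pair support_single.
Qed.

Section TypeD.
Variables (n : nat) (G : 'I_n.+1 -> V) (r C : R).
Hypotheses (n_gt2 : (2 < n)%N) (r_gt0 : 0 < r) (G_frame : frame ip G 0 r).
Local Notation b := ((G ord0 + G (inord 1)) :: steps G n).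
Hypothesis b_simple : simple_system Phi b.
Hypothesis support_C : forall a, a \in Phi -> support a = C.
Implicit Types (i j l : 'I_n.+1) (c d : bool) (p q : bool * 'I_n).

Let neq01 : (ord0 : 'I_n.+1) != inord 1.
Proof. by rewrite -val_eqE /= inordK // ltnS (ltn_trans _ n_gt2). Qed.

Lemma typeD_total x : (forall i, ip (G i) x = 0) -> x = 0.
Proof.
move=> Gx; apply: (simple_ip_eq0 (ip := ip) b_simple) => a; rewrite in_cons.
case/predU1P => [->|/mem_steps_diff[i [j [_ ->]]]]; first by rewrite ipDl !Gx addr0.
by rewrite ipBl !Gx subrr.
Qed.

Lemma typeD_order : has_order (cox b) (2 * n).
Proof.
have n_gt0 : (0 < n)%N by apply: ltn_trans n_gt2.
have coxE (j : nat) : (j <= n)%N -> cox b (G (inord j)) =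
    reflection ip (G ord0 + G (inord 1)) (G (inord (if (j < n)%N then j.+1 else 0))).
  move=> jn; rewrite -[LHS]/(reflection ip _ (cox (steps G n) _)).
  rewrite (coxeter_steps_nat r_gt0 G_frame (leqnn n) jn); congr (reflection _ _ (G (inord _))).
  by case: ltngtP jn.
have inord0 : inord 0 = ord0 :> 'I_n.+1 by apply: val_inj; rewrite /= inordK.
have -> : (2 * n = 2 * (n.+1 - 1))%N by rewrite subSS subn0.
apply: (signed_cycle_order r_gt0 G_frame typeD_total) => //.
- move=> j /andP[j_gt0 jn]; rewrite -[LHS]/(cox b _) coxE ?(ltnW jn) // jn.
  rewrite (reflection_sum r_gt0 G_frame) // -inord0 !(negPf (inord_neq _ _ _)) //; try lia.
  by rewrite expr0 scale1r tpermD // inord_neq; lia.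
- rewrite -[LHS]/(cox b _) coxE // ltnn inord0 (reflection_sum r_gt0 G_frame) //.
  by rewrite eqxx tpermL expr1 scaleN1r.
- case=> // _; rewrite -[LHS]/(cox b _) coxE // n_gt0 (reflection_sum r_gt0 G_frame) //.
  by rewrite eqxx orbT tpermR expr1 scaleN1r inord0.
Qed.

Lemma typeD_roots a : a \in Phi -> signed_pair G a.
Proof.
have sum_pair : signed_pair G (G ord0 + G (inord 1)).
  by exists ord0, (inord 1), false, false; rewrite !scale1r.
move: a; apply: (root_ind Phi_root Phi_reduced b_simple) => [a|a|a x xb].
- by rewrite in_cons => /predU1P[->//|/mem_steps_diff[i [j [ij ->]]]]; apply: signed_pair_diff.
- exact: signed_pair_opp.
apply: signed_pair_perm; move: xb; rewrite in_cons.
case/predU1P => [->|/mem_steps_diff[i [j [ij ->]]]].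
  exact: (signed_perm_sum r_gt0 G_frame neq01).
exact: (signed_perm_diff r_gt0 G_frame).
Qed.

Lemma typeD_pair_root c d i j : i != j -> (-1) ^+ c *: G i + (-1) ^+ d *: G j \in Phi.
Proof.
have diff_root k l : k != l -> G k - G l \in Phi.
  apply: (frame_diff_root r_gt0 G_frame) => // a ab.
  exact: simple_root b_simple _ (mem_consr ab).
have sum_root0 k : k != ord0 -> G ord0 + G k \in Phi.
  move=> k0; have root01 : G ord0 + G (inord 1) \in Phi.
    by rewrite (simple_root b_simple) ?mem_head.
  have [->//|k1] := eqVneq k (inord 1).
  have := root_reflection Phi_root (diff_root _ _ k1) root01.
  by rewrite linearD /= !(frame_reflection r_gt0 G_frame) // tpermR tpermD // eq_sym.
have sum_root : i != j -> G i + G j \in Phi.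
  have [->|j0] := eqVneq j ord0; first by rewrite addrC; apply: sum_root0.
  have [->|i0 ij] := eqVneq i ord0; first by move=> _; apply: sum_root0.
  have := root_reflection Phi_root (diff_root _ _ i0) (sum_root0 j j0).
  by rewrite linearD /= !(frame_reflection r_gt0 G_frame) // tpermR tpermD // eq_sym.
move=> ij; case: c d => [] []; rewrite ?expr0 ?expr1 ?scaleN1r ?scale1r.
- by rewrite -opprD; apply: (root_opp Phi_root); apply: sum_root.
- by rewrite addrC; apply: diff_root; rewrite eq_sym.
- exact: diff_root.
- exact: sum_root.
Qed.

(* The sign is flipped at a single coordinate, which is not the first one: as n > 2, these
   2n sign vectors restrict to every pair of signs on every pair of coordinates. *)
Definition spin_sign p j : bool := p.1 (+) (j == lift ord0 p.2).

Definition spin_vertex p : V := coord_vec G r (fun j => (-1) ^+ spin_sign p j * (C / 2)).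

Lemma spin_vertex_attains p i j : i != j ->
  attains (spin_vertex p) ((-1) ^+ spin_sign p i *: G i + (-1) ^+ spin_sign p j *: G j).
Proof.
move=> ij; rewrite /attains support_C ?typeD_pair_root // !ipE.
by rewrite !(ip_coord_vec r_gt0 G_frame) !signrMK; field.
Qed.

Lemma spin_vertex_tight p : tight (spin_vertex p).
Proof.
split.
  apply/alcoved_supportP => a aP; rewrite support_C //.
  have C_ge0 : 0 <= C by rewrite -(support_C aP) support_ge0.
  apply: signed_pair_ip_le (typeD_roots aP) => i j _.
  by rewrite !(ip_coord_vec r_gt0 G_frame) !normrMsign !ger0_norm; lra.
move=> x xt; pose y i := (-1) ^+ spin_sign p i * ip (G i) x.
have y_opp i j : i != j -> y i + y j = 0.
  move=> ij; have := xt _ (typeD_pair_root _ _ ij) (spin_vertex_attains p ij).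
  by rewrite !ipE.
apply: typeD_total => i.
have [j] := fresh_ordinal (s := [:: i]) (ltnW (ltnW n_gt2) : (1 < n.+1)%N).
rewrite inE => ji.
have [l] := fresh_ordinal (s := [:: i; j]) (ltnW n_gt2 : (2 < n.+1)%N).
rewrite !inE => /norP[li lj].
have /eqP : y i = 0 by move: (y_opp _ _ ji) (y_opp _ _ li) (y_opp _ _ lj); lra.
by rewrite mulf_eq0 signr_eq0 => /eqP.
Qed.

Lemma spin_vertex_cover a : a \in Phi -> exists p, attains (spin_vertex p) a.
Proof.
case/typeD_roots => i [j [c [d [ij ->]]]].
have flip k l e : k != l -> k != ord0 -> exists p, spin_sign p k = ~~ e /\ spin_sign p l = e.
  case: (unliftP ord0 k) => [m ->|->] kl // _; exists (e, m).
  by rewrite /spin_sign /= eqxx eq_sym (negPf kl) addbF addbT.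
suff [p [<- <-]] : exists p, spin_sign p i = c /\ spin_sign p j = d.
  by exists p; apply: spin_vertex_attains.
have [<-|cd] := eqVneq c d; last first.
  have -> : c = ~~ d by case: (c) (d) cd => [] [].
  have [i0|i0] := eqVneq i ord0; last exact: flip ij i0.
  have ji : j != i by rewrite eq_sym.
  have j0 : j != ord0 by rewrite -i0.
  by have [p []] := flip j i (~~ d) ji j0; rewrite negbK; exists p.
have [k] := fresh_ordinal (s := [:: ord0; i; j]) (n_gt2 : (3 < n.+1)%N).
rewrite !inE => /norP[k0 /norP[ki kj]].
case: (unliftP ord0 k) k0 ki kj => [m ->|->] // _ ki kj; exists (c, m).
by rewrite /spin_sign /= !(eq_sym _ (lift _ _)) (negPf ki) (negPf kj) addbF.
Qed.

Lemma spin_vertex_inj : P <> [set 0]%classic -> injective spin_vertex.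
Proof.
move=> Pn p q pq; have C0 : C / 2 != 0.
  by rewrite mulf_neq0 ?(support_const_neq0 support_C) ?invr_eq0 ?pnatr_eq0.
have sign_eq j : spin_sign p j = spin_sign q j.
  have := congr1 (ip (G j)) pq; rewrite !(ip_coord_vec r_gt0 G_frame).
  by move/(mulIf C0)/signr_inj.
have p1q : p.1 = q.1.
  by have := sign_eq ord0; rewrite /spin_sign !(negPf (neq_lift _ _)) !addbF.
have := sign_eq (lift ord0 p.2); rewrite /spin_sign p1q eqxx => /addbI/esym/eqP/lift_inj.
by case: p q p1q {pq sign_eq} => c k [d l] /= -> ->.
Qed.

Lemma typeD_generated : generated_by_vertices (2 * n).
Proof.
apply: (@generated_by_tight _ spin_vertex); last exact: spin_vertex_inj.
- by rewrite card_prod card_bool card_ord.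
- exact: spin_vertex_tight.
- exact: spin_vertex_cover.
Qed.

End TypeD.

Lemma dynkinD_generated z L x y h : fork ip z [:: x] [:: y] L ->
  simple_system Phi (x :: y :: z :: L) -> has_order (cox (x :: y :: z :: L)) h ->
  generated_by_vertices h.
Proof.
move=> fk simp ord_h; have sub : {subset z :: [:: x] ++ [:: y] ++ L <= Phi}.
  by move=> u uL; apply: (simple_root simp); move: uL; rewrite !inE => /or4P[]->; rewrite ?orbT.
have support_z a : a \in Phi -> support a = support z.
  move: a; apply: (support_single_class simp) => u uL; apply: (weyl_conj_fork sub fk).
  by move: uL; rewrite !inE => /or4P[]->; rewrite ?orbT.
case: fk => [[[[zx1 zx] _ _] [zy _ _] zL] [xy /orthogonal1lP xL /orthogonal1lP yL] [_ _ L0]].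
have {}xy : ip x y = 0 by apply: (orthogonal1lP xy); rewrite mem_head.
pose r := ip z z / 2; have zz : ip z z = 2 * r by rewrite /r; field.
have r_gt0 : 0 < r by rewrite divr_gt0 // ip_gt0 (root_neq0 Phi_root) ?sub ?mem_head.
case: zy => zy1 zy.
have yzL : arm ip y (z :: L).
  by split=> //; [apply: bondC|apply/orthogonal1lP].
pose e := 2^-1 *: (x - y).
have ye : ip y e = - r by rewrite !ipE (ipC y) xy -zy1 zz; field.
have zLe : {in z :: L, forall u, ip u e = 0}.
  move=> u /predU1P[->|uL]; first by rewrite !ipE zx zy; ring.
  by rewrite !ipE (ipC u) xL // (ipC u) yL // subrr mulr0.
have ee : ip e e = r by rewrite !ipE xy (ipC y) xy -zx1 -zy1 zz; field.
have yy : ip y y = 2 * r by rewrite -zy1.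
have [G [tG G0 G_frame]] := arm_frame yzL yy ye zLe; rewrite ee subrr in G_frame.
have G1 : G (inord 1) = y + e.
  have inord0 : inord 0 = ord0 :> 'I_(size (z :: L)).+2 by apply: val_inj; rewrite /= inordK.
  by move: (congr1 (head 0) tG) => /= ->; rewrite inord0 G0 subrK.
have xE : x = G ord0 + G (inord 1).
  by rewrite G1 G0 addrCA -scalerDl (_ : _ + _ = 1) ?scale1r ?subrKC //; field.
have L_size : (2 < (size (z :: L)).+1)%N by rewrite !ltnS lt0n size_eq0.
rewrite xE tG in simp ord_h; have := typeD_order L_size r_gt0 G_frame simp.
by move/(has_order_uniq ord_h) => ->; exact: typeD_generated L_size r_gt0 G_frame simp support_z.
Qed.

(** * Types E, F and G *)

Section Certificates.
Variables (t : seq V) (M : seq (seq int)) (C : R).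
Local Notation n := (size t).
Hypothesis t_simple : simple_system Phi t.
Hypothesis t_cartan : forall i j, (i < n)%N -> (j < n)%N ->
  cartan_number ip t`_j t`_i = (cartan_entry M i j)%:~R.
Hypothesis support_C : forall a, a \in Phi -> support a = C.
Implicit Types (rts : seq (seq int)) (node m : nat) (u : V).

Lemma ip_lcomb_coweight node u c : (node < n)%N ->
  simple_values ip t (unit_coords n node) u -> ip (lcomb t c) u = (c`_node)%:~R.
Proof.
move=> node_n /ip_lcomb->; rewrite int_dotE (bigD1 (Ordinal node_n)) //= nth_mkseq // eqxx mul1r.
rewrite big1 ?addr0 // => k; rewrite -val_eqE /= => /negPf kn.
by rewrite nth_mkseq // kn mul0r.
Qed.

Lemma coweight_vertex_tight rts node m u : (node < n)%N -> (0 < m)%N ->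
  {in rts, forall c, lcomb t c \in Phi} ->
  (forall a, a \in Phi -> exists2 c, c \in rts & a = lcomb t c) ->
  coweight_vertex n rts node m -> simple_values ip t (unit_coords n node) u ->
  tight ((C / m%:R) *: u).
Proof.
set top := [seq c <- rts | c`_node == m%:Z] => node_n m_gt0 rts_root Phi_rts.
case/and3P => /allP le_m top0 /allP diff /(ip_lcomb_coweight _ node_n) uE.
have mR : (m%:R : R) != 0 by rewrite pnatr_eq0 -lt0n.
split=> [|x xt].
  apply/alcoved_supportP => a aP; have C_ge0 := support_ge0 aP.
  rewrite support_C // in C_ge0 *; have [c crts ->] := Phi_rts a aP.
  rewrite ipZr uE mulrAC ler_pdivrMr ?ltr0n // ler_wpM2l //.
  by rewrite -[m%:R]/(m%:Z%:~R) ler_int le_m.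
have top_x c : c \in top -> ip (lcomb t c) x = 0.
  rewrite mem_filter => /andP[/eqP cm /rts_root cP]; apply: xt => //.
  by rewrite /attains support_C // ipZr uE cm -[m%:Z%:~R]/m%:R divfK.
have x_off i : (i < n)%N -> i != node -> ip t`_i x = 0.
  move=> i_n inode; have := diff i; rewrite mem_iota i_n (negPf inode) => /(_ isT).
  case/hasP => c ctop /hasP[c' ctop' cc'].
  by rewrite -(lcomb_diff i_n cc') ipBl !top_x // subrr.
apply: (nth_ip_eq0 t_simple (ip := ip)) => i i_n.
have [->|] := eqVneq i node; last exact: x_off.
have /hasP[c ctop _] : has predT top by rewrite has_predT lt0n size_eq0.
have := top_x c ctop; rewrite ip_suml (bigD1 (Ordinal node_n)) //= big1 => [|k kn].
  rewrite addr0 ipZl; move: ctop; rewrite mem_filter => /andP[/eqP-> _] /eqP.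
  by rewrite mulf_eq0 -[m%:Z%:~R]/(m%:R) (negPf mR) => /eqP.
by rewrite ipZl x_off ?mulr0 // -val_eqE.
Qed.

Lemma certificate_generated node m w h h' : certificate M n node m w h ->
  has_order (cox t) h' -> generated_by_vertices h'.
Proof.
case/and5P=> /and4P[node_n m_gt0 h_gt0 wn] closed coweight period /andP[free_f cover] ord.
have Phi_rts := root_closed_roots Phi_root Phi_reduced t_simple t_cartan closed.
have rts_root := @coxeter_orbits_root _ _ _ _ _ _ Phi_root t_simple t_cartan h.
have [u uE] := simple_values_exists ip t_simple (unit_coords n node).
set f := foldr _ _ _ in free_f cover; pose W0 := coxeter_element ip [seq t`_i | i <- w].
have W0u : simple_values ip t f (W0 u) by apply: (coxeter_word_simple_values t_cartan).
have Wcox : W (cox t) by apply: weyl_coxeter => x; apply: simple_root t_simple x.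
have W_W0 : W W0.
  by apply: weyl_coxeter => _ /mapP[i /(allP wn) i_n ->]; apply: simple_nth_root t_simple _ i_n.
have ord_h := coxeter_order t_simple t_cartan h_gt0 period free_f.
rewrite (has_order_uniq ord ord_h); case: ord_h => _ cox_h _.
have vE : W0 ((C / m%:R) *: u) = (C / m%:R) *: W0 u by rewrite /W0 linearZ.
apply: (generated_by_orbit Wcox h_gt0 cox_h (v := W0 ((C / m%:R) *: u))).
- apply: weyl_tight W_W0 _.
  exact: coweight_vertex_tight node_n m_gt0 rts_root Phi_rts coweight uE.
- move=> a /Phi_rts[c crts ->]; have /hasP[j _ /eqP jm] := allP cover c crts.
  exists j; rewrite /attains support_C ?(weyl_root (weyl_iter j Wcox)) ?rts_root //.
  rewrite (iter_cox_lcomb t_cartan) vE ipZr (ip_lcomb _ W0u) jm -[m%:Z%:~R]/(m%:R) divfK //.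
  by rewrite pnatr_eq0 -lt0n.
- move=> Pn k kh; rewrite vE linearZ /= => /scalerI kW0u.
  apply: (coxeter_freeP t_cartan free_f W0u kh); apply: kW0u.
  by rewrite mulf_neq0 ?(support_const_neq0 support_C) ?invr_eq0 ?pnatr_eq0 -?lt0n.
Qed.

End Certificates.

Lemma E_cartanE k i j : (i < k)%N -> (j < k)%N -> cartan_entry (E_cartan k) i j =
  if i is i'.+1 then
    if j is j'.+1 then 2 * (i' == j')%:R - (i' == j'.+1)%:R - (i'.+1 == j')%:R
    else - (i' == 2)%N%:R
  else if j is j'.+1 then - (j' == 2)%N%:R else 2.
Proof.
move=> ik jk; rewrite /cartan_entry /E_cartan !nth_mkseq //.
case: i {ik} => [|i]; case: j {jk} => [|j]; rewrite //= ?xpair_eqE ?eqSS ?andbF ?orbF ?andbT.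
- by case: (j == _).
- by case: (i == _).
- by do 3![case: eqP => ?] => //=; lia.
Qed.

Lemma typeE_gram z L x y y' i j (t := [:: x, y', y, z & L]) :
  fork ip z [:: x] [:: y; y'] L -> (i < size t)%N -> (j < size t)%N ->
  ip t`_i t`_j = ip z z / 2 * (cartan_entry (E_cartan (size t)) i j)%:~R.
Proof.
move=> [[[[zx1 zx] _ _] [zy /orthogonalC zy' [yy' _ _]] zL] [xyy /orthogonal1lP xL yyL] _].
have [xy xy'] : ip x y = 0 /\ ip x y' = 0.
  by split; apply: (orthogonal1lP xyy); rewrite !inE eqxx ?orbT.
move: yyL; rewrite orthogonal_consl => /andP[yL y'L].
have y'_arm : arm ip y' [:: y, z & L].
  split; [exact: bondC yy'| |split; [exact: bondC zy|exact: yL|exact: zL]].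
  by apply/orthogonalC; rewrite orthogonal_consl; apply/andP; split=> //; apply: orthogonalC.
have y'y' : ip y' y' = ip z z by case: zy yy' => -> _ [->].
have row0 k : (k < (size L).+3)%N ->
    ip x [:: y', y, z & L]`_k = - (ip z z / 2) * (k == 2%N)%:R.
  case: k => [|[|[|k]]] /= kL; rewrite ?xy ?xy' ?mulr0 //; first by rewrite ipC zx; ring.
  by rewrite xL ?mem_nth.
move=> i_n jn; rewrite (E_cartanE i_n jn); move: i_n jn.
case: i => [|i]; case: j => [|j]; rewrite /= ?ltnS => i_n jn.
- by rewrite -zx1; field.
- by rewrite row0 // rmorphN /= rmorph_nat; ring.
- by rewrite ipC row0 // rmorphN /= rmorph_nat; ring.
- by rewrite (arm_gram y'_arm) // y'y' !rmorphB rmorphM /= !rmorph_nat.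
Qed.

Lemma dynkinE_generated z L x y y' h (t := [:: x, y', y, z & L]) :
  fork ip z [:: x] [:: y; y'] L -> (2 <= size L <= 4)%N ->
  simple_system Phi t -> has_order (cox t) h -> generated_by_vertices h.
Proof.
move=> fk sL simp ord_h; have sub : {subset z :: [:: x] ++ [:: y; y'] ++ L <= Phi}.
  move=> u; rewrite !inE => uL; apply: (simple_root simp); rewrite !inE.
  by case/or4P: uL => [->|->|->|/orP[]->]; rewrite ?orbT.
have zz : ip z z != 0 by rewrite ip_eq0 (root_neq0 Phi_root) ?sub ?mem_head.
have support_z a : a \in Phi -> support a = support z.
  move: a; apply: (support_single_class simp) => u uL; apply: (weyl_conj_fork sub fk).
  by move: uL; rewrite !inE => /or4P[->|->|->|/orP[]->]; rewrite ?orbT.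
have cartan i j : (i < size t)%N -> (j < size t)%N ->
    cartan_number ip t`_j t`_i = (cartan_entry (E_cartan (size t)) i j)%:~R.
  move=> i_n jn; rewrite /cartan_number ipC !(typeE_gram fk) //.
  have -> : cartan_entry (E_cartan (size t)) i i = 2 by rewrite /cartan_entry !nth_mkseq // eqxx.
  by field.
have generated n node m w k : size L = n ->
    certificate (E_cartan n.+4) n.+4 node m w k -> generated_by_vertices h.
  by move=> <- cert; apply: certificate_generated simp cartan support_z _ _ _ _ _ cert ord_h.
case sLE : (size L) sL => [|[|[|[|[|n]]]]] // _.
- exact: generated sLE certificate_E6.
- exact: generated sLE certificate_E7.
- exact: generated sLE certificate_E8.
Qed.

Definition G2_cartan : seq (seq int) := [:: [:: 2; -1]; [:: -3; 2]].

Section TypeG.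
Variables a s : V.
Hypotheses (aa : ip a a = 3 * ip s s) (as_bond : ip a s = - ip a a / 2).
Hypothesis t_simple : simple_system Phi [:: a; s].
Local Notation t := [:: a; s].
Local Notation rts := (coxeter_orbits G2_cartan 2 6).
Local Notation long := (support a).
Local Notation short := (support s).
Implicit Types (c : seq int).

Let sP : s \in Phi. Proof. by rewrite (simple_root t_simple) // !inE eqxx orbT. Qed.
Let ss_gt0 : 0 < ip s s. Proof. by rewrite ip_gt0 (root_neq0 Phi_root sP). Qed.

Lemma typeG_cartan i j : (i < size t)%N -> (j < size t)%N ->
  cartan_number ip t`_j t`_i = (cartan_entry G2_cartan i j)%:~R.
Proof.
rewrite /cartan_number; case: i => [|[|]] // _; case: j => [|[|]] // _ /=;
  by rewrite ?(ipC s a) ?as_bond ?aa /cartan_entry /=; field; rewrite gt_eqF.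
Qed.

Lemma typeG_order : has_order (cox t) 6.
Proof. by apply: (@coxeter_order _ _ _ _ _ _ t_simple typeG_cartan [:: 1; 0]); vm_compute. Qed.

Lemma typeG_lcomb_root c : c \in rts -> lcomb t c \in Phi.
Proof. exact: (coxeter_orbits_root Phi_root t_simple typeG_cartan). Qed.

Lemma typeG_roots x : x \in Phi -> exists2 c, c \in rts & x = lcomb t c.
Proof. by apply: (root_closed_roots Phi_root Phi_reduced t_simple typeG_cartan); vm_compute. Qed.

Lemma typeG_lcomb_ip c x : ip (lcomb t c) x = (c`_0)%:~R * ip a x + (c`_1)%:~R * ip s x.
Proof. by rewrite /lcomb !big_ord_recl big_ord0 addr0 ipDl !ipZl. Qed.

Definition G2_norm c : int := 3 * c`_0 ^+ 2 - 3 * (c`_0 * c`_1) + c`_1 ^+ 2.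

Lemma typeG_lcomb_norm c : ip (lcomb t c) (lcomb t c) = (G2_norm c)%:~R * ip s s.
Proof.
rewrite typeG_lcomb_ip ![ip _ (lcomb t c)]ipC !typeG_lcomb_ip (ipC s a) as_bond aa /G2_norm.
by rewrite !(rmorphD, rmorphB, rmorphM, rmorphXn) /=; field.
Qed.

Lemma typeG_support c : c \in rts -> support (lcomb t c) = if G2_norm c == 3 then long else short.
Proof.
move=> crts; have cP := typeG_lcomb_root crts.
have /allP/(_ c crts) : all (fun c => (G2_norm c == 3) || (G2_norm c == 1)) rts by vm_compute.
have as_norm : ip a a <> ip s s by rewrite aa; move: ss_gt0; lra.
case: eqP => [c3 _|_ /eqP c1].
  apply: (support_norm t_simple) cP (_ : _ = ip a a); last by rewrite typeG_lcomb_norm c3 aa.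
  by move=> u; rewrite !inE => /orP[]/eqP-> // /esym.
apply: (support_norm t_simple) cP (_ : _ = ip s s); last by rewrite typeG_lcomb_norm c1 mul1r.
by move=> u; rewrite !inE => /orP[]/eqP-> //.
Qed.

Lemma typeG_support_bounds : long <= 2 * short /\ 3 * short <= 2 * long.
Proof.
have lcombD c c' : lcomb t c + lcomb t c' = lcomb t (mkseq (fun k => c`_k + c'`_k) 2).
  by rewrite /lcomb -big_split; apply: eq_bigr => k _ /=; rewrite nth_mkseq // rmorphD scalerDl.
have := supportD (lcomb t [:: 1; 1]) (lcomb t [:: 1; 2]).
have := supportD (lcomb t [:: 1; 3]) (lcomb t [:: 2; 3]).
have -> : lcomb t [:: 1; 3] + lcomb t [:: 2; 3] = 3 *: lcomb t [:: 1; 2].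
  rewrite lcombD /lcomb !big_ord_recl !big_ord0 /= !addr0 scalerDr !scalerA.
  by congr (_ *: _ + _ *: _); ring.
rewrite lcombD supportZ // !typeG_support //=.
by rewrite mulr_natl; lra.
Qed.

(* The highest root and the highest short root. *)
Definition G2_tops : seq (seq int) := [:: [:: 2; 3]; [:: 1; 2]].

Lemma G2_tops_rts : {subset G2_tops <= rts}.
Proof. by apply/allP; vm_compute. Qed.

Lemma G2_le_top c : c \in rts -> exists d,
  [/\ d \in G2_tops, G2_norm d = G2_norm c, c`_0 <= d`_0 & c`_1 <= d`_1].
Proof.
have /allP below : all (fun c => has (fun d =>
    [&& G2_norm d == G2_norm c, c`_0 <= d`_0 & c`_1 <= d`_1]) G2_tops) rts by vm_compute.
by move/below/hasP => [d dtop /and3P[/eqP dc c0 c1]]; exists d.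
Qed.

(* These values make both tops attain their supports at v. *)
Section Vertex.
Variable v : V.
Hypotheses (av : ip a v = 2 * long - 3 * short) (sv : ip s v = 2 * short - long).

Lemma typeG_attains_top c : c \in G2_tops -> attains v (lcomb t c).
Proof.
move=> ctop; rewrite /attains typeG_lcomb_ip av sv typeG_support ?G2_tops_rts //.
by move: ctop; rewrite !inE => /orP[]/eqP-> /=; ring.
Qed.

Lemma typeG_tight : tight v.
Proof.
have [long_le short_le] := typeG_support_bounds; split.
  apply/alcoved_supportP => x /typeG_roots[c crts ->].
  have [d [dtop dc c0d c1d]] := G2_le_top crts.
  rewrite typeG_support // -dc -typeG_support ?G2_tops_rts // -(typeG_attains_top dtop).
  by rewrite !typeG_lcomb_ip lerD // ler_wpM2r ?ler_int // ?av ?sv subr_ge0.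
move=> x xt; have top0 c : c \in G2_tops -> ip (lcomb t c) x = 0.
  by move=> ctop; apply: xt; [apply/typeG_lcomb_root/G2_tops_rts|apply: typeG_attains_top].
apply: (simple_ip_eq0 (ip := ip) t_simple) => y.
have := top0 [:: 1; 2] isT; have := top0 [:: 2; 3] isT; rewrite !typeG_lcomb_ip /=.
by rewrite !inE => ? ? /orP[]/eqP->; lra.
Qed.

(* If the k-th power fixed v, the images of the two tops would still attain the supports at
   v; but their sum lies below that of the tops in both coordinates. *)
Lemma typeG_orbit_free k : P <> [set 0]%classic -> (0 < k < 6)%N -> iter k (cox t) v <> v.
Proof.
have [long_le short_le] := typeG_support_bounds; move=> Pn k6 kv.
have short_gt0 : 0 < short.
  rewrite lt_neqAle support_ge0 // andbT; apply: contra_not_neq Pn => short0.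
  apply: support_eq0 => x /typeG_roots[c crts ->]; rewrite typeG_support //.
  by case: ifP => _; lra.
have W_cox : W (cox t) by apply: weyl_coxeter => x; apply: simple_root t_simple x.
have top_k c : c \in G2_tops ->
    ip (lcomb t (iter k (coxeter_coords G2_cartan 2) c)) v = support (lcomb t c).
  move=> ctop; rewrite -(iter_cox_lcomb typeG_cartan) -{1}kv.
  by rewrite (weyl_isometry (weyl_iter k W_cox)) typeG_attains_top.
have := top_k [:: 1; 2] isT; have := top_k [:: 2; 3] isT.
rewrite !typeG_lcomb_ip !typeG_support // av sv {top_k}.
have /allP/(_ k) : all (fun k => let c := iter k (coxeter_coords G2_cartan 2) [:: 2; 3] in
    let d := iter k (coxeter_coords G2_cartan 2) [:: 1; 2] in
    (c`_0 + d`_0 <= 2) && (c`_1 + d`_1 <= 4)) (iota 1 5) by vm_compute.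
rewrite mem_iota => /(_ k6)/andP[]; set c := iter k _ _; set d := iter k _ _.
rewrite -!(ler_int R) !rmorphD /= => cd0 cd1.
have av_ge0 : 0 <= 2 * long - 3 * short by lra.
have sv_ge0 : 0 <= 2 * short - long by lra.
by have := ler_wpM2r av_ge0 cd0; have := ler_wpM2r sv_ge0 cd1; rewrite !mulrDl; lra.
Qed.

End Vertex.

Lemma typeG_generated : generated_by_vertices 6.
Proof.
have [v [av sv]] : exists v, ip a v = 2 * long - 3 * short /\ ip s v = 2 * short - long.
  have sa : s != a by apply/eqP => sa; move: aa ss_gt0; rewrite sa; lra.
  have [v vP] := riesz ip (fun y => if y == a then 2 * long - 3 * short else 2 * short - long)
    (simple_free t_simple).
  by exists v; rewrite !vP ?inE ?eqxx ?orbT // (negPf sa).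
have W_cox : W (cox t) by apply: weyl_coxeter => x; apply: simple_root t_simple x.
have [_ cox6 _] := typeG_order.
apply: (generated_by_orbit W_cox _ cox6 (typeG_tight av sv)) => // [x|Pn k].
  case/typeG_roots => c crts ->.
  have /allP/(_ c crts)/hasP[k _ ctop] : all (fun c => has (fun k =>
      iter k (coxeter_coords G2_cartan 2) c \in G2_tops) (iota 0 6)) rts by vm_compute.
  by exists k; rewrite (iter_cox_lcomb typeG_cartan); apply: typeG_attains_top.
exact: typeG_orbit_free.
Qed.

End TypeG.

Lemma dynkinG_generated z x h : mbond ip 3 z x ->
  (forall t, perm_eq [:: z; x] t -> simple_system Phi t /\ has_order (cox t) h) ->
  generated_by_vertices h.
Proof.
move=> zx orders; have [a [u [au_perm aa au]]] : exists a u,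
    [/\ perm_eq [:: z; x] [:: a; u], ip a a = 3 * ip u u & ip a u = - ip a a / 2].
  case: zx => -[norm zx]; first by exists z, x.
  by exists x, z; rewrite ipC; split=> //; perm_by_count.
have [simp ord_h] := orders _ au_perm.
rewrite (has_order_uniq ord_h (typeG_order aa au simp)).
exact: typeG_generated aa au simp.
Qed.

End SymmetricAlcoved.

Section TypeF.
Variables (R : realType) (V : vectType R) (ip : {dot V for idfun}) (Phi : {fset V}).
Implicit Types (x y z u v : V).

Lemma F4_diagram y z u v : bond ip y z -> bond ip u v ->
  ip z z = 2 * ip u u -> ip z u = - ip z z / 2 -> ip y u = 0 -> ip y v = 0 -> ip z v = 0 ->
  u != 0 -> simple_system Phi [:: y; z; u; v] -> type_F4 ip Phi.
Proof.
rewrite -(ip_eq0 ip) => -[yy yz] [vv uv] zz zu yu yv zv uu simp.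
exists [:: y; z; u; v]; split=> //; first exact/simple_systemP.
rewrite yy zz in yz; rewrite zz in yy zu; rewrite /cartan_number.
case=> [|[|[|[|//]]]]; case=> [|[|[|[|//]]]] _ _; rewrite /= ?rmorphN /=;
  rewrite ?[ip z y]ipC ?[ip u y]ipC ?[ip v y]ipC ?[ip u z]ipC ?[ip v z]ipC ?[ip v u]ipC;
  rewrite ?(yy, yz, zz, zu, yu, yv, zv, uv) -?vv ?mulr0 ?mul0r //; by field.
Qed.

Lemma dynkinF_type_F4 y z u v : root_system ip Phi -> multi ip 2 z [:: y] u [:: v] ->
  simple_system Phi [:: y; z; u; v] -> type_F4 ip Phi.
Proof.
move=> Phi_root [_ zu [[zy _ _] [uv _ _]] /orthogonalP ov /orthogonalP oy] simp.
have [yu yv zv] : [/\ ip y u = 0, ip y v = 0 & ip z v = 0].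
  by split; [apply: oy|apply: ov|apply: ov]; rewrite !inE eqxx ?orbT.
have [z0 u0] : z != 0 /\ u != 0.
  by split; apply: (simple_neq0 Phi_root simp); rewrite !inE eqxx ?orbT.
case: zu => -[norm zu]; first exact: F4_diagram (bondC zy) uv norm zu yu yv zv u0 simp.
have simp' : simple_system Phi [:: v; u; z; y].
  by apply: simple_system_perm simp; perm_by_count.
by apply: (F4_diagram (bondC uv) zy norm _ _ _ _ z0 simp'); rewrite ipC.
Qed.

End TypeF.

Theorem theorem4p3 (R : realType) (V : vectType R) (ip : {dot V for idfun})
    (Phi : {fset V}) (h : nat) (P : set V)
    (Phi_root : root_system ip Phi)
    (Phi_reduced : reduced Phi)
    (Phi_irreducible : irreducible ip Phi)
    (Phi_notF4 : ~ type_F4 ip Phi)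
    (h_coxeter : coxeter_number ip Phi h)
    (P_nonempty : (P !=set0)%classic)
    (P_alcoved : alcoved_polytope ip Phi P)
    (P_symmetric : weyl_symmetric ip Phi P) :
  exists v : 'I_h -> V,
    [/\ (forall i, vertex ip P (v i)),
        generating_set ip Phi P (range v)
      & P <> [set 0]%classic -> injective v].
Proof.
case: h_coxeter => b [/simple_systemP b_simple b_order].
have b_neq0 := simple_nonempty Phi_root b_simple Phi_irreducible.
have [t [tb t_tree t_dynkin]] := dynkin_classification
  (simple_admissible Phi_root b_simple)
  (simple_connected Phi_root Phi_reduced b_simple Phi_irreducible) b_neq0.
have orders t' := simple_system_reorder Phi_root b_simple tb t_tree b_order (t' := t').
case: t_dynkin => [z L zL|z L x zLx|z L x y zxyL|z L x y y' zxyL szL|z x y x' zx|z x [_ zx _ _ _]]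
  tE.
- by have [simp ord] := orders _ tE; apply: dynkinA_generated zL simp ord.
- by have [simp ord] := orders _ tE; apply: dynkinBC_generated zLx simp ord.
- by have [simp ord] := orders _ tE; apply: dynkinD_generated zxyL simp ord.
- by have [simp ord] := orders _ tE; apply: dynkinE_generated zxyL szL simp ord.
- by have [simp _] := orders _ tE; case: Phi_notF4; apply: dynkinF_type_F4 zx simp.
- by apply: dynkinG_generated zx _ => // t' /(perm_trans tE)/orders.
Qed.
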